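(* Let $N\ge1$, $\gamma\ge0$, $s\in(0,1)$ and $0<s<\frac{N(\gamma+1)}{2}$. Let $\varphi\in L^1(\mathbb{R}^N)\cap L^\infty(\mathbb{R}^N)$ be nonnegative, and let $v$ be the solution of $$\partial_t v(x,t)=t^\gamma\big(\Delta-(-\Delta)^s\big)v(x,t)\ \text{ in }\mathbb{R}^N\times(0,\infty),\qquad v(x,0)=\varphi(x)\ \text{ in }\mathbb{R}^N.$$ Then $v$ is nonnegative and integrable in time, i.e. $v(x,\cdot)\in L^1(0,\infty)$. Moreover, let $\mathbf{S}$ be a subordinator with associated kernel $\mathbf{k}$, Laplace transform $\mathcal{K}$ of $\mathbf{k}$, and associated density $G_t$, and assume that $$\lim_{\lambda\to0^+}\lambda\,\mathcal{K}(\lambda)=0$$ and that, for some $\varrho\ge0$, the function $L(x):=x^{-\varrho}\mathcal{K}(x^{-1})$ is slowly varying at infinity, i.e. $\lim_{x\to\infty}L(\lambda x)/L(x)=1$ for all $\lambda>0$. Then the Cesàro mean of the subordinated solution $v^E$ satisfies $$\mathbf{M}_t(v^E(x,t))\ \sim\ \frac{\|v(x,\cdot)\|_1}{\Gamma(\varrho+1)}\,t^{\varrho-1}L(t)\qquad\text{as }t\to\infty.$$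
   Context: Notation. $f(t)\sim g(t)$ as $t\to\infty$ means $\lim_{t\to\infty}f(t)/g(t)=1$. $\Gamma$ is the Gamma function. $\|v(x,\cdot)\|_1=\int_0^\infty |v(x,\tau)|\,d\tau$ is the $L^1(0,\infty)$ norm in time. The fractional Laplacian is $(-\Delta)^s u=\mathcal{F}^{-1}(|\xi|^{2s}\mathcal{F}u)$ with $\mathcal{F}$ the Fourier transform in $x$. Subordinators. A subordinator $\mathbf{S}=\{\mathbf{S}_t\}_{t\ge0}$ is a non-decreasing Lévy process with values in $[0,\infty)$, $\mathbf{S}_0=0$. Its Laplace transform is $\mathbb{E}[e^{-\lambda\mathbf{S}_t}]=e^{-t\Phi(\lambda)}$, $\lambda\ge0$, where $\Phi(\lambda)=\int_0^\infty(1-e^{-\lambda\tau})\,d\sigma(\tau)$ and the Lévy measure $\sigma$ satisfies $\int_0^\infty(1\wedge\tau)\,d\sigma(\tau)<\infty$. The associated kernel is $\mathbf{k}(t)=\sigma((t,\infty))$, assumed positive and in $L^1_{\mathrm{loc}}(0,\infty)$, and $\mathcal{K}(\lambda)=\int_0^\infty e^{-\lambda t}\mathbf{k}(t)\,dt=\Phi(\lambda)/\lambda$, so that $\Phi(\lambda)=\lambda\mathcal{K}(\lambda)$. The inverse subordinator is $E_t=\inf\{r\ge0:\mathbf{S}_r\ge t\}$, and $G_t(\tau)$ denotes its marginal density: $G_t(\tau)=\partial_\tau\mathbb{P}(E_t\le\tau)=-\partial_\tau\mathbb{P}(\mathbf{S}_\tau<t)$. Subordinated solution and Cesàro mean. $$v^{E}(x,t)=\int_0^\infty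 v(x,\tau)G_t(\tau)\,d\tau,\qquad \mathbf{M}_t(v^{E}(x,t))=\frac1t\int_0^t v^{E}(x,r)\,dr,\qquad (x,t)\in\mathbb{R}^N\times(0,\infty).$$ *)

(* Defs.v *)
From HB Require Import structures.
From mathcomp Require Import all_boot all_order all_algebra.
From mathcomp Require Import complex.
From mathcomp Require Import all_classical all_reals all_analysis.

Set Implicit Arguments.
Unset Strict Implicit.
Unset Printing Implicit Defensive.

Import Order.TTheory GRing.Theory Num.Theory.
Import numFieldNormedType.Exports.

Local Open Scope classical_set_scope.
Local Open Scope ring_scope.

(* The Borel sigma-algebra of R^n, generated by the coordinate maps; this is
   the same construction as the one of the library for n.-tuple R. *)
Definition rV_display : measure_display.
Proof. exact. Qed.

Section rV_measurable.
Context {R : realType} (n : nat).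

Let coord (i : 'I_n) (x : 'rV[R]_n) : measurableTypeR R := x ord0 i.

Let rV_set0 : g_sigma_preimage coord set0.
Proof. exact: sigma_algebra0. Qed.

Let rV_setC A : g_sigma_preimage coord A -> g_sigma_preimage coord (~` A).
Proof. exact: sigma_algebraC. Qed.

Let rV_bigcup (F : _^nat) : (forall i, g_sigma_preimage coord (F i)) ->
  g_sigma_preimage coord (\bigcup_i (F i)).
Proof. exact: sigma_algebra_bigcup. Qed.

HB.instance Definition _ := @isMeasurable.Build rV_display
  'rV[R]_n (g_sigma_preimage coord) rV_set0 rV_setC rV_bigcup.

Lemma measurable_coord (i : 'I_n) :
  measurable_fun [set: 'rV[R]_n] (fun x => x ord0 i : measurableTypeR R).
Proof.
move=> _ Y mY; rewrite setTI; apply: sub_sigma_algebra => /=.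
rewrite -bigcup_seq/=; exists i => /=; first by rewrite mem_index_enum.
by exists Y => //; rewrite setTI.
Qed.

Lemma measurable_fun_rV d (T : measurableType d) (f : T -> 'rV[R]_n) :
  (forall i, measurable_fun [set: T]
    (fun x => f x ord0 i : measurableTypeR R)) ->
  measurable_fun [set: T] f.
Proof.
move=> mf.
suff : preimage_set_system [set: T] f (g_sigma_preimage coord) `<=` measurable.
  by move=> h _ A mA; apply: h; exists A.
rewrite -g_sigma_preimage_comp.
apply: smallest_sub; first exact: sigma_algebra_measurable.
rewrite -bigcup_seq; apply: bigcup_sub => i _ A [B mB <-].
exact: mf.
Qed.

End rV_measurable.

Section lebesgue_rV.
Context {R : realType}.

Definition rV_cons (n : nat) (p : measurableTypeR R * 'rV[R]_n) :
    'rV[R]_n.+1 :=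
  row_mx (const_mx p.1 : 'rV[R]_1) p.2.

Lemma rV_cons0 n p (j : 'I_1) : @rV_cons n p ord0 (lshift n j) = p.1.
Proof. exact: etrans (row_mxEl _ _ _ _) (mxE _ _ _ _). Qed.

Lemma rV_consS n p (j : 'I_n) :
  @rV_cons n p ord0 (rshift 1 j) = p.2 ord0 j.
Proof. exact: row_mxEr. Qed.

Lemma measurable_rV_cons n : measurable_fun setT (@rV_cons n).
Proof.
apply: measurable_fun_rV => i.
case: (@splitP 1 n i) => j ij.
  have -> : i = lshift n j by exact: val_inj.
  by under eq_fun do rewrite rV_cons0; exact: measurable_fst.
have -> : i = rshift 1 j by exact: val_inj.
under eq_fun do rewrite rV_consS.
exact: (measurableT_comp (measurable_coord j)).
Qed.

Definition rV_measure_cons n (m : {measure set 'rV[R]_n -> \bar R}) :=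
  pushforward (@lebesgue_measure R \x^ m)%E (@rV_cons n).

HB.instance Definition _ n (m : {measure set 'rV[R]_n -> \bar R}) :=
  Measure.copy (rV_measure_cons m)
    (measure_function_pushforward__canonical__measure_function_Measure
      (@lebesgue_measure R \x^ m)%E (@measurable_rV_cons n)).

(* Lebesgue measure on R^n: the n-fold product of Lebesgue measure on R,
   transported along R * R^n ~ R^(1+n). *)
Fixpoint lebesgue_rV (n : nat) : {measure set 'rV[R]_n -> \bar R} :=
  match n with
  | 0 => \d_(0 : 'rV[R]_0)
  | n.+1 => rV_measure_cons (lebesgue_rV n)
  end.

Lemma lebesgue_rV_box n (A : 'I_n -> set R) :
  (forall i, measurable (A i : set (measurableTypeR R))) ->
  lebesgue_rV n [set x | forall i, A i (x ord0 i)] =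
  (\prod_(i < n) lebesgue_measure (A i))%E.
Proof.
elim: n A => [|n IH] A mA.
  rewrite big_ord0 /= diracE mem_set//=.
  by case.
rewrite big_ord_recl /= /rV_measure_cons /pushforward.
have lift1 (i : 'I_n) : lift ord0 i = rshift 1 i by exact: val_inj.
pose B := [set y : 'rV[R]_n | forall i, A (lift ord0 i) (y ord0 i)].
have -> : @rV_cons n @^-1` [set x | forall i, A i (x ord0 i)] = A ord0 `*` B.
  apply/seteqP; split => -[a y] /=.
    move=> h; split => /= [|i].
      have := h ord0; have {2}-> : ord0 = lshift n (ord0 : 'I_1) by exact: val_inj.
      by rewrite rV_cons0.
    have := h (lift ord0 i).
    by rewrite {2}(lift1 i) rV_consS.
  move=> [/= Aa By] i; case: (unliftP ord0 i) => [j ->|->].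
    have := By j.
    by rewrite {3}(lift1 j) rV_consS.
  move: Aa; have -> : (ord0 : 'I_n.+1) = lshift n (ord0 : 'I_1) by exact: val_inj.
  by rewrite rV_cons0.
have mB : measurable B.
  rewrite (_ : B = \big[setI/setT]_(i < n)
      ((fun y : 'rV[R]_n => y ord0 i : measurableTypeR R) @^-1` A (lift ord0 i))).
    by apply: bigsetI_measurable => i _; rewrite -[X in measurable X]setTI;
      exact: measurable_coord.
  rewrite -bigcap_seq; apply/seteqP; split => y /= h i; first by move=> _; exact: h.
  by apply: h; rewrite /= mem_index_enum.
rewrite product_measure2E; [|exact: mA|exact: mB].
by rewrite -(IH (fun i => A (lift ord0 i)))// => i; exact: mA.
Qed.

End lebesgue_rV.


Section differential_operators.
Context {R : realType} {N : nat}.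
Implicit Types (f : 'rV[R]_N -> R) (x xi : 'rV[R]_N).

Definition dotr x xi : R := \sum_(i < N) x ord0 i * xi ord0 i.

(* The norm of the normedModType 'rV[R]_N is the sup norm; the symbol of the
   fractional Laplacian needs the Euclidean one. *)
Definition enorm x : R := Num.sqrt (dotr x x).

Definition partial (i : 'I_N) f x : R := 'D_(delta_mx ord0 i) f x.

Definition laplacian f x : R := \sum_(i < N) partial i (partial i f) x.

Definition has_cont_partials f : Prop :=
  forall i : 'I_N,
    (forall x, derivable f x (delta_mx ord0 i)) /\ continuous (partial i f).

Definition C2 f : Prop :=
  [/\ continuous f, has_cont_partials f &
      forall i : 'I_N, has_cont_partials (partial i f)].

End differential_operators.

Section fourier.
Local Open Scope complex_scope.
Context {R : realType} {N : nat}.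
Implicit Types (u : 'rV[R]_N -> R) (g : 'rV[R]_N -> R[i]) (x xi : 'rV[R]_N).

Local Notation mu := (@lebesgue_rV R N).

Definition cintegrable g : Prop :=
  mu.-integrable setT (fun x => (complex.Re (g x))%:E) /\
  mu.-integrable setT (fun x => (complex.Im (g x))%:E).

Definition cintegral g : R[i] :=
  (\int[mu]_x complex.Re (g x)) +i* (\int[mu]_x complex.Im (g x)).

Definition expi (theta : R) : R[i] := cos theta +i* sin theta.

(* F g (xi) = \int g(x) e^{-i x.xi} dx, the normalization for which
   -Laplacian has symbol |xi|^2. *)
Definition fourier g xi : R[i] :=
  cintegral (fun x => g x * expi (- dotr x xi)).

Definition inv_fourier g x : R[i] :=
  ((2 * pi) ^- N)%:C * cintegral (fun xi => g xi * expi (dotr x xi)).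

Definition fourierR u : 'rV[R]_N -> R[i] := fourier (fun x => (u x)%:C).

Definition frac_laplacian (s : R) u x : R[i] :=
  inv_fourier (fun xi => (enorm xi `^ (2 * s))%:C * fourierR u xi) x.

End fourier.

Section cauchy_problem.
Local Open Scope complex_scope.
Context {R : realType} {N : nat}.

Local Notation mu := (@lebesgue_rV R N).

(* v solves  d_t v = t^gamma (Delta - (-Delta)^s) v,  v(.,0) = phi:
   classical solutions that are continuous on [0, oo[ and differentiable on
   ]0, oo[ as L^1(R^N)-valued maps, and for which -Delta and (-Delta)^s act as
   absolutely convergent Fourier multipliers. The integrability and continuity
   requirements are those under which the equation is meaningful and the
   solution unique. The equation is stated in R[i] because frac_laplacian is
   complex-valued by construction. *)
Record cauchy_solution (gamma s : R) (phi : 'rV[R]_N -> R)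
    (v : 'rV[R]_N -> R -> R) : Prop := {
  sol_L1 : forall t : R, 0 <= t -> (v ^~ t) \in Lfun mu 1%E ;
  sol_C2 : forall t : R, 0 < t -> C2 (v ^~ t) ;
  sol_multiplier : forall t : R, 0 < t ->
    cintegrable (fun xi => (enorm xi ^+ 2)%:C * fourierR (v ^~ t) xi) /\
    cintegrable (fun xi => (enorm xi `^ (2 * s))%:C * fourierR (v ^~ t) xi) ;
  sol_derivable : forall x (t : R), 0 < t -> derivable (v x) t 1 ;
  sol_equation : forall x (t : R), 0 < t ->
    ('D_1 (v x) t)%:C =
    (t `^ gamma)%:C *
      ((laplacian (v ^~ t) x)%:C - frac_laplacian s (v ^~ t) x) ;
  sol_derivable_L1 : forall t : R, 0 < t ->
    (\int[mu]_x `| h^-1 * (v x (t + h) - v x t) - 'D_1 (v x) t |%:E)%E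
      @[h --> 0^'] --> 0%E ;
  sol_initial : {ae mu, forall x, v x 0 = phi x} ;
  sol_initial_L1 :
    (\int[mu]_x `| v x t - phi x |%:E)%E @[t --> 0^'+] --> 0%E }.

End cauchy_problem.

Section subordinators.
Context {R : realType} d (T : measurableType d) (P : probability T R).

(* Independent increments: those over [t_0, t_1], ..., [t_(n-1), t_n] are
   mutually independent whenever 0 <= t_0 <= ... <= t_n. *)
Record levy_process (S : R -> {RV P >-> R}) : Prop := {
  levy0 : forall w, S 0 w = 0 ;
  levy_independent : forall (n : nat) (t : nat -> R) (B : nat -> set R),
    0 <= t 0 -> (forall i, t i <= t i.+1) ->
    (forall i, measurable (B i : set (measurableTypeR R))) ->
    P [set w | forall i, (i < n)%N -> B i (S (t i.+1) w - S (t i) w)] =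
    (\prod_(i < n) P [set w | B i (S (t i.+1) w - S (t i) w)%R])%E ;
  levy_stationary : forall (t h : R) (B : set R), 0 <= t -> 0 <= h ->
    measurable (B : set (measurableTypeR R)) ->
    P [set w | B (S (t + h) w - S t w)] = P [set w | B (S h w)] ;
  levy_right_continuous : forall w (t : R), 0 <= t ->
    S u w @[u --> t^'+] --> S t w ;
  levy_left_limits : forall w (t : R), 0 < t -> cvg (S u w @[u --> t^'-]) }.

Definition laplace_exponent (sigma : {measure set (measurableTypeR R) -> \bar R})
    (lambda : R) : R :=
  \int[sigma]_(tau in `]0, +oo[) (1 - expR (- (lambda * tau))).

(* S is a subordinator without drift and with Levy measure sigma; only the
   restriction of sigma to ]0, +oo[ matters. *)
Record subordinator (S : R -> {RV P >-> R})
    (sigma : {measure set (measurableTypeR R) -> \bar R}) : Prop := {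
  sub_levy : levy_process S ;
  sub_ge0 : forall w (t : R), 0 <= t -> 0 <= S t w ;
  sub_nondecreasing : forall w (t u : R), 0 <= t -> t <= u -> S t w <= S u w ;
  sub_levy_measure :
    (\int[sigma]_(tau in `]0%R, +oo[) (Num.min 1 tau)%:E < +oo)%E ;
  sub_laplace : forall lambda t : R, 0 <= lambda -> 0 <= t ->
    ('E_P[fun w => expR (- (lambda * S t w))] =
     (expR (- (t * laplace_exponent sigma lambda)))%:E)%E }.

(* E_t = inf {r >= 0 : S_r >= t}, equal to +oo when S stays below t. *)
Definition inverse_subordinator (S : R -> {RV P >-> R}) (t : R) (w : T) :
    \bar R :=
  ereal_inf [set r%:E | r in [set r : R | 0 <= r /\ t <= S r w]].

(* G_t = d/dtau P(E_t <= tau) in the sense of densities *)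
Definition inverse_density (S : R -> {RV P >-> R}) (G : R -> R -> R) : Prop :=
  forall t : R, 0 < t ->
  [/\ measurable_fun (`]0%R, +oo[ : set R) (G t),
      forall tau : R, 0 < tau -> 0 <= G t tau &
      forall tau : R, 0 <= tau ->
        P [set w | (inverse_subordinator S t w <= tau%:E)%E] =
        (\int[lebesgue_measure]_(r in `]0%R, tau]) (G t r)%:E)%E].

End subordinators.

Section kernels.
Context {R : realType}.
Local Notation leb := (@lebesgue_measure R).

Definition levy_kernel (sigma : {measure set (measurableTypeR R) -> \bar R})
    (t : R) : R := fine (sigma `]t, +oo[%classic).

Definition admissible_kernel (k : R -> R) : Prop :=
  (forall t : R, 0 < t -> 0 < k t) /\ locally_integrable `]0, +oo[ k.

Definition laplace_transform (k : R -> R) (lambda : R) : R :=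
  \int[leb]_(t in `]0, +oo[) (expR (- (lambda * t)) * k t).

Definition slowly_varying (L : R -> R) : Prop :=
  forall lambda : R, 0 < lambda -> L (lambda * x) / L x @[x --> +oo] --> (1 : R).

Definition asymp_equiv (f g : R -> R) : Prop :=
  f t / g t @[t --> +oo] --> (1 : R).

Definition Gamma (a : R) : R :=
  \int[leb]_(t in `]0, +oo[) (t `^ (a - 1) * expR (- t)).

Definition L1_norm_time (f : R -> R) : R :=
  \int[leb]_(t in `]0, +oo[) `|f t|.

Definition subordinated (f : R -> R) (G : R -> R -> R) (t : R) : R :=
  \int[leb]_(tau in `]0, +oo[) (f tau * G t tau).

Definition cesaro_mean (f : R -> R) (t : R) : R :=
  t^-1 * \int[leb]_(r in `]0, t[) f r.

End kernels.

(* Main.v *)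
From HB Require Import structures.
Require Import Defs.
From mathcomp Require Import all_boot all_order all_algebra.
From mathcomp Require Import complex.
From mathcomp Require Import all_classical all_reals all_analysis.
From mathcomp Require Import measurable_realfun ess_sup_inf.
From mathcomp Require Import ring lra.

Import Order.TTheory GRing.Theory Num.Theory.
Import numFieldNormedType.Exports.

Set Implicit Arguments.
Unset Strict Implicit.
Unset Printing Implicit Defensive.

Local Open Scope classical_set_scope.
Local Open Scope ring_scope.

(** Write w(xi) = |xi|^2 + |xi|^(2s) for the symbol of -Delta + (-Delta)^s.

    Formula. Integrating the equation against cos(x.xi) and sin(x.xi) turns it
    into the scalar equation y' = - t^gamma w(xi) y. Hence the transform of
    v(., t) is exp(- clock(t) w(xi)) times that of phi, where clock is the
    primitive of t^gamma, and v is recovered by Fourier inversion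
    ([solution_formula]). The Fourier analysis is real: [cosT] and [sinT] are the
    cosine and sine transforms and [synth A B] superposes waves with amplitudes A
    and B. It rests on Gaussians, whose transforms are explicit
    ([normal_pdf_cos], [gaussN_cos]) and which form an approximate identity
    ([gaussN_approx]); this gives inversion in both directions
    ([fourier_inversion], [synth_transform]).

    Positivity. The factor exp(- clock(t) |xi|^2) of the multiplier averages phi
    against a Gaussian density. The factor exp(- clock(t) |xi|^(2s)) preserves
    lower bounds too: multipliers with this property are stable under sums,
    products and pointwise limits, and since 1 - (1 - z)^s is a power series with
    nonnegative coefficients, the stable factor can be reached from Gaussians by
    these operations ([posmult_stable]). So v takes its values between 0 and the
    supremum of phi ([solution_bound]), and v > 0 unless phi = 0
    ([solution_gt0]).

    Integrability in time. |v(x, t)| is at most a multiple of the integral of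
    exp(- clock(t) |xi|^(2s)), which is of order t^(- N (gamma + 1) / (2 s)); the
    exponent is less than -1 by hypothesis ([solution_integrable]).

    Subordination. Since E_r <= tau means S_tau >= r, the function G_r is the
    density of tau |-> P(S_tau >= r), whose Laplace transform in r is
    (1 - exp(- tau Phi(lambda))) / lambda. Step functions in tau extend this to
    the Laplace transform of the subordinated function, which is
    K(lambda) times the integral of v(x, tau) exp(- tau Phi(lambda))
    ([laplace_subordinated], with Phi(lambda) = lambda K(lambda) from
    [laplace_exponentE]). As lambda tends to 0 so does Phi(lambda), and the
    integral tends to the norm of v(x, .).

    Tauberian step. The kernel K is regularly varying of exponent - rho at 0, so
    Karamata's theorem ([karamata]) converts the asymptotics of the Laplace
    transform into that of the primitive, which is t times the Cesaro mean. It is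
    deduced from a continuity property of the Laplace transform on monotone
    functions ([monotone_laplace_continuity]), where the polynomials in exp(- u)
    that localize near a point are Landau kernels. *)

(** * Integrals of real functions *)

Section real_integrals.
Context d (T : measurableType d) (R : realType) (mu : {measure set T -> \bar R}).
Variables (D : set T) (mD : measurable D).

Lemma integrable_le (f g : T -> R) : measurable_fun D f ->
  mu.-integrable D (EFin \o g) -> (forall x, D x -> `|f x| <= g x) ->
  mu.-integrable D (EFin \o f).
Proof.
move=> mf ig fg; apply: le_integrable ig => //; first exact/measurable_EFinP.
by move=> x Dx /=; rewrite lee_fin (le_trans (fg _ Dx))// ler_norm.
Qed.

Lemma integrable_measurable (f : T -> R) :
  mu.-integrable D (EFin \o f) -> measurable_fun D f.
Proof. by move=> /measurable_int/measurable_EFinP. Qed.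

Lemma integrable_mulr (r : R) (f : T -> R) : mu.-integrable D (EFin \o f) ->
  mu.-integrable D (EFin \o (fun x => r * f x)).
Proof.
by move=> fi; rewrite (_ : _ \o _ = (fun x => r%:E * (EFin \o f) x)%E)//;
  apply: integrableZl.
Qed.

Lemma integrable_add (f g : T -> R) : mu.-integrable D (EFin \o f) ->
  mu.-integrable D (EFin \o g) ->
  mu.-integrable D (EFin \o (fun x => f x + g x)).
Proof.
by move=> fi gi; rewrite (_ : _ \o _ = ((EFin \o f) \+ (EFin \o g))%E)//;
  apply: integrableD.
Qed.

Lemma integrable_sub (f g : T -> R) : mu.-integrable D (EFin \o f) ->
  mu.-integrable D (EFin \o g) ->
  mu.-integrable D (EFin \o (fun x => f x - g x)).
Proof.
by move=> fi gi; rewrite (_ : _ \o _ = ((EFin \o f) \- (EFin \o g))%E)//;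
  apply: integrableB.
Qed.

Lemma integrable_normr (f : T -> R) : mu.-integrable D (EFin \o f) ->
  mu.-integrable D (EFin \o (fun x => `|f x|)).
Proof. by move=> /integrable_abse. Qed.

Lemma integrable_mulb (M : R) (b f : T -> R) : measurable_fun D b ->
  (forall x, D x -> `|b x| <= M) -> mu.-integrable D (EFin \o f) ->
  mu.-integrable D (EFin \o (fun x => b x * f x)).
Proof.
move=> mb bM fi; apply: (@integrable_le _ (fun x => M * `|f x|)).
- by apply: measurable_funM => //; exact: integrable_measurable.
- by apply: integrable_mulr; exact: integrable_normr.
- by move=> x Dx; rewrite normrM ler_wpM2r// bM.
Qed.

Lemma integrable_mulbr (M : R) (b f : T -> R) : measurable_fun D b ->
  (forall x, D x -> `|b x| <= M) -> mu.-integrable D (EFin \o f) ->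
  mu.-integrable D (EFin \o (fun x => f x * b x)).
Proof.
move=> mb bM /(integrable_mulb mb bM); congr (mu.-integrable _ (EFin \o _)).
by apply/funext => x; rewrite mulrC.
Qed.

Lemma Rintegral_dct (f_ : nat -> T -> R) (f g : T -> R) :
  (forall n, measurable_fun D (f_ n)) ->
  (forall x, D x -> f_ ^~ x @ \oo --> f x) ->
  mu.-integrable D (EFin \o g) ->
  (forall n x, D x -> `|f_ n x| <= g x) ->
  mu.-integrable D (EFin \o f) /\
  (\int[mu]_(x in D) f_ n x @[n --> \oo] --> \int[mu]_(x in D) f x).
Proof.
move=> mf_ f_f ig f_g.
have mf : measurable_fun D f.
  by apply: (measurable_fun_cvg mf_).
have [fi _ cv] : [/\ mu.-integrable D (EFin \o f),
  [sequence \int[mu]_(x in D) `|(EFin \o f_ n) x - (EFin \o f) x|]_n @ \oo --> 0 &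
  [sequence \int[mu]_(x in D) ((EFin \o f_ n) x)]_n @ \oo --> \int[mu]_(x in D) ((EFin \o f) x) ]%E.
  apply: (@dominated_convergence _ _ _ mu D mD _ _ (EFin \o g)).
  - by move=> n; apply/measurable_EFinP.
  - exact/measurable_EFinP.
  - apply/aeW => x Dx; apply: cvg_EFin; first exact: nearW.
    exact: f_f.
  - by [].
  - by apply/aeW => x n Dx; rewrite /= lee_fin f_g.
split => //.
by apply: fine_cvg; rewrite fineK//; exact: integrable_fin_num.
Qed.

End real_integrals.

(** A copy of a measure that remembers a proof of sigma-finiteness, so that the
    Fubini theorems, which ask for a sigma-finite structure, apply to measures
    whose sigma-finiteness is a lemma. *)
Definition sigma_finite_of d (T : measurableType d) (R : realType)
  (m : {measure set T -> \bar R}) of sigma_finite setT m : set T -> \bar R := m.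

HB.instance Definition _ d (T : measurableType d) (R : realType)
    (m : {measure set T -> \bar R}) (s : sigma_finite setT m) :=
  Measure.copy (sigma_finite_of s) m.

HB.instance Definition _ d (T : measurableType d) (R : realType)
    (m : {measure set T -> \bar R}) (s : sigma_finite setT m) :=
  @Measure_isSigmaFinite.Build _ _ _ (sigma_finite_of s) s.

Section real_fubini.
Context d1 d2 (T1 : measurableType d1) (T2 : measurableType d2) (R : realType).
Variables (m1 : {measure set T1 -> \bar R}) (m2 : {measure set T2 -> \bar R}).

(** The real-valued integral is the fine part of a difference of integrals of
    nonnegative functions, each of which is measurable in the parameter by
    Tonelli. *)
Lemma measurable_Rintegral_param (f : T1 * T2 -> R) : sigma_finite setT m2 ->
  measurable_fun setT f ->
  measurable_fun setT (fun x => \int[m2]_y f (x, y)).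
Proof.
move=> s2 mf.
pose M2 : {sigma_finite_measure set T2 -> \bar R} := sigma_finite_of s2.
rewrite /Rintegral.
apply: (measurableT_comp (fine_measurable measurableT)).
have mE : measurable_fun setT (EFin \o f) by exact/measurable_EFinP.
rewrite (_ : (fun x => _) = (fun x => (\int[M2]_y ((EFin \o f)^\+)%E (x, y))%E
    - (\int[M2]_y ((EFin \o f)^\-)%E (x, y))%E)%E); last first.
  apply/funext => x.
  rewrite (integralE m2 setT (fun y => (f (x, y))%:E)).
  have <- : (\int[m2]_y (fun y => (f (x, y))%:E)^\+ y =
    \int[M2]_y (EFin \o f)^\+ (x, y))%E by apply: (@eq_integral _ _ _ m2) => y _; rewrite /= !funeposE.
  have <- // : (\int[m2]_y (fun y => (f (x, y))%:E)^\- y =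
    \int[M2]_y (EFin \o f)^\- (x, y))%E by apply: (@eq_integral _ _ _ m2) => y _; rewrite /= !funenegE.
apply: emeasurable_funB.
- apply: (measurable_fun_fubini_tonelli_F (((EFin \o f)^\+)%E)).
    exact: measurable_funepos.
  by move=> z; rewrite funepos_ge0.
- apply: (measurable_fun_fubini_tonelli_F (((EFin \o f)^\-)%E)).
    exact: measurable_funeneg.
  by move=> z; rewrite funeneg_ge0.
Qed.

(** Domination by a product g(x) h(y) is how absolute integrability is obtained
    below: typically one variable is cut off by a Gaussian and the other by an
    integrable amplitude. *)
Lemma integrable_product_bound (f : T1 * T2 -> R) (g : T1 -> R) (h : T2 -> R)
    (s1 : sigma_finite setT m1) (s2 : sigma_finite setT m2) :
  measurable_fun setT f ->
  m1.-integrable setT (EFin \o g) -> m2.-integrable setT (EFin \o h) ->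
  (forall x y, `|f (x, y)| <= g x * h y) ->
  (sigma_finite_of s1 \x sigma_finite_of s2)%E.-integrable setT (EFin \o f).
Proof.
move=> mf ig ih fgh.
pose M1 : {sigma_finite_measure set T1 -> \bar R} := sigma_finite_of s1.
pose M2 : {sigma_finite_measure set T2 -> \bar R} := sigma_finite_of s2.
apply/(@integrable12ltyP _ _ _ _ _ M1 M2); first exact/measurable_EFinP.
apply: (@le_lt_trans _ _ (\int[M1]_x ((\int[m2]_y `|h y|)%:E * `|g x|%:E))%E).
  apply: ge0_le_integral => //.
  - by move=> x _; exact: integral_ge0.
  - apply: (measurable_fun_fubini_tonelli_F (fun z => `|f z|%:E)) => //.
    by apply/measurable_EFinP; exact: measurableT_comp.
  - apply: measurable_funeM; apply/measurable_EFinP; apply: measurableT_comp => //.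
    exact: integrable_measurable ig.
  - move=> x _.
    apply: (@le_trans _ _ (\int[m2]_y (`|g x|%:E * `|h y|%:E))%E).
      apply: ge0_le_integral => //.
      + apply/measurable_EFinP; apply: measurableT_comp => //.
        exact: (measurableT_comp mf (pair1_measurable x)).
      + by apply: measurable_funeM; apply/measurable_EFinP; apply: measurableT_comp => //;
          exact: integrable_measurable ih.
      + move=> y _; rewrite lee_fin (le_trans (fgh _ _))//.
        by rewrite -normrM ler_norm.
    rewrite integralZl//; last exact: integrable_normr.
    rewrite muleC lee_pmul//; first exact: integral_ge0.
    rewrite /Rintegral fineK//.
    by apply: integrable_fin_num => //; exact: integrable_normr.
have ig' : M1.-integrable setT (fun x => `|g x|%:E).
  exact (integrable_abse ig).
rewrite integralZl//.
rewrite ltey_eq; apply/orP; left; rewrite fin_numM//.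
exact: integrable_fin_num.
Qed.

Lemma Rintegral_Fubini (f : T1 * T2 -> R) (g : T1 -> R) (h : T2 -> R) :
  sigma_finite setT m1 -> sigma_finite setT m2 ->
  measurable_fun setT f ->
  m1.-integrable setT (EFin \o g) -> m2.-integrable setT (EFin \o h) ->
  (forall x y, `|f (x, y)| <= g x * h y) ->
  \int[m1]_x \int[m2]_y f (x, y) = \int[m2]_y \int[m1]_x f (x, y).
Proof.
move=> s1 s2 mf ig ih fgh.
pose M1 : {sigma_finite_measure set T1 -> \bar R} := sigma_finite_of s1.
pose M2 : {sigma_finite_measure set T2 -> \bar R} := sigma_finite_of s2.
have i1 x : m2.-integrable setT (fun y => (f (x, y))%:E).
  apply: (integrable_le measurableT _ (integrable_mulr measurableT (g x) ih)).
    exact: (measurableT_comp mf (pair1_measurable x)).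
  by move=> y _; exact: fgh.
have i2 y : m1.-integrable setT (fun x => (f (x, y))%:E).
  apply: (integrable_le measurableT _ (integrable_mulr measurableT (h y) ig)).
    exact: (measurableT_comp mf (pair2_measurable y)).
  by move=> x _ ; rewrite mulrC; exact: fgh.
have fi := integrable_product_bound s1 s2 mf ig ih fgh.
rewrite /Rintegral.
transitivity (fine (\int[M1]_x (\int[M2]_y (f (x, y))%:E)))%E.
  congr fine; apply: eq_integral => x _; rewrite fineK//.
  exact: integrable_fin_num.
rewrite (Fubini fi).
congr fine; apply: eq_integral => y _; rewrite fineK//.
exact: integrable_fin_num.
Qed.

End real_fubini.

Section tonelli_on.
Context d1 d2 (T1 : measurableType d1) (T2 : measurableType d2) (R : realType).
Variables (m1 : {measure set T1 -> \bar R}) (m2 : {measure set T2 -> \bar R}).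
Variables (D1 : set T1) (D2 : set T2).
Hypotheses (mD1 : measurable D1) (mD2 : measurable D2).

Let sigma_finite_mrestr d (T : measurableType d) (m : {measure set T -> \bar R})
    (D : set T) (mD : measurable D) :
  sigma_finite D m -> sigma_finite setT (mrestr m mD).
Proof.
move=> [F DF mF]; exists (fun n => ~` D `|` F n).
  apply/seteqP; split => // x _; have [xD|xD] := pselect (D x); last by exists 0%N => //; left.
  by move: xD; rewrite DF => -[n _ Fnx]; exists n => //; right.
move=> n; have [mFn Fn] := mF n; split; first by apply: measurableU => //; exact: measurableC.
rewrite /mrestr setIUl setICl set0U; apply: le_lt_trans Fn.
by apply: le_measure; rewrite ?inE//; exact: measurableI.
Qed.

Let integral_mrestr d (T : measurableType d) (m : {measure set T -> \bar R})
    (D : set T) (mD : measurable D) (F : T -> \bar R) :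
  (\int[mrestr m mD]_x (F \_ D) x = \int[m]_(x in D) F x)%E.
Proof.
rewrite -integral_mkcond; apply: eq_measure_integral => A _ AD.
by rewrite /mrestr/=; congr (m _); exact/setIidPl.
Qed.

(** Restricting both measures reduces the exchange of integrals over D1 and D2 to
    the exchange over the whole spaces. In this form the second measure may be
    infinite near the boundary of D2, as a Levy measure is near 0. *)
Lemma tonelli_on (f : T1 * T2 -> \bar R) : sigma_finite D1 m1 -> sigma_finite D2 m2 ->
  measurable_fun (D1 `*` D2) f -> (forall x y, D1 x -> D2 y -> (0 <= f (x, y))%E) ->
  (\int[m1]_(x in D1) \int[m2]_(y in D2) f (x, y) =
   \int[m2]_(y in D2) \int[m1]_(x in D1) f (x, y))%E.
Proof.
move=> /(sigma_finite_mrestr mD1) s1 /(sigma_finite_mrestr mD2) s2 mf f0.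
pose M1 : {sigma_finite_measure set T1 -> \bar R} := sigma_finite_of s1.
pose M2 : {sigma_finite_measure set T2 -> \bar R} := sigma_finite_of s2.
pose g := f \_ (D1 `*` D2).
have mg : measurable_fun setT g.
  by apply/(measurable_restrictT f (measurableX mD1 mD2)).
have g0 z : (0 <= g z)%E.
  by case: z => x y; rewrite /g patchE; case: ifPn => //; rewrite inE => -[] /=; exact: f0.
have g1 x : (\int[M2]_y g (x, y))%E = ((fun x => \int[m2]_(y in D2) f (x, y))%E \_ D1) x.
  rewrite patchE -integral_mrestr; case: ifPn => xD; last first.
    by apply: integral0_eq => y _; rewrite /g patchE in_setX (negbTE xD).
  by apply: eq_integral => y _; rewrite /g !patchE in_setX xD.
have g2 y : (\int[M1]_x g (x, y))%E = ((fun y => \int[m1]_(x in D1) f (x, y))%E \_ D2) y.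
  rewrite patchE -integral_mrestr; case: ifPn => yD; last first.
    by apply: integral0_eq => x _; rewrite /g patchE in_setX (negbTE yD) andbF.
  by apply: eq_integral => x _; rewrite /g !patchE in_setX yD andbT.
rewrite -(integral_mrestr m1 mD1) -(integral_mrestr m2 mD2).
rewrite -(funext g1) -(funext g2).
exact: (@fubini_tonelli _ _ _ _ _ M1 M2 g mg g0).
Qed.

End tonelli_on.

(** * Waves and the characteristic function of the normal law *)

Section waves.
Variable R : realType.
Implicit Types (c : R -> R) (th : R).

(** Cosine, sine and their phase shifts are treated together: the estimates on
    the transforms only use continuity and the bound 1. *)
Definition wave c : Prop := continuous c /\ forall x, `|c x| <= 1.

Lemma norm_cos_le1 (x : R) : `|cos x| <= 1.
Proof. by rewrite ler_norml cos_geN1 cos_le1. Qed.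

Lemma norm_sin_le1 (x : R) : `|sin x| <= 1.
Proof. by rewrite ler_norml sin_geN1 sin_le1. Qed.

Lemma wave_cos : wave (@cos R).
Proof. by split; [exact: continuous_cos|exact: norm_cos_le1]. Qed.

Lemma wave_sin : wave (@sin R).
Proof. by split; [exact: continuous_sin|exact: norm_sin_le1]. Qed.

Lemma wave_shift c th : wave c -> wave (fun z => c (z + th)).
Proof.
move=> [cc c1]; split => // z; apply: (@continuous_comp _ _ _ (fun z => z + th)); last exact: cc.
by apply: cvgD => //; exact: cvg_cst.
Qed.

Lemma measurable_wave d (T : measurableType d) (D : set T) c (g : T -> R) : wave c ->
  measurable_fun D g -> measurable_fun D (fun x => c (g x)).
Proof.
by move=> [cc _]; apply: measurableT_comp; exact: continuous_measurable_fun.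
Qed.

Lemma integrable_wave d (T : measurableType d) (mu : {measure set T -> \bar R})
    c (f g : T -> R) : wave c -> measurable_fun setT g ->
  mu.-integrable setT (EFin \o f) ->
  mu.-integrable setT (EFin \o (fun x => f x * c (g x))).
Proof.
move=> wc mg; apply: (integrable_mulbr measurableT (M := 1)).
  exact: measurable_wave.
by move=> x _; exact: wc.2.
Qed.

Lemma norm_wave_le c (r x : R) : wave c -> `|r * c x| <= `|r|.
Proof. by move=> [_ c1]; rewrite normrM ler_piMr. Qed.

End waves.

Section line.
Variable R : realType.
Local Notation mu := (@lebesgue_measure R).

Lemma Rintegral_FTC_line (P p : R -> R) (a b : R) :
  (forall y : R, is_derive y 1 P (p y)) -> continuous p ->
  mu.-integrable setT (EFin \o p) ->
  P k%:R @[k --> \oo] --> a -> P (- k%:R) @[k --> \oo] --> b ->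
  \int[mu]_y p y = a - b.
Proof.
move=> dP cp ip Pa Pb.
pose D (k : nat) : set R := `[- k.+1%:R, k.+1%:R]%classic.
have [_ h1] : mu.-integrable setT (EFin \o p) /\
   \int[mu]_y (p \_ (D k)) y @[k --> \oo] --> \int[mu]_y p y.
  apply: (@Rintegral_dct _ _ _ mu setT measurableT _ p (fun y => `|p y|)).
  - move=> k; apply/measurable_restrict => //; first exact: measurable_itv.
    by rewrite setTI; apply: measurable_funTS; exact: integrable_measurable ip.
  - move=> y _; apply: cvg_near_cst.
    near=> k; rewrite patchE ifT// inE /D /= in_itv/=.
    rewrite -ler_norml (@le_trans _ _ k%:R)// ?ler_nat//.
    near: k; exact: nbhs_infty_ger.
  - exact: integrable_normr.
  - by move=> n x _; rewrite patchE; case: ifP => // _; rewrite normr0.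
have h2 : \int[mu]_y (p \_ (D k)) y @[k --> \oo] --> a - b.
  under eq_cvg => k.
    rewrite -Rintegral_mkcond /Rintegral (@continuous_FTC2 _ p P).
    - over.
    - by rewrite -subr_gt0 opprK -natrD ltr0n.
    - exact: continuous_subspaceT.
    - split.
      + by move=> x _; have [] := dP x.
      + apply: cvg_at_right_filter; apply: differentiable_continuous.
        by apply/derivable1_diffP; have [] := dP (- k.+1%:R).
      + apply: cvg_at_left_filter; apply: differentiable_continuous.
        by apply/derivable1_diffP; have [] := dP (k.+1%:R).
    - by move=> x _; rewrite derive1E; apply: derive_val.
  rewrite /=; apply: cvgB.
    by rewrite -(cvg_shiftS (fun k => P k%:R)) in Pa.
  by rewrite -(cvg_shiftS (fun k => P (- k%:R))) in Pb.
exact: (cvg_unique _ h1 h2).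
Unshelve. all: by end_near. Qed.

End line.

Section gauss_line.
Variable R : realType.
Local Notation mu := (@lebesgue_measure R).
Implicit Types m s xi th y : R.

(** Trading a linear factor for a wider Gaussian: with w = (y - m)^2 / (8 s^2) the
    wide density divided by the narrow one is a multiple of exp(3 w), which beats
    |y - m| since 1 + 3 w already does up to the constant. *)
Lemma normal_pdf_moment_le m s y : s != 0 ->
  normal_pdf m s y * `|y - m| <=
  (1 + 4 * s ^+ 2) * (normal_peak s / normal_peak (2 * s) * normal_pdf m (2 * s) y).
Proof.
move=> s0; have s20 : 2 * s != 0 by rewrite mulf_neq0.
rewrite !normal_pdfE//.
have p0 := normal_peak_gt0 s20; have q0 := normal_peak_gt0 s0.
rewrite mulrA divfK ?gt_eqF// -mulrA [leRHS]mulrCA ler_wpM2l ?(ltW q0)//.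
rewrite /normal_fun; set z := y - m.
have s2 : 0 < s ^+ 2 by rewrite exprn_even_gt0.
pose w := z ^+ 2 / ((2 * s) ^+ 2 *+ 2).
have -> : - z ^+ 2 / (s ^+ 2 *+ 2) = - w + (- (3 * w)).
  by rewrite /w; field.
rewrite expRD mulrAC -mulrA mulrC -/z.
rewrite (_ : - z ^+ 2 / ((2 * s) ^+ 2 *+ 2) = - w); last by rewrite /w mulNr.
rewrite ler_wpM2r ?expR_ge0//.
have w0 : 0 <= w by rewrite /w divr_ge0 ?sqr_ge0// mulrn_wge0// sqr_ge0.
rewrite expRN ler_pdivrMr ?expR_gt0// mulrC.
apply: (@le_trans _ _ ((1 + 3 * w) * (1 + 4 * s ^+ 2))).
  have zw : z ^+ 2 = 8 * s ^+ 2 * w by rewrite /w; field.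
  have zz : `|z| <= (1 + z ^+ 2) / 2.
    have := sqr_ge0 (`|z| - 1); rewrite -(real_normK (num_real z)); lra.
  nra.
rewrite ler_wpM2r//; first by nra.
exact: expR_ge1Dx.
Qed.

Lemma integrable_normal_pdf_moment m s : s != 0 ->
  mu.-integrable setT (EFin \o (fun y => normal_pdf m s y * `|y - m|)).
Proof.
move=> s0.
apply: (integrable_le measurableT); last first.
- move=> y _; rewrite ger0_norm; first exact: normal_pdf_moment_le.
  by rewrite mulr_ge0// normal_pdf_ge0.
- apply: integrable_mulr => //; apply: integrable_mulr => //.
  exact: integrable_normal_pdf.
- apply: measurable_funM; first exact: measurable_normal_pdf.
  by apply: measurableT_comp => //; exact: measurable_funB.
Qed.

Lemma is_derive_normal_pdf m s y : s != 0 ->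
  is_derive y 1 (normal_pdf m s) (- ((y - m) / s ^+ 2 * normal_pdf m s y)).
Proof.
move=> s0; rewrite normal_pdfE// /normal_fun.
apply: is_derive_eq.
rewrite scaler0 add0r subr0 /GRing.scale/= mulr1.
by field; rewrite s0.
Qed.

Let moment_bound m s (c : R -> R) : s != 0 -> measurable_fun setT c ->
  (forall y, `|c y| <= 1) ->
  mu.-integrable setT (EFin \o (fun y => normal_pdf m s y * (y - m) * c y)).
Proof.
move=> s0 mc c1.
apply: (integrable_le measurableT _ (integrable_normal_pdf_moment m s0)).
  apply: measurable_funM => //; apply: measurable_funM => //.
    exact: measurable_normal_pdf.
  exact: measurable_funB.
move=> y _; rewrite !normrM (ger0_norm (normal_pdf_ge0 _ _ _)).
by rewrite ler_piMr// mulr_ge0// normal_pdf_ge0.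
Qed.

(** The boundary terms of the integration by parts vanish: the density times
    |y - m| is bounded. *)
Let normal_cvg0 m s (u : nat -> R) (c : nat -> R) : s != 0 ->
  (forall k, k%:R <= `|u k|) -> (forall k, `|c k| <= 1) ->
  normal_pdf m s (u k) * c k @[k --> \oo] --> 0.
Proof.
move=> s0 ku c1; apply/cvgrPdist_le => e e0.
pose C := (1 + 4 * s ^+ 2) * (normal_peak s).
have C0 : 0 < C by rewrite mulr_gt0 ?normal_peak_gt0//; nra.
near=> k; rewrite sub0r normrN normrM ger0_norm ?normal_pdf_ge0//.
apply: (@le_trans _ _ (normal_pdf m s (u k))).
  by rewrite ler_piMr ?normal_pdf_ge0.
have km : C / e <= `|u k - m|.
  rewrite (@le_trans _ _ (k%:R - `|m|))//.
    by rewrite lerBrDr; near: k; exact: nbhs_infty_ger.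
  by rewrite (le_trans _ (lerB_dist _ _))// lerD2r.
rewrite -(ler_pM2r (divr_gt0 C0 e0)) [leRHS]mulrC divfK ?gt_eqF//.
apply: (@le_trans _ _ (normal_pdf m s (u k) * `|u k - m|)).
  by rewrite ler_wpM2l ?normal_pdf_ge0.
have s20 : 2 * s != 0 by rewrite mulf_neq0.
apply: (le_trans (normal_pdf_moment_le _ _ s0)).
rewrite /C ler_wpM2l//; first by nra.
rewrite -[leRHS]mulr1 -mulrA ler_wpM2l ?normal_peak_ge0//.
rewrite mulrC ler_pdivrMr ?normal_peak_gt0// mul1r.
exact: normal_pdf_ub.
Unshelve. all: by end_near. Qed.

(** The characteristic function of the normal law. As a function H of the
    frequency x, the centred integral satisfies H' = - s^2 x H: the derivative
    produces a factor y - m, which the density absorbs since it is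
    - s^2 times the logarithmic derivative, and an integration by parts moves
    the derivative to the cosine. The phase th covers the sine as well. *)
Lemma normal_pdf_cos m s xi th : s != 0 ->
  \int[mu]_y (normal_pdf m s y * cos (y * xi + th)) =
  cos (m * xi + th) * expR (- (s ^+ 2 * xi ^+ 2 / 2)).
Proof.
move=> s0.
suff main (z : R) : \int[mu]_y (normal_pdf m s y * cos ((y - m) * xi + z)) =
  cos z * expR (- (s ^+ 2 * xi ^+ 2 / 2)).
  rewrite -main; apply: eq_Rintegral => y _; congr (_ * cos _); ring.
pose f (x y : R) := normal_pdf m s y * cos ((y - m) * x + z).
pose g (x y : R) := normal_pdf m s y * - ((y - m) * sin ((y - m) * x + z)).
have df (x y : R) : is_derive x 1 (f ^~ y) (g x y).
  rewrite /f /g; apply: is_derive_eq.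
  rewrite /GRing.scale/=; ring.
pose H (x : R) := \int[mu]_y f x y.
have ma x : measurable_fun setT (fun y : R => (y - m) * x + z).
  by apply: measurable_funD => //; apply: measurable_funM => //; exact: measurable_funB.
have fi x : mu.-integrable setT (EFin \o f x).
  exact: (integrable_wave (mu := mu) (@wave_cos R) (ma x) (integrable_normal_pdf m s)).
have ms x : measurable_fun setT (fun y : R => sin ((y - m) * x + z)).
  exact: (measurable_wave (@wave_sin R)).
have dH (x : R) : is_derive x 1 H (\int[mu]_y g x y).
  have Ix : `]x - 1, x + 1[%classic x.
    by rewrite /= in_itv/= ltrBlDr ltrDl ltr01 andbT.
  have dfv x0 y : partial1of2 f x0 y = g x0 y.
    by rewrite partial1of2E; apply: derive_val.
  have hG x0 y : `]x - 1, x + 1[%classic x0 -> setT y ->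
     `|partial1of2 f x0 y| <= normal_pdf m s y * `|y - m|.
    move=> _ _; rewrite dfv /g normrM normrN normrM ger0_norm ?normal_pdf_ge0//.
    by rewrite ler_wpM2l ?normal_pdf_ge0// ler_piMr// norm_sin_le1.
  have fd x0 y : `]x - 1, x + 1[%classic x0 -> setT y -> derivable (f ^~ y) x0 1.
    by move=> _ _; have [] := df x0 y.
  have G0 y : 0 <= normal_pdf m s y * `|y - m| by rewrite mulr_ge0 ?normal_pdf_ge0.
  have := @derivable_under_integral _ _ _ mu f setT measurableT x (x - 1) (x + 1)
    Ix (fun x _ => fi x) fd _ G0 (integrable_normal_pdf_moment m s0) hG.
  have := @differentiation_under_integral _ _ _ mu f setT measurableT x (x - 1) (x + 1)
    Ix (fun x _ => fi x) fd _ G0 (integrable_normal_pdf_moment m s0) hG.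
  move=> H1 H2; apply: DeriveDef => //.
  rewrite -derive1E H1; apply: eq_Rintegral => y _; exact: dfv.
(* The integral of p = P' over the line vanishes. *)
have ode x : \int[mu]_y g x y = - (s ^+ 2 * x) * H x.
  pose P y := normal_pdf m s y * sin ((y - m) * x + z).
  pose p y := s ^- 2 * g x y + x * f x y.
  have gi : mu.-integrable setT (EFin \o g x).
    rewrite (_ : _ \o _ = EFin \o (fun y => normal_pdf m s y * (y - m) * - sin ((y - m) * x + z))).
      apply: moment_bound => // [|y]; last by rewrite normrN norm_sin_le1.
      exact: measurableT_comp (ms x).
    by apply/funext => y; rewrite /g /=; congr EFin; ring.
  have ip : mu.-integrable setT (EFin \o p).
    by apply: integrable_add => //; apply: integrable_mulr.
  have dP (y : R) : is_derive y 1 P (p y).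
    have dn := is_derive_normal_pdf m y s0.
    have ds : is_derive y 1 (fun y : R => sin ((y - m) * x + z)) (x * cos ((y - m) * x + z)).
      by apply: is_derive_eq; rewrite /GRing.scale/=; ring.
    apply: (is_derive_eq (is_deriveM dn ds)).
    rewrite /GRing.scale/= /p /g /f; field; exact: s0.
  have cp : continuous p.
    have cl (b : R) : continuous (fun y : R => (y - m) * x + b).
      by move=> y; apply: cvgD; [apply: cvgMl; apply: cvgB => //; exact: cvg_cst
        |exact: cvg_cst].
    move=> y; apply: cvgD; apply: cvgMr; apply: cvgM;
      try exact: continuous_normal_pdf.
    - apply: cvgN; apply: cvgM; first by apply: cvgB => //; exact: cvg_cst.
      by apply: continuous_comp; [exact: cl|exact: continuous_sin].
    - by apply: continuous_comp; [exact: cl|exact: continuous_cos].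
  have e : \int[mu]_y p y = 0 - 0.
    apply: (Rintegral_FTC_line dP cp ip).
      by apply: normal_cvg0 => // k; rewrite ?norm_sin_le1// ger0_norm.
    by apply: normal_cvg0 => // k; rewrite ?norm_sin_le1// normrN ger0_norm.
  move: e; rewrite subrr.
  rewrite /p RintegralD//; [|exact: integrable_mulr..].
  rewrite !RintegralZl// -/(H x) => /eqP; rewrite addr_eq0 => /eqP e.
  have s2 : s ^+ 2 != 0 by rewrite expf_neq0.
  by rewrite -[LHS](mulVKf s2) e; ring.
(* Integrating factor of the equation for H. *)
pose E (x : R) := H x * expR (s ^+ 2 * x ^+ 2 / 2).
have dE (x : R) : is_derive x 1 E 0.
  have hx := dH x.
  rewrite /E; apply: is_derive_eq.
  by rewrite ode /GRing.scale/=; field.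
have E0 : E xi = E 0 by exact: is_derive_0_is_cst.
have : E xi = cos z.
  rewrite E0 /E expr0n/= mulr0 mul0r expR0 mulr1 /H /f.
  under eq_Rintegral do rewrite mulr0 add0r.
  rewrite RintegralZr//; last exact: integrable_normal_pdf.
  by rewrite /Rintegral integral_normal_pdf/= mul1r.
by rewrite /E => <-; rewrite expRN mulfK ?gt_eqF ?expR_gt0.
Qed.

End gauss_line.

(** * Integration on R^n and the Gaussian kernel *)

Section rV_integral.
Variable R : realType.
Local Notation leb := (@lebesgue_measure R).
Local Notation mu n := (@lebesgue_rV R n).

Lemma measurable_box n (A : 'I_n -> set R) :
  (forall i, measurable (A i : set (measurableTypeR R))) ->
  measurable [set x : 'rV[R]_n | forall i, A i (x ord0 i)].
Proof.
move=> mA; rewrite (_ : [set x | _] = \big[setI/setT]_(i < n)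
    ((fun y : 'rV[R]_n => y ord0 i : measurableTypeR R) @^-1` A i)).
  by apply: bigsetI_measurable => i _; rewrite -[X in measurable X]setTI;
    exact: measurable_coord.
rewrite -bigcap_seq; apply/seteqP; split => y /= h i; first by move=> _; exact: h.
by apply: h; rewrite /= mem_index_enum.
Qed.

Lemma rV_consE0 n (p : measurableTypeR R * 'rV[R]_n) :
  rV_cons p ord0 ord0 = p.1.
Proof.
rewrite (_ : ord0 = lshift n (ord0 : 'I_1) :> 'I_n.+1); last exact: val_inj.
exact: rV_cons0.
Qed.

Lemma rV_consEl n (p : measurableTypeR R * 'rV[R]_n) i :
  rV_cons p ord0 (lift ord0 i) = p.2 ord0 i.
Proof.
rewrite (_ : lift ord0 i = rshift 1 i :> 'I_n.+1); last exact: val_inj.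
exact: rV_consS.
Qed.

(** The cubes [-k, k]^n exhaust the space and have measure (2 k)^n. *)
Lemma sigma_finite_lebesgue_rV n : sigma_finite setT (mu n).
Proof.
exists (fun k => [set x : 'rV[R]_n |
    forall i, (`[- k%:R, k%:R]%classic : set R) (x ord0 i)]).
  apply/seteqP; split => // x _.
  pose M := \sum_(i < n) `|x ord0 i|.
  have [k Mk] : exists k : nat, M <= k%:R.
    by exists (Num.truncn M).+1; apply/ltW/truncnS_gt.
  exists k => // i /=; rewrite in_itv/= -ler_norml (le_trans _ Mk)//.
  by rewrite /M (bigD1 i)//= lerDl sumr_ge0.
move=> k; split; first exact: (@measurable_box n (fun=> `[- k%:R, k%:R]%classic)).
rewrite (@lebesgue_rV_box _ n (fun=> `[- k%:R, k%:R]%classic))//.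
have -> : (\prod_(i < n) leb `[(- k%:R)%R, (k%:R)%R]%classic)%E = ((k%:R + k%:R) ^+ n : R)%:E.
  elim: n => [|n IH]; first by rewrite big_ord0 expr0.
  rewrite big_ord_recl IH exprS EFinM.
  rewrite lebesgue_measure_itv/= lte_fin.
  case: ltP => [_|]; first by rewrite opprK.
  rewrite -subr_ge0 -opprD oppr_ge0 => k0.
  by rewrite (_ : k%:R + k%:R = 0)//; apply/eqP; rewrite eq_le k0 addr_ge0.
exact: ltry.
Qed.

(** Lebesgue measure on R^(n+1) is the image of the product of the measures on R
    and R^n, so Fubini splits off the first coordinate. *)
Lemma integrable_rV_cons n (f : 'rV[R]_n.+1 -> R) (g : R -> R) (h : 'rV[R]_n -> R) :
  measurable_fun setT f -> leb.-integrable setT (EFin \o g) ->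
  (mu n).-integrable setT (EFin \o h) ->
  (forall a y, `|f (rV_cons (a, y))| <= g a * h y) ->
  (mu n.+1).-integrable setT (EFin \o f) /\
  \int[mu n.+1]_x f x = \int[leb]_a \int[mu n]_y f (rV_cons (a, y)).
Proof.
move=> mf ig ih fgh.
have sl : sigma_finite setT leb by exact: sigma_finiteT.
pose M1 : {sigma_finite_measure set _ -> \bar R} := sigma_finite_of sl.
pose M2 : {sigma_finite_measure set 'rV[R]_n -> \bar R} :=
  sigma_finite_of (@sigma_finite_lebesgue_rV n).
have mfc : measurable_fun setT (f \o @rV_cons R n).
  by apply: measurableT_comp => //; exact: measurable_rV_cons.
have mfE : measurable_fun setT (EFin \o f) by exact/measurable_EFinP.
have ifc := integrable_product_bound sl (@sigma_finite_lebesgue_rV n) mfc ig ih fgh.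
(* The two constructions of the product measure agree on rectangles. *)
have eqm A : measurable A -> (M1 \x M2)%E A = (leb \x^ mu n)%E A.
  move=> mA; apply: (@product_measure_unique _ _ _ _ _ M1 M2 (leb \x^ mu n)%E) => //.
  by move=> B C mB mC; exact: (@product_measure2E _ _ _ _ _ leb (mu n)).
have ifc2 : (leb \x^ mu n)%E.-integrable setT (EFin \o (f \o @rV_cons R n)).
  apply/integrableP; split; first exact/measurable_EFinP.
  have /integrableP[_] := ifc.
  congr (_ < _)%E; apply: eq_measure_integral => A mA _; exact: eqm.
split.
  exact: (@integrable_pushforward _ _ _ _ _ _ (@measurable_rV_cons R n) (leb \x^ mu n)%E setT).
rewrite /Rintegral [in LHS]/=.
transitivity (fine (\int[(M1 \x M2)%E]_z (EFin \o (f \o @rV_cons R n)) z)).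
  congr fine.
  rewrite (@integral_pushforward _ _ _ _ _ _ (@measurable_rV_cons R n) (leb \x^ mu n)%E setT)//.
  rewrite preimage_setT.
  by apply: eq_measure_integral => A mA _; exact/esym/eqm.
rewrite -(integral12_prod_meas1 ifc); congr fine.
apply: eq_integral => a _; rewrite fineK//.
apply: integrable_fin_num => //.
apply: (integrable_le measurableT _ (integrable_mulr measurableT (g a) ih)).
  exact: (measurableT_comp mfc (pair1_measurable a)).
by move=> y _; exact: fgh.
Qed.

Lemma measurable_coordR n (i : 'I_n) :
  measurable_fun setT (fun x : 'rV[R]_n => x ord0 i : R).
Proof. exact: measurable_coord. Qed.

Lemma measurable_prod_coord n (F : 'I_n -> R -> R) :
  (forall i, measurable_fun setT (F i)) ->
  measurable_fun setT (fun x : 'rV[R]_n => \prod_(i < n) F i (x ord0 i)).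
Proof.
move=> mF; apply: measurable_prod => i _.
exact: (measurableT_comp (mF i) (measurable_coordR i)).
Qed.

Lemma integrable_prod n (F : 'I_n -> R -> R) :
  (forall i, leb.-integrable setT (EFin \o F i)) ->
  (mu n).-integrable setT (EFin \o (fun x : 'rV[R]_n => \prod_(i < n) F i (x ord0 i))) /\
  \int[mu n]_x (\prod_(i < n) F i (x ord0 i)) = \prod_(i < n) \int[leb]_r F i r.
Proof.
elim: n F => [|n IH] F iF.
  split.
    apply: (@eq_integrable _ _ _ _ _ measurableT (cst 1%E)).
      by move=> x _; rewrite /= big_ord0.
    exact: finite_measure_integrable_cst.
  under eq_Rintegral do rewrite big_ord0.
  by rewrite big_ord0 /Rintegral integral_dirac// diracT mul1e.
have mF i : measurable_fun setT (F i) by exact: integrable_measurable (iF i).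
have [i1 e1] := IH (fun i => F (lift ord0 i)) (fun i => iF (lift ord0 i)).
have key a (y : 'rV[R]_n) : \prod_(i < n.+1) F i (rV_cons (a, y) ord0 i) =
    F ord0 a * \prod_(i < n) F (lift ord0 i) (y ord0 i).
  rewrite big_ord_recl rV_consE0; congr (_ * _).
  by apply: eq_bigr => i _; rewrite rV_consEl.
have [i2 e2] := @integrable_rV_cons n (fun x : 'rV[R]_n.+1 => \prod_(i < n.+1) F i (x ord0 i))
  (fun a => `|F ord0 a|)
  (fun y => `|\prod_(i < n) F (lift ord0 i) (y ord0 i)|)
  (measurable_prod_coord mF)
  (integrable_normr (iF ord0)) (integrable_normr i1)
  (fun a y => eq_ind_r (fun z => `|z| <= _) (eq_ind_r (fun z => z <= _) (lexx _) (normrM _ _)) (key a y)).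
split => //.
rewrite e2 big_ord_recl -e1 -RintegralZr//.
apply: eq_Rintegral => a _; rewrite -RintegralZl//.
by apply: eq_Rintegral => y _; rewrite key.
Qed.

End rV_integral.

Section gaussian_kernel.
Variables (R : realType).
Local Notation leb := (@lebesgue_measure R).
Local Notation mu n := (@lebesgue_rV R n).

(** The density of n independent normal variables of common deviation s, centred
    at the coordinates of x. *)
Definition gaussN n (x : 'rV[R]_n) (s : R) (y : 'rV[R]_n) : R :=
  \prod_(i < n) normal_pdf (x ord0 i) s (y ord0 i).

Lemma gaussN_ge0 n (x : 'rV[R]_n) s y : 0 <= gaussN x s y.
Proof. by apply: prodr_ge0 => i _; exact: normal_pdf_ge0. Qed.

Lemma gaussN_gt0 n (x : 'rV[R]_n) s y : s != 0 -> 0 < gaussN x s y.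
Proof.
move=> s0; apply: prodr_gt0 => i _; rewrite normal_pdfE//.
by rewrite mulr_gt0 ?normal_peak_gt0 ?expR_gt0.
Qed.

Lemma gaussNC n (x : 'rV[R]_n) s y : s != 0 -> gaussN x s y = gaussN y s x.
Proof.
move=> s0; apply: eq_bigr => i _; rewrite !normal_pdfE// /normal_fun.
by rewrite -(sqrrN (_ - _)) opprB.
Qed.

Lemma integrable_gaussN n (x : 'rV[R]_n) s :
  (mu n).-integrable setT (EFin \o gaussN x s).
Proof.
by have [] := @integrable_prod R n (fun i => normal_pdf (x ord0 i) s)
  (fun i => integrable_normal_pdf _ _).
Qed.

Lemma measurable_gaussN n (x : 'rV[R]_n) s : measurable_fun setT (gaussN x s).
Proof. exact: integrable_measurable (integrable_gaussN x s). Qed.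

Lemma Rintegral_gaussN n (x : 'rV[R]_n) s : \int[mu n]_y gaussN x s y = 1.
Proof.
have [_ ->] := @integrable_prod R n (fun i => normal_pdf (x ord0 i) s)
  (fun i => integrable_normal_pdf _ _).
by apply: big1 => i _; rewrite /Rintegral integral_normal_pdf.
Qed.

Lemma measurable_dotr n (xi : 'rV[R]_n) : measurable_fun setT (fun y => dotr y xi).
Proof.
rewrite /dotr; apply: measurable_sum => i; apply: measurable_funM => //.
exact: measurable_coordR.
Qed.

(** Induction on the dimension: the coordinate split off contributes the
    one-dimensional formula, with the remaining part of the scalar product as
    its phase. *)
Lemma gaussN_cos n (x xi : 'rV[R]_n) s th : s != 0 ->
  \int[mu n]_y (gaussN x s y * cos (dotr y xi + th)) =
  cos (dotr x xi + th) * expR (- (s ^+ 2 * dotr xi xi / 2)).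
Proof.
move=> s0; elim: n x xi th => [|n IH] x xi th.
  under eq_Rintegral do rewrite /gaussN /dotr !big_ord0 mul1r add0r.
  rewrite /dotr !big_ord0 mulr0 mul0r oppr0 expR0 mulr1 add0r.
  by rewrite /Rintegral integral_dirac// diracT mul1e.
pose x' : 'rV[R]_n := \row_i x ord0 (lift ord0 i).
pose xi' : 'rV[R]_n := \row_i xi ord0 (lift ord0 i).
have dE (z w : 'rV[R]_n.+1) : dotr z w = z ord0 ord0 * w ord0 ord0 +
   dotr (\row_i z ord0 (lift ord0 i)) (\row_i w ord0 (lift ord0 i)).
  by rewrite /dotr big_ord_recl; congr (_ + _); apply: eq_bigr => i _; rewrite !mxE.
have dc a (y : 'rV[R]_n) : dotr (rV_cons (a, y)) xi = a * xi ord0 ord0 + dotr y xi'.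
  rewrite dE rV_consE0 /=; congr (_ + dotr _ _).
  by apply/rowP => i; rewrite mxE rV_consEl.
have gc a (y : 'rV[R]_n) : gaussN x s (rV_cons (a, y)) =
    normal_pdf (x ord0 ord0) s a * gaussN x' s y.
  rewrite /gaussN big_ord_recl rV_consE0; congr (_ * _).
  by apply: eq_bigr => i _; rewrite rV_consEl mxE.
have [_ ->] := @integrable_rV_cons R n (fun y => gaussN x s y * cos (dotr y xi + th))
  (normal_pdf (x ord0 ord0) s) (gaussN x' s)
  (measurable_funM (measurable_gaussN x s) (measurable_wave (wave_shift th (@wave_cos R)) (measurable_dotr xi)))
  (integrable_normal_pdf _ _) (integrable_gaussN _ _)
  (fun a y => ltac:(rewrite normrM ger0_norm ?gaussN_ge0// gc ler_piMr ?norm_cos_le1//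
     mulr_ge0 ?gaussN_ge0 ?normal_pdf_ge0//)).
pose e := expR (- (s ^+ 2 * dotr xi' xi' / 2)).
transitivity (\int[leb]_a (normal_pdf (x ord0 ord0) s a *
    cos (a * xi ord0 ord0 + (dotr x' xi' + th)) * e)).
  apply: eq_Rintegral => a _.
  rewrite -mulrA [cos _ * e](_ : _ = \int[mu n]_y (gaussN x' s y *
     cos (dotr y xi' + (a * xi ord0 ord0 + th)))); last first.
    by rewrite IH /e; congr (cos _ * _); ring.
  rewrite -RintegralZl//; last first.
    exact: (integrable_wave (wave_shift _ (@wave_cos R)) (measurable_dotr _) (integrable_gaussN x' s)).
  by apply: eq_Rintegral => y _; rewrite gc dc -mulrA; congr (_ * (_ * cos _)); ring.
rewrite RintegralZr//; last first.
  apply: (integrable_wave (mu := leb) (wave_shift _ (@wave_cos R))); last exact: integrable_normal_pdf.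
  exact: measurable_funM.
rewrite normal_pdf_cos// -[LHS]mulrA /e -expRD (dE x xi) (dE xi xi) -/x' -/xi'.
by congr (cos _ * expR _); ring.
Qed.

End gaussian_kernel.

(** * Cosine and sine transforms *)

Lemma cvg_sumR (R : realType) (n : nat) (f : 'I_n -> nat -> R) (l : 'I_n -> R) :
  (forall i, f i k @[k --> \oo] --> l i) ->
  \sum_(i < n) f i k @[k --> \oo] --> \sum_(i < n) l i.
Proof.
by move=> fl; apply: cvg_big => // x; exact: add_continuous.
Qed.

Section seq_continuity.
Variables (R : realType) (N : nat).
Implicit Types (F : 'rV[R]_N -> R) (x : 'rV[R]_N).

(** Continuity along coordinatewise convergent sequences. It is what dominated
    convergence gives for the transforms, and it implies the metric form
    [seq_continuous_at_near], which the approximate identity needs. *)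
Definition seq_continuous_at F x := forall u : nat -> 'rV[R]_N,
  (forall i, u n ord0 i @[n --> \oo] --> x ord0 i) -> F (u n) @[n --> \oo] --> F x.

Lemma seq_continuous_at_near F x (e : R) : seq_continuous_at F x -> 0 < e ->
  exists2 delta : R, 0 < delta & forall y : 'rV[R]_N,
    (forall i, `|y ord0 i - x ord0 i| <= delta) -> `|F y - F x| <= e.
Proof.
move=> Fx e0; apply: contrapT => H.
have {}H (n : nat) : exists y : 'rV[R]_N,
    (forall i, `|y ord0 i - x ord0 i| <= n.+1%:R^-1) /\ e < `|F y - F x|.
  apply: contrapT => h; apply: H; exists n.+1%:R^-1 => //.
  move=> y hy; rewrite leNgt; apply/negP => ye; apply: h; by exists y.
have [u Hu] := choice H.
have /cvgrPdist_lt/(_ _ e0)[m _ /(_ m (leqnn _))] : F (u n) @[n --> \oo] --> F x.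
  apply: Fx => i; apply/cvgrPdist_le => r r0.
  near=> n; rewrite distrC; have [/(_ i) h _] := Hu n; apply: (le_trans h).
  rewrite invf_ple ?posrE// (@le_trans _ _ n%:R)// ?ler_nat//.
  by near: n; exact: nbhs_infty_ger.
by have [_ /lt_trans] := Hu m; rewrite distrC => /[apply]; rewrite ltxx.
Unshelve. all: by end_near. Qed.

Lemma continuous_seq F x : {for x, continuous F} -> seq_continuous_at F x.
Proof.
move=> cF u ux; apply: (@cvg_comp _ _ _ u F _ (nbhs x)) => //.
apply/cvg_ballP => e e0; near=> n; split => // i j.
rewrite (ord1 i) /ball/= ; move: j; near: n.
apply: filter_forall => j.
by have /cvgrPdist_lt/(_ _ e0) := ux j.
Unshelve. all: by end_near. Qed.

End seq_continuity.

Section transforms.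
Variables (R : realType) (N : nat).
Local Notation mu := (@lebesgue_rV R N).
Local Notation rV := 'rV[R]_N.
Implicit Types (A B F u : rV -> R) (x y xi : rV) (s th : R) (c : R -> R).

(** For c = cos and c = sin, the real part and minus the imaginary part of the
    Fourier transform; [synth A B] is the superposition of cosine waves with
    amplitudes A and sine waves with amplitudes B, hence (2 pi)^N times the real
    part of the inverse Fourier transform of A - i B. *)
Definition waveT c u xi : R := \int[mu]_y (u y * c (dotr y xi)).
Definition cosT := waveT (@cos R).
Definition sinT := waveT (@sin R).
Definition synth A B x : R :=
  \int[mu]_xi (A xi * cos (dotr x xi) + B xi * sin (dotr x xi)).

(** The transform of the centred Gaussian density of deviation s. *)
Definition gexp s xi : R := expR (- (s ^+ 2 * dotr xi xi / 2)).

Lemma dotrC x y : dotr x y = dotr y x.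
Proof. by apply: eq_bigr => i _; rewrite mulrC. Qed.

Lemma dotrBl x y z : dotr (x - y) z = dotr x z - dotr y z.
Proof. by rewrite /dotr -sumrB; apply: eq_bigr => i _; rewrite !mxE mulrBl. Qed.

Lemma dotrDl x y z : dotr (x + y) z = dotr x z + dotr y z.
Proof. by rewrite /dotr -big_split; apply: eq_bigr => i _; rewrite !mxE mulrDl. Qed.

Lemma dotrNl x z : dotr (- x) z = - dotr x z.
Proof. by rewrite /dotr -sumrN; apply: eq_bigr => i _; rewrite !mxE mulNr. Qed.

Lemma dotrNr x z : dotr x (- z) = - dotr x z.
Proof. by rewrite dotrC dotrNl dotrC. Qed.

Lemma dotr0l z : dotr (0 : rV) z = 0.
Proof. by rewrite /dotr big1// => i _; rewrite mxE mul0r. Qed.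

Lemma dotr_ge0 x : 0 <= dotr x x.
Proof. by apply: sumr_ge0 => i _; rewrite -expr2 sqr_ge0. Qed.

Lemma gexp_ge0 s xi : 0 <= gexp s xi. Proof. exact: expR_ge0. Qed.

Lemma gexp_le1 s xi : gexp s xi <= 1.
Proof.
by rewrite -expR0 ler_expR oppr_le0 divr_ge0// mulr_ge0 ?sqr_ge0 ?dotr_ge0.
Qed.

Lemma measurable_dotr2 :
  measurable_fun setT (fun p : rV * rV => dotr p.1 p.2).
Proof.
rewrite /dotr; apply: measurable_sum => i; apply: measurable_funM.
- exact: (measurableT_comp (measurable_coordR i) measurable_fst).
- exact: (measurableT_comp (measurable_coordR i) measurable_snd).
Qed.

Lemma measurable_dotrr : measurable_fun setT (fun x : rV => dotr x x).
Proof.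
by rewrite /dotr; apply: measurable_sum => i; apply: measurable_funM;
  exact: measurable_coordR.
Qed.

Lemma measurable_gexp s : measurable_fun setT (gexp s).
Proof.
apply: (measurableT_comp (@measurable_expR R)); apply: measurableT_comp => //.
by apply: measurable_funM => //; apply: measurable_funM => //; exact: measurable_dotrr.
Qed.

Lemma dotrE x : dotr x = fun y => dotr y x.
Proof. by apply/funext => y; exact: dotrC. Qed.

Definition integrableR F := mu.-integrable setT (EFin \o F).

Lemma integrableR_mulr r F : integrableR F -> integrableR (fun x => r * F x).
Proof. by move=> iF; exact: (integrable_mulr measurableT r iF). Qed.

Lemma integrableR_add F G : integrableR F -> integrableR G ->
  integrableR (fun x => F x + G x).
Proof. by move=> iF iG; exact: (integrable_add measurableT iF iG). Qed.

Lemma integrableR_sub F G : integrableR F -> integrableR G ->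
  integrableR (fun x => F x - G x).
Proof. by move=> iF iG; exact: (integrable_sub measurableT iF iG). Qed.

Lemma integrableR_normr F : integrableR F -> integrableR (fun x => `|F x|).
Proof. exact: integrable_normr. Qed.

Lemma integrable_waved c F x : wave c -> integrableR F ->
  integrableR (fun y => F y * c (dotr y x)).
Proof. by move=> wc; apply: integrable_wave => //; exact: measurable_dotr. Qed.

Lemma integrable_synth A B x : integrableR A -> integrableR B ->
  integrableR (fun xi => A xi * cos (dotr x xi) + B xi * sin (dotr x xi)).
Proof.
move=> iA iB; rewrite dotrE; apply: integrable_add => //; apply: integrable_waved => //.
  exact: wave_cos.
exact: wave_sin.
Qed.

Lemma synthZ (c : R) A B x : integrableR A -> integrableR B ->
  synth (fun xi => c * A xi) (fun xi => c * B xi) x = c * synth A B x.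
Proof.
move=> iA iB; rewrite /synth -RintegralZl//; last exact: integrable_synth.
by apply: eq_Rintegral => xi _; ring.
Qed.

Lemma synthD A B A' B' x : integrableR A -> integrableR B ->
  integrableR A' -> integrableR B' ->
  synth (fun xi => A xi + A' xi) (fun xi => B xi + B' xi) x =
  synth A B x + synth A' B' x.
Proof.
move=> iA iB iA' iB'; rewrite /synth -RintegralD//; [|exact: integrable_synth..].
by apply: eq_Rintegral => xi _; ring.
Qed.

Lemma synth_le A B x xi : `|A xi * cos (dotr x xi) + B xi * sin (dotr x xi)| <= `|A xi| + `|B xi|.
Proof.
by rewrite (le_trans (ler_normD _ _))// lerD// norm_wave_le//; [exact: wave_cos|exact: wave_sin].
Qed.

Lemma integrable_absD A B : integrableR A -> integrableR B ->
  integrableR (fun xi => `|A xi| + `|B xi|).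
Proof. by move=> iA iB; apply: integrable_add => //; exact: integrable_normr. Qed.

Lemma norm_synth_le A B x : integrableR A -> integrableR B ->
  `|synth A B x| <= \int[mu]_xi (`|A xi| + `|B xi|).
Proof.
move=> iA iB; apply: (le_trans (le_normr_Rintegral measurableT _)).
  exact: integrable_synth.
apply: le_Rintegral => //.
- by apply: integrable_normr; exact: integrable_synth.
- exact: integrable_absD.
- by move=> xi _; exact: synth_le.
Qed.

Lemma integrable_gexpM s F : integrableR F -> integrableR (fun xi => gexp s xi * F xi).
Proof.
move=> iF; apply: (integrable_mulb measurableT (M := 1)) => //.
  exact: measurable_gexp.
by move=> xi _; rewrite ger0_norm ?gexp_ge0// gexp_le1.
Qed.

Lemma measurable_synthf A B : measurable_fun setT A -> measurable_fun setT B ->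
  measurable_fun setT (fun p : rV * rV =>
    A p.2 * cos (dotr p.1 p.2) + B p.2 * sin (dotr p.1 p.2)).
Proof.
move=> mA mB; apply: measurable_funD; apply: measurable_funM.
- exact: (measurableT_comp mA measurable_snd).
- exact: measurable_wave (@wave_cos R) measurable_dotr2.
- exact: (measurableT_comp mB measurable_snd).
- exact: measurable_wave (@wave_sin R) measurable_dotr2.
Qed.

Lemma measurable_synth A B : measurable_fun setT A -> measurable_fun setT B ->
  measurable_fun setT (synth A B).
Proof.
move=> mA mB.
exact: (measurable_Rintegral_param (m2 := mu) (@sigma_finite_lebesgue_rV R N) (measurable_synthf mA mB)).
Qed.

Lemma measurable_waveT c u : wave c -> measurable_fun setT u ->
  measurable_fun setT (waveT c u).
Proof.
move=> wc mu_; apply: (measurable_Rintegral_param (m2 := mu)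
  (f := fun p : rV * rV => u p.2 * c (dotr p.2 p.1)) (@sigma_finite_lebesgue_rV R N)).
apply: measurable_funM; first exact: (measurableT_comp mu_ measurable_snd).
apply: (measurable_wave wc); under eq_fun do rewrite dotrC.
exact: measurable_dotr2.
Qed.

Lemma norm_waveT_le c u xi : wave c -> integrableR u ->
  `|waveT c u xi| <= \int[mu]_y `|u y|.
Proof.
move=> wc iu; have iw := integrable_waved xi wc iu.
apply: (le_trans (le_normr_Rintegral measurableT iw)).
apply: le_Rintegral => //; [exact: integrable_normr..|].
by move=> y _; exact: norm_wave_le.
Qed.

Lemma waveT_seq_continuous c u xi : wave c -> integrableR u ->
  seq_continuous_at (waveT c u) xi.
Proof.
move=> wc iu w hw; refine (proj2 (@Rintegral_dct _ _ _ mu setT measurableT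
  (fun n y => u y * c (dotr y (w n))) (fun y => u y * c (dotr y xi)) (fun y => `|u y|)
  _ _ (integrable_normr iu) _)).
- by move=> n; apply: (integrable_measurable (mu := mu)); exact: integrable_waved.
- move=> y _; apply: cvgMr; apply: continuous_cvg; first exact: wc.1.
  by rewrite /dotr; apply: cvg_sumR => i; apply: cvgMr.
- by move=> n y _; exact: norm_wave_le.
Qed.

Lemma gaussN_sin x xi s : s != 0 ->
  \int[mu]_y (gaussN x s y * sin (dotr y xi)) = sin (dotr x xi) * gexp s xi.
Proof.
move=> s0; have h (z : R) : sin z = cos (z + - (pi / 2)).
  by rewrite -[LHS](cosBpihalf z).
rewrite h -(gaussN_cos _ _ _ s0); apply: eq_Rintegral => y _; by rewrite h.
Qed.

Lemma gaussN_cos0 x xi s : s != 0 ->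
  \int[mu]_y (gaussN x s y * cos (dotr y xi)) = cos (dotr x xi) * gexp s xi.
Proof.
move=> s0; rewrite -[dotr x xi]addr0 -(gaussN_cos _ _ _ s0).
by apply: eq_Rintegral => y _; rewrite addr0.
Qed.

(** A Gaussian multiplier averages the synthesized function against a Gaussian
    density: Fubini, and the cosine and sine transforms of the density. This is
    the source of all positivity below. *)
Lemma synth_gexp A B x s : s != 0 -> integrableR A -> integrableR B ->
  synth (fun xi => gexp s xi * A xi) (fun xi => gexp s xi * B xi) x =
  \int[mu]_y (gaussN x s y * synth A B y).
Proof.
move=> s0 iA iB.
have [mA mB] := (integrable_measurable iA, integrable_measurable iB).
pose f (p : rV * rV) := gaussN x s p.1 *
    (A p.2 * cos (dotr p.1 p.2) + B p.2 * sin (dotr p.1 p.2)).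
have mf : measurable_fun setT f.
  apply: measurable_funM; last exact: measurable_synthf.
  exact: (measurableT_comp (measurable_gaussN x s) measurable_fst).
transitivity (\int[mu]_y \int[mu]_xi f (y, xi)); last first.
  apply: eq_Rintegral => y _; rewrite /f /= RintegralZl//.
  exact: integrable_synth.
rewrite (Rintegral_Fubini (g := gaussN x s) (h := fun xi => `|A xi| + `|B xi|))//.
- apply: eq_Rintegral => xi _; rewrite /f/=.
  transitivity (\int[mu]_y (A xi * (gaussN x s y * cos (dotr y xi)) +
                            B xi * (gaussN x s y * sin (dotr y xi)))).
    have i1 := integrable_waved xi (@wave_cos R) (integrable_gaussN x s).
    have i2 := integrable_waved xi (@wave_sin R) (integrable_gaussN x s).
    rewrite RintegralD//; [|exact: integrable_mulr..].
    by rewrite !RintegralZl// gaussN_cos0// gaussN_sin//; ring.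
  by apply: eq_Rintegral => y _; ring.
- exact: sigma_finite_lebesgue_rV.
- exact: sigma_finite_lebesgue_rV.
- exact: integrable_gaussN.
- exact: integrable_absD.
- move=> y xi; rewrite /f/= normrM ger0_norm ?gaussN_ge0//.
  by rewrite ler_wpM2l ?gaussN_ge0// synth_le.
Qed.

(** The normalizing constants of the deviations s and 1/s multiply to
    1 / (2 pi). *)
Lemma normal_peakV s : s != 0 -> (normal_peak s^-1)^-1 = 2 * pi * normal_peak s.
Proof.
move=> s0; have p0 := normal_peak_gt0 s0.
have q0 : 0 < normal_peak s^-1 by rewrite normal_peak_gt0// invr_neq0.
suff e : 2 * pi * normal_peak s * normal_peak s^-1 = 1.
  by rewrite -[RHS](mulfK (lt0r_neq0 q0)) e mul1r.
rewrite /normal_peak -mulrA -invfM -sqrtrM; last first.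
  by rewrite mulrn_wge0// mulr_ge0 ?sqr_ge0 ?pi_ge0.
rewrite (_ : s ^+ 2 * pi *+ 2 * (s^-1 ^+ 2 * pi *+ 2) = (2 * pi) ^+ 2); last by field.
by rewrite sqrtr_sqr ger0_norm ?mulr_ge0 ?pi_ge0// divff// mulf_neq0 ?gt_eqF ?pi_gt0.
Qed.

Lemma gexpE s xi : s != 0 ->
  gexp s xi = (2 * pi * normal_peak s) ^+ N * gaussN (0 : rV) s^-1 xi.
Proof.
move=> s0; rewrite -normal_peakV// /gaussN.
have sV0 : s^-1 != 0 by rewrite invr_neq0.
have q0 := normal_peak_gt0 sV0.
rewrite -[N in _ ^+ N]card_ord -prodr_const -big_split/=.
rewrite /gexp /dotr mulr_sumr mulr_suml -sumrN expR_sum.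
apply: eq_bigr => i _; rewrite normal_pdfE// mulKf ?gt_eqF// /normal_fun mxE subr0.
by congr expR; field.
Qed.

Lemma integrable_gexp s : s != 0 -> integrableR (gexp s).
Proof.
move=> s0; rewrite /integrableR (_ : gexp s = fun xi =>
  (2 * pi * normal_peak s) ^+ N * gaussN (0 : rV) s^-1 xi).
  by apply: integrable_mulr => //; exact: integrable_gaussN.
by apply/funext => xi; rewrite gexpE.
Qed.

(** Self-duality of the Gaussian: [gexp s] is a multiple of the density of
    deviation 1/s, so transforming it once more gives back the density of
    deviation s. *)
Lemma gexp_cos x y s th : s != 0 ->
  \int[mu]_xi (gexp s xi * cos (dotr xi (x - y) + th)) =
  (2 * pi) ^+ N * gaussN x s y * cos th.
Proof.
move=> s0; have sV0 : s^-1 != 0 by rewrite invr_neq0.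
under eq_Rintegral do rewrite gexpE// -mulrA.
rewrite RintegralZl//; last first.
  exact: (integrable_waved _ (wave_shift th (@wave_cos R)) (integrable_gaussN (0 : rV) s^-1)).
have -> : gaussN x s y = normal_peak s ^+ N *
    expR (- (s^-1 ^+ 2 * dotr (x - y) (x - y) / 2)).
  rewrite /gaussN /dotr mulr_sumr mulr_suml -sumrN expR_sum.
  rewrite -[N in _ ^+ N]card_ord -prodr_const -big_split/=.
  apply: eq_bigr => i _; rewrite normal_pdfE// /normal_fun !mxE.
  by congr (_ * expR _); field.
by rewrite gaussN_cos// dotr0l add0r exprMn; ring.
Qed.

Lemma gaussN_le x y s : s != 0 -> gaussN x s y <= normal_peak s ^+ N.
Proof.
move=> s0; rewrite /gaussN -[N in _ ^+ N]card_ord -prodr_const; apply: ler_prod => i _.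
by rewrite normal_pdf_ge0 normal_pdf_ub.
Qed.

Lemma integrable_gaussNM x s F : s != 0 -> integrableR F ->
  integrableR (fun y => gaussN x s y * F y).
Proof.
move=> s0; apply: (integrable_mulb measurableT (M := normal_peak s ^+ N)) => [|y _].
  exact: measurable_gaussN.
by rewrite ger0_norm ?gaussN_ge0// gaussN_le.
Qed.

(** Damping the amplitudes by a Gaussian makes the double integral converge
    absolutely, and integrating first in the frequency produces the Gaussian
    kernel. *)
Lemma synth_gexp_transform u x s : s != 0 -> integrableR u ->
  synth (fun xi => gexp s xi * cosT u xi) (fun xi => gexp s xi * sinT u xi) x =
  (2 * pi) ^+ N * \int[mu]_y (gaussN x s y * u y).
Proof.
move=> s0 iu; have mu_ := integrable_measurable iu.
pose f (p : rV * rV) := gexp s p.1 * cos (dotr p.1 (x - p.2)) * u p.2.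
have mf : measurable_fun setT f.
  apply: measurable_funM; last exact: (measurableT_comp mu_ measurable_snd).
  apply: measurable_funM; first exact: (measurableT_comp (measurable_gexp s) measurable_fst).
  rewrite (_ : (fun _ => _) = (fun p : rV * rV => cos (dotr p.1 x - dotr p.1 p.2))); last first.
    by apply/funext => p; rewrite ![dotr p.1 _]dotrC dotrBl.
  apply: (measurable_wave (@wave_cos R)); apply: measurable_funB.
    exact: (measurableT_comp (measurable_dotr x) measurable_fst).
  exact: measurable_dotr2.
transitivity (\int[mu]_xi \int[mu]_y f (xi, y)).
  apply: eq_Rintegral => xi _; rewrite /f/=.
  transitivity (\int[mu]_y (gexp s xi * cos (dotr x xi) * (u y * cos (dotr y xi)) +
      gexp s xi * sin (dotr x xi) * (u y * sin (dotr y xi)))).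
    have i1 := integrable_waved xi (@wave_cos R) iu; have i2 := integrable_waved xi (@wave_sin R) iu.
    rewrite RintegralD//; [|exact: integrable_mulr..].
    by rewrite !RintegralZl// /cosT /sinT /waveT; ring.
  by apply: eq_Rintegral => y _; rewrite [dotr xi _]dotrC dotrBl cosB; ring.
rewrite (Rintegral_Fubini (g := gexp s) (h := fun y => `|u y|))//.
- rewrite -RintegralZl//; last first.
    exact: integrable_gaussNM.
  apply: eq_Rintegral => y _; rewrite /f/= RintegralZr//.
    rewrite mulrA; congr (_ * _).
    rewrite -[RHS]mulr1 -[X in _ = _ * X]cos0 -gexp_cos//.
    by apply: eq_Rintegral => xi _; rewrite addr0.
  exact: integrable_waved (@wave_cos R) (integrable_gexp s0).
- exact: sigma_finite_lebesgue_rV.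
- exact: sigma_finite_lebesgue_rV.
- exact: integrable_gexp.
- exact: integrable_normr.
- move=> xi y; rewrite /f/= normrM ler_wpM2r// normrM ger0_norm ?gexp_ge0//.
  by rewrite ler_piMr ?gexp_ge0// norm_cos_le1.
Qed.

End transforms.

(** * Fourier inversion *)

Section approximate_identity.
Variables (R : realType) (N : nat).
Local Notation mu := (@lebesgue_rV R N).
Local Notation rV := 'rV[R]_N.
Implicit Types (A B F u : rV -> R) (x y xi : rV) (s th : R).

(** Deviations of the Gaussian kernels used as an approximate identity. *)
Definition scale (n : nat) : R := n.+1%:R^-1.

Lemma scale_gt0 n : 0 < scale n. Proof. by rewrite invr_gt0. Qed.
Lemma scale_neq0 n : scale n != 0. Proof. by rewrite gt_eqF ?scale_gt0. Qed.

Lemma cvg_scale : scale n @[n --> \oo] --> 0.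
Proof. exact: cvg_harmonic. Qed.

Lemma cvg_gexp xi : gexp (scale n) xi @[n --> \oo] --> (1 : R).
Proof.
suff : gexp (scale n) xi @[n --> \oo] --> expR (- (0 ^+ 2 * dotr xi xi / 2)).
  by rewrite expr0n/= !mul0r oppr0 expR0.
apply: continuous_cvg; first exact: continuous_expR.
apply: cvgN; apply: cvgMl; apply: cvgMl.
by rewrite expr2; under eq_fun do rewrite expr2; apply: cvgM; exact: cvg_scale.
Qed.

Lemma normal_peak1_le1 : normal_peak (1 : R) <= 1.
Proof.
rewrite /normal_peak invf_le1; last by rewrite sqrtr_gt0 expr1n mul1r mulrn_wgt0// pi_gt0.
rewrite -[leLHS]sqrtr1 ler_wsqrtr// expr1n mul1r.
by have := @pi_ge2 R; lra.
Qed.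

(** Outside the cube of half-side delta, the narrow kernel is a small multiple of
    the kernel of deviation 1: the coordinate that leaves the cube provides the
    exponential, all the others at most the factor n + 1. *)
Lemma gaussN_tail x y (n : nat) (delta : R) : 0 < delta ->
  (exists i, delta < `|y ord0 i - x ord0 i|) ->
  gaussN x (scale n) y <=
  n.+1%:R ^+ N * expR (- (delta ^+ 2 * (n.+1%:R ^+ 2 - 1) / 2)) * gaussN x 1 y.
Proof.
move=> d0 [j hj].
have e i : normal_pdf (x ord0 i) (scale n) (y ord0 i) =
    n.+1%:R * expR (- ((y ord0 i - x ord0 i) ^+ 2 * (n.+1%:R ^+ 2 - 1) / 2)) *
    normal_pdf (x ord0 i) 1 (y ord0 i).
  rewrite !normal_pdfE ?scale_neq0 ?oner_neq0// /normal_fun.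
  have -> : normal_peak (scale n) = n.+1%:R * normal_peak 1.
    rewrite /normal_peak expr1n mul1r -mulrnAr sqrtrM ?sqr_ge0// sqrtr_sqr.
    by rewrite gtr0_norm ?scale_gt0// invfM invrK.
  rewrite -[RHS]mulrA [expR _ * (_ * _)]mulrCA -expRD -mulrA; congr (_ * (_ * expR _)).
  rewrite /scale; field.
  by rewrite (_ : 1 + n%:R = n.+1%:R) ?pnatr_eq0// -natr1 addrC.
rewrite /gaussN (eq_bigr _ (fun i _ => e i)) big_split/= ler_wpM2r//.
  by apply: prodr_ge0 => i _; exact: normal_pdf_ge0.
rewrite big_split/= prodr_const card_ord ler_wpM2l ?exprn_ge0//.
rewrite (bigD1 j)//= -[leRHS]mulr1 ler_pM ?expR_ge0 ?prodr_ge0//.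
- rewrite ler_expR lerN2 ler_wpM2r// ler_wpM2r//.
    by rewrite subr_ge0 exprn_ege1// ler1n.
  by rewrite -[leRHS]real_normK ?num_real// lerXn2r ?nnegrE// ltW.
- apply: prodr_ile1 => i _; rewrite expR_ge0 -[X in _ <= X]expR0 ler_expR oppr_le0.
  by rewrite divr_ge0// mulr_ge0 ?sqr_ge0// subr_ge0 exprn_ege1// ler1n.
Qed.

(** One term of the exponential series, of degree N + 1 in c (n + 1), suffices to
    absorb the power N and leave a factor 1 / (n + 1). *)
Lemma cvg_tail (delta : R) : 0 < delta ->
  n.+1%:R ^+ N * expR (- (delta ^+ 2 * (n.+1%:R ^+ 2 - 1) / 2)) @[n --> \oo] --> (0 : R).
Proof.
move=> d0; pose c := delta ^+ 2 / 2.
have c0 : 0 < c by rewrite divr_gt0// exprn_gt0.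
have C0 : 0 < N.+1`!%:R / c ^+ N.+1 by rewrite divr_gt0 ?ltr0n ?fact_gt0// exprn_gt0.
apply: (@squeeze_cvgr _ _ _ _ (cst 0) (fun n => expR c * (N.+1`!%:R / c ^+ N.+1) * scale n)).
- near=> n; rewrite mulr_ge0 ?exprn_ge0 ?expR_ge0//=.
  have -> : - (delta ^+ 2 * (n.+1%:R ^+ 2 - 1) / 2) = c - c * n.+1%:R ^+ 2.
    by rewrite /c; field.
  clearbody c; rewrite expRB [_ * (_ / _)]mulrCA -mulrA [X in _ <= X]mulrA -mulrA ler_wpM2l ?expR_ge0//.
  rewrite /scale; set m : R := n.+1%:R; have m0 : 0 < m by rewrite /m ltr0n.
  rewrite ler_pdivrMr ?expR_gt0//.
  have h := @expR_ge1Dxn R (c * m) N (ltW (mulr_gt0 c0 m0)).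
  have h2 : expR (c * m) <= expR (c * m ^+ 2).
    rewrite ler_expR ler_wpM2l ?(ltW c0)// ler_eXnr//.
    by rewrite /m ler1n.
  have {}h : (c * m) ^+ N.+1 / N.+1`!%:R <= expR (c * m ^+ 2).
    by apply: le_trans h2; apply: le_trans h; rewrite lerDr.
  apply: le_trans (ler_wpM2l _ h); last first.
    by rewrite mulr_ge0 ?invr_ge0// ltW.
  rewrite le_eqVlt; apply/orP; left; apply/eqP.
  rewrite exprMn !exprS.
  move: (fact_gt0 N.+1) (exprn_gt0 N c0); set F := (N.+1`!)%N; set a := c ^+ N => F0 a0; field.
  by rewrite pnatr_eq0 -lt0n F0 !gt_eqF.
- exact: cvg_cst.
- rewrite -(mulr0 (expR c * (N.+1`!%:R / c ^+ N.+1))).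
  by apply: cvgMr; exact: cvg_scale.
Unshelve. all: by end_near. Qed.

(** The kernels are an approximate identity: near x continuity applies, and away
    from x the factor of [gaussN_tail] makes the contribution of the integrable
    function F negligible. *)
Lemma gaussN_approx F x : integrableR F -> seq_continuous_at F x ->
  \int[mu]_y (gaussN x (scale n) y * F y) @[n --> \oo] --> F x.
Proof.
move=> iF cF; apply/cvgrPdist_le => e e0.
have e20 : 0 < e / 2 by rewrite divr_gt0.
have [delta d0 near_x] := seq_continuous_at_near cF e20.
pose tau n : R := n.+1%:R ^+ N * expR (- (delta ^+ 2 * (n.+1%:R ^+ 2 - 1) / 2)).
have tau0 n : 0 <= tau n by rewrite mulr_ge0 ?exprn_ge0 ?expR_ge0.
pose C := \int[mu]_y `|F y| + `|F x|.
have C0 : 0 <= C by rewrite addr_ge0 ?Rintegral_ge0.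
have ig s : integrableR (gaussN x s) := integrable_gaussN x s.
have igF n : integrableR (fun y => gaussN x (scale n) y * F y).
  by apply: integrable_gaussNM => //; exact: scale_neq0.
have key n : `|\int[mu]_y (gaussN x (scale n) y * F y) - F x| <= e / 2 + tau n * C.
  rewrite -[X in `|_ - X|]mulr1 -[X in `|_ - _ * X|](Rintegral_gaussN x (scale n)).
  rewrite -RintegralZl//; last exact: ig.
  rewrite -(RintegralB _ (igF n) (integrableR_mulr _ (ig _)))//.
  have iB : integrableR (fun y => gaussN x (scale n) y * F y - F x * gaussN x (scale n) y).
    by apply: integrableR_sub => //; exact: integrableR_mulr.
  apply: (le_trans (le_normr_Rintegral measurableT iB)).
  have iG : integrableR (fun y => e / 2 * gaussN x (scale n) y +
      tau n * (`|F y| + `|F x| * gaussN x 1 y)).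
    apply: integrableR_add => //; first exact: integrableR_mulr.
    apply: integrableR_mulr => //; apply: integrableR_add => //.
      exact: integrableR_normr.
    exact: integrableR_mulr.
  apply: (@le_trans _ _ (\int[mu]_y (e / 2 * gaussN x (scale n) y +
      tau n * (`|F y| + `|F x| * gaussN x 1 y)))).
    apply: le_Rintegral => //; first exact: integrableR_normr.
    move=> y _; rewrite [F x * _]mulrC -mulrBr normrM ger0_norm ?gaussN_ge0//.
    have [h|/existsNP[i /negP]] := pselect (forall i, `|y ord0 i - x ord0 i| <= delta).
      rewrite -[leLHS]addr0 lerD//.
        by rewrite mulrC ler_wpM2r ?gaussN_ge0// near_x.
      by rewrite mulr_ge0// addr_ge0// mulr_ge0// gaussN_ge0.
    rewrite -ltNge => hi.
    rewrite -[leLHS]add0r lerD//; first by rewrite mulr_ge0 ?gaussN_ge0// ltW.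
    have ht := @gaussN_tail x y n delta d0 (ex_intro _ i hi).
    rewrite -/(tau n) in ht.
    apply: (le_trans (ler_wpM2r (normr_ge0 _) ht)).
    rewrite -mulrA ler_wpM2l// (le_trans (ler_wpM2l (gaussN_ge0 _ _ _) (ler_normB _ _)))//.
    rewrite mulrDr lerD// ?[gaussN _ _ _ * _]mulrC// ler_piMr//.
    rewrite (le_trans (gaussN_le _ _ _)) ?oner_neq0//.
    by rewrite exprn_ile1 ?normal_peak_ge0 ?normal_peak1_le1.
  have i1 : integrableR (fun y => `|F x| * gaussN x 1 y) by exact: integrableR_mulr.
  have i0 : integrableR (fun y => `|F y|) by exact: integrableR_normr.
  have i2 : integrableR (fun y => `|F y| + `|F x| * gaussN x 1 y) by exact: integrableR_add.
  rewrite (RintegralD _ (integrableR_mulr _ (ig _)) (integrableR_mulr _ i2))//.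
  rewrite (RintegralZl _ _ (ig _))// (RintegralZl _ _ i2)// (RintegralD _ i0 i1)//.
  by rewrite (RintegralZl _ _ (ig _))// !Rintegral_gaussN !mulr1.
have /cvgrPdist_le/(_ _ e20) : tau n * C @[n --> \oo] --> 0.
  by rewrite -(mul0r C); apply: cvgMl; exact: cvg_tail.
apply: filterS => n; rewrite sub0r normrN ger0_norm ?mulr_ge0// => h.
rewrite distrC (le_trans (key n))//.
by rewrite [leRHS](splitr e) lerD2l.
Qed.

(** Both sides of the damped inversion formula converge when the damping is
    removed: the right-hand one by the approximate identity, the left-hand one
    by dominated convergence. *)
Lemma fourier_inversion u x : integrableR u -> seq_continuous_at u x ->
  integrableR (cosT u) -> integrableR (sinT u) ->
  synth (cosT u) (sinT u) x = (2 * pi) ^+ N * u x.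
Proof.
move=> iu cu ic is_.
have h1 : synth (fun xi => gexp (scale n) xi * cosT u xi)
    (fun xi => gexp (scale n) xi * sinT u xi) x @[n --> \oo] --> (2 * pi) ^+ N * u x.
  rewrite (_ : (fun n => _) = (fun n => (2 * pi) ^+ N *
      \int[mu]_y (gaussN x (scale n) y * u y))).
    by apply: cvgMr; exact: gaussN_approx.
  by apply/funext => n; rewrite synth_gexp_transform// scale_neq0.
have h2 : synth (fun xi => gexp (scale n) xi * cosT u xi)
    (fun xi => gexp (scale n) xi * sinT u xi) x @[n --> \oo] --> synth (cosT u) (sinT u) x.
  refine (proj2 (@Rintegral_dct _ _ _ mu setT measurableT
    (fun n xi => gexp (scale n) xi * cosT u xi * cos (dotr x xi) +
      gexp (scale n) xi * sinT u xi * sin (dotr x xi)) _ _ _ _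
    (integrable_absD ic is_) _)).
  - move=> n; apply: (integrable_measurable (mu := mu)); apply: integrable_synth;
      exact: integrable_gexpM.
  - move=> xi _; rewrite -[cosT u xi in X in _ --> X]mul1r -[sinT u xi in X in _ --> X]mul1r.
    by apply: cvgD; apply: cvgMl; apply: cvgMl; exact: cvg_gexp.
  - move=> n xi _; rewrite (le_trans (synth_le (fun xi => gexp (scale n) xi * cosT u xi)
      (fun xi => gexp (scale n) xi * sinT u xi) x xi))//.
    by rewrite lerD// normrM ger0_norm ?gexp_ge0// ler_piMl// gexp_le1.
exact: cvg_unique h2 h1.
Qed.

(** The converse inversion. With a Gaussian weight in x the integrals can be
    exchanged; the weight turns products of waves into Gaussian kernels centred
    at eta and - eta, and the parities of A and B identify the two
    contributions. *)
Lemma synth_transform A B D eta th : integrableR A -> integrableR B -> integrableR D ->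
  (forall x, D x = synth A B x) ->
  (forall xi, A (- xi) = A xi) -> (forall xi, B (- xi) = - B xi) ->
  (forall xi, seq_continuous_at A xi) -> (forall xi, seq_continuous_at B xi) ->
  \int[mu]_x (D x * cos (dotr x eta + th)) =
  (2 * pi) ^+ N * (A eta * cos th - B eta * sin th).
Proof.
move=> iA iB iD DE eA oB cA cB.
have [mA mB] := (integrable_measurable iA, integrable_measurable iB).
have wc := wave_shift th (@wave_cos R).
have iDc : integrableR (fun x => D x * cos (dotr x eta + th)) by exact: (integrable_waved eta wc iD).
pose I n := \int[mu]_x (gexp (scale n) x * (D x * cos (dotr x eta + th))).
have h1 : I n @[n --> \oo] --> \int[mu]_x (D x * cos (dotr x eta + th)).
  refine (proj2 (@Rintegral_dct _ _ _ mu setT measurableT _ _ _ _ _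
    (integrableR_normr iDc) _)).
  - by move=> n; apply: (integrable_measurable (mu := mu)); exact: integrable_gexpM.
  - move=> x _; rewrite -[X in _ --> X]mul1r.
    by apply: cvgMl; exact: cvg_gexp.
  - move=> n x _.
    by rewrite normrM ger0_norm ?gexp_ge0// ler_piMl// gexp_le1.
pose Kp n xi := gaussN eta (scale n) xi.
pose Km n xi := gaussN (- eta) (scale n) xi.
(* Kp and Km are the kernels produced by the frequencies xi - eta and xi + eta. *)
have IE n : I n = (2 * pi) ^+ N * (
    (cos th / 2) * (\int[mu]_xi (Kp n xi * A xi) + \int[mu]_xi (Km n xi * A xi)) +
    (sin th / 2) * (\int[mu]_xi (Km n xi * B xi) - \int[mu]_xi (Kp n xi * B xi))).
  set s := scale n; have s0 : s != 0 by exact: scale_neq0.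
  pose f (p : rV * rV) := gexp s p.1 * (A p.2 * cos (dotr p.1 p.2) + B p.2 * sin (dotr p.1 p.2))
    * cos (dotr p.1 eta + th).
  have mf : measurable_fun setT f.
    apply: measurable_funM; last first.
      by apply: (measurable_wave wc); exact: (measurableT_comp (measurable_dotr _) measurable_fst).
    apply: measurable_funM; last exact: measurable_synthf.
    exact: (measurableT_comp (measurable_gexp s) measurable_fst).
  transitivity (\int[mu]_x \int[mu]_xi f (x, xi)).
    apply: eq_Rintegral => x _; rewrite /f/= RintegralZr//; last first.
      by apply: integrableR_mulr => //; exact: integrable_synth.
    rewrite RintegralZl//; last exact: integrable_synth.
    by rewrite DE mulrA.
  rewrite (Rintegral_Fubini (g := gexp s) (h := fun y => `|A y| + `|B y|))//; last 5 first.
  - exact: sigma_finite_lebesgue_rV.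
  - exact: sigma_finite_lebesgue_rV.
  - exact: integrable_gexp.
  - exact: integrable_absD.
  - move=> x xi; rewrite /f/= normrM -[leRHS]mulr1 ler_pM// ?norm_cos_le1//.
    by rewrite normrM ger0_norm ?gexp_ge0// ler_wpM2l ?gexp_ge0// synth_le.
  have iK (w : rV) (F : rV -> R) : integrableR F -> integrableR (fun y => gaussN w s y * F y).
    exact: integrable_gaussNM.
  rewrite -!RintegralD//; [|exact: iK..].
  rewrite -RintegralB//; [|exact: iK..].
  have iS : integrableR (fun x => Kp n x * A x + Km n x * A x).
    by apply: integrableR_add => //; exact: iK.
  have iT : integrableR (fun x => Km n x * B x - Kp n x * B x).
    by apply: integrableR_sub => //; exact: iK.
  rewrite -!RintegralZl// -RintegralD//; [|exact: integrableR_mulr..].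
  rewrite -RintegralZl//; last by apply: integrableR_add => //; exact: integrableR_mulr.
  apply: eq_Rintegral => xi _.
  have ic w r : integrableR (fun x => gexp s x * cos (dotr x w + r)).
    exact: (integrable_waved w (wave_shift r (@wave_cos R)) (integrable_gexp N s0)).
  have e1 r : \int[mu]_x (gexp s x * cos (dotr x (xi - eta) + r)) =
      (2 * pi) ^+ N * Kp n xi * cos r.
    by rewrite gexp_cos// gaussNC.
  have e2 r : \int[mu]_x (gexp s x * cos (dotr x (xi + eta) + r)) =
      (2 * pi) ^+ N * Km n xi * cos r.
    by rewrite -{1}(opprK eta) gexp_cos// gaussNC.
  transitivity (\int[mu]_x (
    A xi / 2 * (gexp s x * cos (dotr x (xi - eta) + - th)) +
    A xi / 2 * (gexp s x * cos (dotr x (xi + eta) + th)) +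
    (B xi / 2 * (gexp s x * cos (dotr x (xi + eta) + (th - pi / 2))) +
    B xi / 2 * (gexp s x * cos (dotr x (xi - eta) + (- th - pi / 2)))))).
    apply: eq_Rintegral => x _; rewrite /f/=.
    have sE (z w : R) : cos (z + (w - pi / 2)) = sin (z + w).
      by rewrite addrA cosBpihalf.
    rewrite !sE ![dotr x (_ + _)]dotrC !dotrDl dotrNl ![dotr _ x]dotrC.
    rewrite (_ : dotr x xi - dotr x eta + (- th) = dotr x xi - (dotr x eta + th)); last by ring.
    rewrite -(addrA (dotr x xi) (dotr x eta) th).
    move: (dotr x eta + th) => b; move: (dotr x xi) => a.
    by rewrite cosB cosD sinB sinD; field.
  have im k w r : integrableR (fun x => k * (gexp s x * cos (dotr x w + r))).
    exact: (integrableR_mulr k (ic w r)).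
  rewrite !RintegralD//; try exact: im; try (by apply: integrableR_add => //; exact: im).
  rewrite !RintegralZl//; try exact: ic.
  rewrite !e1 !e2 cosN !cosBpihalf sinN.
  by field.
have cA' := cA eta; have cAm := cA (- eta); have cBm := cB (- eta).
have h2 : I n @[n --> \oo] --> (2 * pi) ^+ N * (
    (cos th / 2) * (A eta + A (- eta)) + (sin th / 2) * (B (- eta) - B eta)).
  rewrite (funext IE); apply: cvgMr; apply: cvgD; apply: cvgMr.
    by apply: cvgD; exact: gaussN_approx.
  by apply: cvgB; exact: gaussN_approx.
rewrite (cvg_unique _ h1 h2)// eA oB; congr (_ * _); by field.
Qed.

End approximate_identity.

(** * The binomial series and multipliers that preserve lower bounds *)

Section real_powers.
Variable R : realType.
Implicit Types (s x z l : R).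

Lemma cvg_powR (u : nat -> R) l s : 0 < s -> 0 <= l -> (forall n, 0 <= u n) ->
  u n @[n --> \oo] --> l -> u n `^ s @[n --> \oo] --> l `^ s.
Proof.
move=> s0; rewrite le_eqVlt => /predU1P[<-|l0] u0 ul.
  rewrite powR0 ?gt_eqF//; apply/cvgrPdist_le => e e0.
  have e1 : 0 < e `^ s^-1 by rewrite powR_gt0.
  have /cvgrPdist_le/(_ _ e1) := ul; apply: filterS => n.
  rewrite !sub0r !normrN !ger0_norm ?powR_ge0// => h.
  have := ge0_ler_powR (ltW s0) _ _ h; rewrite !nnegrE => /(_ (u0 n) (powR_ge0 _ _)).
  by rewrite -powRrM mulVf ?gt_eqF// powRr1 ?(ltW e0).
have c : {for l, continuous (fun x : R => x `^ s)}.
  apply: differentiable_continuous; apply/derivable1_diffP.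
  by have [] := is_derive1_powR s l0.
exact: (@continuous_cvg _ _ _ _ _ u (fun x : R => x `^ s) l c ul).
Qed.

(** The Taylor coefficients of s (1 - z)^(s - 1), the derivative of
    1 - (1 - z)^s. They are nonnegative since s lies in ]0, 1[. *)
Fixpoint dcoef s (k : nat) : R :=
  if k is k'.+1 then dcoef s k' * ((k'.+1%:R - s) / k'.+1%:R) else s.

Lemma dcoef_ge0 s k : 0 < s < 1 -> 0 <= dcoef s k.
Proof.
move=> /andP[s0 s1]; elim: k => [|k IH] /=; first exact: ltW.
by rewrite mulr_ge0// divr_ge0// subr_ge0 (le_trans (ltW s1))// ler1n.
Qed.

Lemma dcoef_le s k : 0 < s < 1 -> dcoef s k <= s.
Proof.
move=> s01; have /andP[s0 s1] := s01; elim: k => [|k IH] //=.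
rewrite (le_trans _ IH)// ler_piMr ?dcoef_ge0//.
by rewrite ler_pdivrMr// mul1r gerBl ltW.
Qed.

(** The Taylor polynomial of degree n of 1 - (1 - z)^s at 0. *)
Definition bpoly s n z : R := \sum_(k < n) (dcoef s k / k.+1%:R) * z ^+ k.+1.

Lemma is_derive_bpoly s n z :
  is_derive z 1 (bpoly s n) (\sum_(k < n) dcoef s k * z ^+ k).
Proof.
rewrite /bpoly; elim: n => [|n IH].
  rewrite big_ord0 (_ : (fun z => _) = cst 0); last by apply/funext => y; rewrite big_ord0.
  exact: is_derive_cst.
rewrite big_ord_recr/= (_ : (fun z => _) = (bpoly s n) +
    (fun z => (dcoef s n / n.+1%:R) * z ^+ n.+1)); last first.
  by apply/funext => y; rewrite big_ord_recr.
apply: is_deriveD.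
have hX : is_derive z 1 (fun z : R => z ^+ n.+1) (n.+1%:R * z ^+ n).
  apply: DeriveDef; first exact: exprn_derivable.
  by rewrite exp_derive /GRing.scale/= mulr1.
apply: is_derive_eq.
by rewrite /GRing.scale/=; field; rewrite (_ : 1 + n%:R = n.+1%:R) ?pnatr_eq0// -natr1 addrC.
Qed.

(** The function f = 1 - (1 - z)^s satisfies (1 - z) f' + s f = s; its Taylor
    polynomial does so up to a single monomial. *)
Lemma bpoly_ode s n z :
  (1 - z) * (\sum_(k < n) dcoef s k * z ^+ k) + s * bpoly s n z = s - dcoef s n * z ^+ n.
Proof.
elim: n => [|n IH]; first by rewrite /bpoly !big_ord0 /= expr0; ring.
rewrite /bpoly !big_ord_recr/= -/(bpoly s n z) mulrDr mulrDr addrACA IH /=.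
by rewrite exprS; field; rewrite (_ : 1 + n%:R = n.+1%:R) ?pnatr_eq0// -natr1 addrC.
Qed.

(** Newton's binomial series: the quotient Q n of 1 - bpoly by (1 - z)^s starts at
    1 and by [bpoly_ode] has a derivative of order z^n, so it stays close to 1. *)
Lemma cvg_bpoly s z : 0 < s < 1 -> 0 <= z < 1 ->
  bpoly s n z @[n --> \oo] --> 1 - (1 - z) `^ s.
Proof.
move=> s01 /andP[z0 z1]; have /andP[s0 s1] := s01.
have [->|zn0] := eqVneq z 0.
  rewrite subr0 powR1 subrr (_ : (fun n => _) = cst 0); first exact: cvg_cst.
  by apply/funext => n; rewrite /bpoly big1// => k _; rewrite exprS mul0r mulr0.
have zp : 0 < z by rewrite lt_def zn0.
pose Q n (w : R) := (1 - bpoly s n w) * (1 - w) `^ (- s).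
have dQ n (w : R) : w < 1 -> is_derive w 1 (Q n) (dcoef s n * w ^+ n * (1 - w) `^ (- s - 1)).
  move=> w1; have w10 : 0 < 1 - w by rewrite subr_gt0.
  have d1 := is_derive_bpoly s n w.
  have d2 : is_derive w 1 (fun w : R => (1 - w) `^ (- s)) (- (- s * (1 - w) `^ (- s - 1))).
    have h := is_derive1_powR (- s) w10.
    have hg : is_derive w 1 (fun w : R => 1 - w) (- 1).
      by apply: is_derive_eq; rewrite ?add0r ?sub0r ?mul1r.
    have hc : is_derive w 1 ((fun x : R => x `^ (- s)) \o (fun w : R => 1 - w))
        (- s * (1 - w) `^ (- s - 1) * -1) by exact: is_derive1_comp.
    by apply: (is_derive_eq hc); ring.
  have d3 : is_derive w 1 (fun w => 1 - bpoly s n w) (- \sum_(k < n) dcoef s k * w ^+ k).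
    by apply: is_derive_eq; rewrite ?add0r ?sub0r ?mul1r.
  apply: (is_derive_eq (is_deriveM d3 d2)).
  rewrite /GRing.scale/=.
  have -> : (1 - w) `^ (- s) = (1 - w) * (1 - w) `^ (- s - 1).
    rewrite {1}(_ : - s = 1 + (- s - 1)); last by ring.
    by rewrite powRD ?powRr1 ?(ltW w10)//; apply/implyP => _; rewrite gt_eqF.
  have o := bpoly_ode s n w.
  set p := \sum_(k < n) _ in o *; set b := bpoly s n w in o *.
  have -> : dcoef s n * w ^+ n = s - ((1 - w) * p + s * b) by rewrite o; ring.
  by ring.
have cQ n : {within `[0, z], continuous (Q n)}.
  apply: derivable_within_continuous => w; rewrite in_itv/= => /andP[_ wz].
  by have [] := dQ n w (le_lt_trans wz z1).
have z10 : 0 < 1 - z by rewrite subr_gt0.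
have b0 n : bpoly s n 0 = 0.
  by rewrite /bpoly big1// => k _; rewrite exprS mul0r mulr0.
have key n : 0 <= Q n z - 1 <= s * (1 - z) `^ (- s - 1) * z ^+ n.
  have dQ' w : w \in `]0, z[%R -> is_derive w 1 (Q n) (dcoef s n * w ^+ n * (1 - w) `^ (- s - 1)).
    by rewrite in_itv/= => /andP[_ wz]; apply: dQ; exact: lt_trans z1.
  have [c] := MVT zp dQ' (cQ n).
  rewrite in_itv/= => /andP[c0 cz].
  rewrite {2}/Q b0 !subr0 powR1 mulr1 => ->.
  have c1 : c < 1 := lt_trans cz z1.
  rewrite !mulr_ge0 ?dcoef_ge0 ?powR_ge0 ?exprn_ge0 ?(ltW c0)//=.
  rewrite -[leRHS]mulr1 ler_pM//.
  - by rewrite !mulr_ge0 ?dcoef_ge0 ?powR_ge0 ?exprn_ge0 ?(ltW c0).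
  - rewrite mulrAC ler_pM//.
    + by rewrite mulr_ge0 ?dcoef_ge0 ?powR_ge0.
    + by rewrite exprn_ge0// ltW.
    + rewrite ler_pM ?dcoef_ge0 ?powR_ge0 ?dcoef_le//.
      rewrite (_ : - s - 1 = - (s + 1)); last by ring.
      rewrite !powRN lef_pV2 ?posrE ?powR_gt0 ?subr_gt0//.
      apply: ge0_ler_powR; rewrite ?nnegrE ?subr_ge0 ?ltW//.
        by rewrite addr_gt0.
      by rewrite ltrD2l ltrN2.
    + by rewrite lerXn2r ?nnegrE// ltW.
  - exact: ltW.
have Q1 : Q n z @[n --> \oo] --> (1 : R).
  rewrite -[X in _ --> X]add0r (_ : (fun n => Q n z) = (fun n => (Q n z - 1) + 1)); last first.
    by apply/funext => n; rewrite subrK.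
  apply: cvgD; last exact: cvg_cst.
  apply: (@squeeze_cvgr _ _ _ _ (cst 0) (fun n => s * (1 - z) `^ (- s - 1) * z ^+ n)).
  - by apply: nearW => n; exact: key.
  - exact: cvg_cst.
  - rewrite -(mulr0 (s * (1 - z) `^ (- s - 1))); apply: cvgMr.
    by apply: cvg_expr; rewrite ger0_norm ?(ltW zp).
rewrite (_ : (fun n => _) = (fun n => 1 - Q n z * (1 - z) `^ s)).
  by apply: cvgB; [exact: cvg_cst|rewrite -[X in _ --> X]mul1r; exact: cvgMl].
apply/funext => n; rewrite /Q -mulrA powRN mulVf ?mulr1; first by ring.
by rewrite gt_eqF// powR_gt0.
Qed.

End real_powers.

Section positive_multipliers.
Variables (R : realType) (N : nat).
Local Notation mu := (@lebesgue_rV R N).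
Local Notation rV := 'rV[R]_N.
Implicit Types (A B F u m : rV -> R) (x y xi : rV) (s th c : R).

(** Multipliers that preserve lower bounds: when m acts on a synthesized function
    bounded below by a, the result is bounded below by m(0) a. The
    typical m is the transform of a positive measure of mass m(0); this
    formulation avoids exhibiting the measure and passes to pointwise limits. *)
Record posmult m : Prop := {
  pm_meas : measurable_fun setT m ;
  pm_bound : forall xi, `|m xi| <= m 0 ;
  pm_synth : forall A B (a : R), integrableR A -> integrableR B ->
    (forall x, a <= synth A B x) ->
    forall x, m 0 * a <= synth (fun xi => m xi * A xi) (fun xi => m xi * B xi) x }.

Lemma integrable_pm m A : posmult m -> integrableR A ->
  integrableR (fun xi => m xi * A xi).
Proof.
move=> pm iA; apply: (integrable_mulb measurableT (M := m 0)) => //.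
  exact: pm_meas.
by move=> xi _; exact: pm_bound.
Qed.

Lemma posmult_cst c : 0 <= c -> posmult (fun=> c).
Proof.
move=> c0; split => //; first by move=> _; rewrite ger0_norm.
move=> A B a iA iB h x.
by rewrite synthZ// ler_wpM2l.
Qed.

Lemma posmult_mul m1 m2 : posmult m1 -> posmult m2 -> posmult (fun xi => m1 xi * m2 xi).
Proof.
move=> p1 p2; split.
- by apply: measurable_funM; exact: pm_meas.
- by move=> xi; rewrite normrM ler_pM// pm_bound.
- move=> A B a iA iB h x.
  have := pm_synth p1 (integrable_pm p2 iA) (integrable_pm p2 iB)
    (pm_synth p2 iA iB h) x.
  rewrite mulrA => /le_trans; apply; rewrite le_eqVlt; apply/orP; left; apply/eqP.
  by apply: eq_Rintegral => xi _; ring.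
Qed.

Lemma posmult_add m1 m2 : posmult m1 -> posmult m2 -> posmult (fun xi => m1 xi + m2 xi).
Proof.
move=> p1 p2; split.
- by apply: measurable_funD; exact: pm_meas.
- by move=> xi; rewrite (le_trans (ler_normD _ _))// lerD// pm_bound.
- move=> A B a iA iB h x.
  have h1 := pm_synth p1 iA iB h x.
  have h2 := pm_synth p2 iA iB h x.
  rewrite mulrDl (le_trans (lerD h1 h2))// le_eqVlt; apply/orP; left; apply/eqP.
  rewrite /synth -RintegralD//; [|by apply: integrable_synth; exact: integrable_pm..].
  by apply: eq_Rintegral => xi _; ring.
Qed.

Lemma posmult_exp m n : posmult m -> posmult (fun xi => m xi ^+ n).
Proof.
move=> pm; elim: n => [|n IH].
  by rewrite (_ : (fun _ => _) = (fun=> 1)); [exact: posmult_cst|apply/funext => xi; rewrite expr0].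
rewrite (_ : (fun _ => _) = (fun xi => m xi * m xi ^+ n)).
  exact: posmult_mul.
by apply/funext => xi; rewrite exprS.
Qed.

Lemma posmult_sum (m : nat -> rV -> R) n : (forall k, posmult (m k)) ->
  posmult (fun xi => \sum_(k < n) m k xi).
Proof.
move=> pm; elim: n => [|n IH].
  by rewrite (_ : (fun _ => _) = (fun=> 0)); [exact: posmult_cst|apply/funext => xi; rewrite big_ord0].
rewrite (_ : (fun _ => _) = (fun xi => (\sum_(k < n) m k xi) + m n xi)).
  exact: posmult_add.
by apply/funext => xi; rewrite big_ord_recr.
Qed.

(** Dominated convergence: all but finitely many of the m_ n are bounded by
    m(0) + 1, since each is bounded by its value at 0. *)
Lemma posmult_lim (m_ : nat -> rV -> R) m : (forall n, posmult (m_ n)) ->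
  (forall xi, m_ n xi @[n --> \oo] --> m xi) -> posmult m.
Proof.
move=> pm ml.
have mm : measurable_fun setT m.
  by apply: (measurable_fun_cvg (h := m_)) => [n|xi _ //]; exact: pm_meas.
split => //.
- move=> xi; apply: (ler_cvg_to (cvg_norm (ml xi)) (ml 0)).
  by apply: nearW => n; exact: pm_bound.
- move=> A B a iA iB h x.
  have [K _ mK] : \forall n \near \oo, m_ n 0 <= m 0 + 1.
    have /cvgrPdist_le/(_ 1 ltr01) := ml 0; apply: filterS => n.
    by rewrite distrC ler_norml => /andP[_]; rewrite lerBlDl.
  have cv : synth (fun xi => m_ (n + K)%N xi * A xi) (fun xi => m_ (n + K)%N xi * B xi) x
      @[n --> \oo] --> synth (fun xi => m xi * A xi) (fun xi => m xi * B xi) x.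
    refine (proj2 (@Rintegral_dct _ _ _ mu setT measurableT _ _
      (fun xi => (m 0 + 1) * (`|A xi| + `|B xi|)) _ _
      (integrableR_mulr _ (integrable_absD iA iB)) _)).
    - move=> n; apply: (integrable_measurable (mu := mu)); apply: integrable_synth;
        exact: integrable_pm.
    - move=> xi _; rewrite (cvg_shiftn K (fun n => m_ n xi * A xi * cos (dotr x xi)
          + m_ n xi * B xi * sin (dotr x xi))).
      by apply: cvgD; apply: cvgMl; apply: cvgMl.
    - move=> n xi _.
      rewrite (le_trans (synth_le (fun xi => m_ (n + K)%N xi * A xi)
         (fun xi => m_ (n + K)%N xi * B xi) x xi))// mulrDr !normrM.
      have h1 : `|m_ (n + K)%N xi| <= m 0 + 1.
        by rewrite (le_trans (pm_bound (pm _) _))// mK//= leq_addl.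
      by rewrite lerD// ler_wpM2r.
  have cl : m_ (n + K)%N 0 * a @[n --> \oo] --> m 0 * a.
    by rewrite (cvg_shiftn K (fun n => m_ n 0 * a)); exact: cvgMl.
  apply: (ler_cvg_to cl cv); apply: nearW => n; exact: pm_synth.
Qed.

Lemma posmult_gexp s : s != 0 -> posmult (gexp s : rV -> R).
Proof.
move=> s0; have g0 : gexp s (0 : rV) = 1.
  by rewrite /gexp dotr0l mulr0 mul0r oppr0 expR0.
split.
- exact: measurable_gexp.
- by move=> xi; rewrite g0 ger0_norm ?gexp_ge0// gexp_le1.
- move=> A B a iA iB h x; rewrite synth_gexp// g0 mul1r.
  have ig : integrableR (gaussN x s) by exact: integrable_gaussN.
  rewrite -[leLHS]mulr1 -(Rintegral_gaussN x s) -RintegralZl//.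
  apply: le_Rintegral => //.
  - exact: integrableR_mulr.
  - apply: (integrable_mulbr measurableT (M := \int[mu]_xi (`|A xi| + `|B xi|))) => //.
      exact: (measurable_synth (integrable_measurable iA) (integrable_measurable iB)).
    by move=> y _; exact: norm_synth_le.
  - by move=> y _; rewrite mulrC ler_wpM2l ?gaussN_ge0.
Qed.

Lemma posmult_expR m c : 0 <= c -> posmult m -> posmult (fun xi => expR (c * m xi)).
Proof.
move=> c0 pm; apply: (@posmult_lim (fun n xi => \sum_(k < n) (k`!%:R^-1 * (c * m xi) ^+ k))).
  move=> n; apply: (@posmult_sum (fun k xi => k`!%:R^-1 * (c * m xi) ^+ k)) => k.
  apply: posmult_mul; first by apply: posmult_cst; rewrite invr_ge0.
  by apply: posmult_exp; apply: posmult_mul => //; exact: posmult_cst.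
move=> xi; have := is_cvg_series_exp_coeff (c * m xi).
rewrite /series/= => /cvg_ex[l h].
rewrite /expR (cvg_lim _ h)//.
rewrite (_ : (fun n => _) = (fun n => \sum_(0 <= k < n) exp_coeff (c * m xi) k)); first exact: h.
by apply/funext => n; rewrite big_mkord; apply: eq_bigr => k _; rewrite mulrC.
Qed.

(** The binomial series has nonnegative coefficients, so its partial sums stay in
    the class. *)
Lemma posmult_binom m s : 0 < s < 1 -> posmult m -> (forall xi, 0 <= m xi < 1) ->
  posmult (fun xi => 1 - (1 - m xi) `^ s).
Proof.
move=> s01 pm m01.
apply: (@posmult_lim (fun n xi => bpoly s n (m xi))); last first.
  by move=> xi; exact: cvg_bpoly.
move=> n; apply: (@posmult_sum (fun k xi => (dcoef s k / k.+1%:R) * m xi ^+ k.+1)) => k.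
apply: posmult_mul; last exact: posmult_exp.
by apply: posmult_cst; rewrite divr_ge0// dcoef_ge0.
Qed.

(** The fractional heat semigroup preserves lower bounds. With
    z = exp(- h (|xi|^2 + h)), the quantity ((1 - z) / h)^s tends to |xi|^(2s) as
    h tends to 0, and
    exp(- tau ((1 - z) / h)^s) = exp(- c) exp(c (1 - (1 - z)^s)), c = tau h^(-s),
    is obtained from the Gaussian multiplier z by the operations above. *)
Lemma posmult_stable s (tau : R) : 0 < s < 1 -> 0 <= tau ->
  posmult (fun xi : rV => expR (- (tau * dotr xi xi `^ s))).
Proof.
move=> s01 tau0; have /andP[s0 s1] := s01.
pose h (n : nat) : R := n.+1%:R^-1.
have h0 n : 0 < h n by rewrite invr_gt0.
(* The shift by h n keeps z n below 1 at the origin. *)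
pose z n (xi : rV) := expR (- ((dotr xi xi + h n) * h n)).
have z01 n xi : 0 <= z n xi < 1.
  by rewrite expR_ge0 expR_lt1 oppr_lt0 mulr_gt0// ltr_wpDl// dotr_ge0.
have pz n : posmult (z n).
  have -> : z n = fun xi => expR (- (h n * h n)) * gexp (Num.sqrt (2 * h n)) xi.
    apply/funext => xi; rewrite /gexp sqr_sqrtr; last by rewrite mulr_ge0// ltW.
    by rewrite -expRD; congr expR; field.
  apply: posmult_mul; first by apply: posmult_cst; exact: expR_ge0.
  by apply: posmult_gexp; rewrite sqrtr_eq0 -ltNge mulr_gt0.
pose c n := tau * (h n)^-1 `^ s.
have c0 n : 0 <= c n by rewrite mulr_ge0 ?powR_ge0.
apply: (@posmult_lim (fun n xi => expR (- c n) * expR (c n * (1 - (1 - z n xi) `^ s)))).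
  move=> n; apply: posmult_mul; first by apply: posmult_cst; exact: expR_ge0.
  by apply: posmult_expR => //; exact: posmult_binom.
move=> xi.
have -> : (fun n => expR (- c n) * expR (c n * (1 - (1 - z n xi) `^ s))) =
    (fun n => expR (- (tau * ((1 - z n xi) / h n) `^ s))).
  apply/funext => n; rewrite -expRD; congr expR.
  have /andP[_ z1] := z01 n xi.
  rewrite powRM ?subr_ge0 ?(ltW z1) ?invr_ge0 ?(ltW (h0 n))// /c; ring.
apply: continuous_cvg; first exact: continuous_expR.
apply: cvgN; apply: cvgMr; apply: cvg_powR => //.
- exact: dotr_ge0.
- by move=> n; have /andP[_ z1] := z01 n xi; apply: divr_ge0; [rewrite subr_ge0 ltW|exact: ltW].
have hc : h n @[n --> \oo] --> 0 by exact: cvg_harmonic.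
pose lam n := dotr xi xi + h n.
have lamc : lam n @[n --> \oo] --> dotr xi xi.
  by rewrite -[X in _ --> X]addr0; apply: cvgD => //; exact: cvg_cst.
have lam0 n : 0 < lam n by rewrite ltr_wpDl// dotr_ge0.
apply: (@squeeze_cvgr _ _ _ _ (fun n => lam n / (1 + lam n * h n)) lam) => //.
- apply: nearW => n; have lh0 : 0 < lam n * h n by rewrite mulr_gt0.
  have e1 : 1 + lam n * h n <= expR (lam n * h n) := expR_ge1Dx _.
  have e2 : 1 - lam n * h n <= expR (- (lam n * h n)) := expR_ge1Dx _.
  have e3 : expR (- (lam n * h n)) <= (1 + lam n * h n)^-1.
    by rewrite expRN lef_pV2 ?posrE ?expR_gt0// addr_gt0.
  rewrite /z -/(lam n); apply/andP; split.
    rewrite ler_pdivlMr// (_ : lam n / _ * h n = 1 - (1 + lam n * h n)^-1).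
      by rewrite lerD2l lerN2.
    by field; rewrite gt_eqF// addr_gt0.
  by rewrite ler_pdivrMr// lerBlDr -lerBlDl.
- rewrite -[X in _ --> X]divr1; apply: cvgM => //; apply: cvgV; first exact: oner_neq0.
  rewrite -[X in _ --> X]addr0 -[X in _ --> _ + X](mulr0 (dotr xi xi)).
  by apply: cvgD; [exact: cvg_cst|exact: cvgM].
Qed.

End positive_multipliers.

(** * The Laplacian on the frequency side *)

Section synth_derivative.
Variables (R : realType) (N : nat).
Local Notation mu := (@lebesgue_rV R N).
Local Notation rV := 'rV[R]_N.
Implicit Types (A B F u m : rV -> R) (x y xi : rV).

Lemma dotr_delta (i : 'I_N) x xi (h : R) :
  dotr (h *: delta_mx ord0 i + x) xi = h * xi ord0 i + dotr x xi.
Proof.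
rewrite dotrDl; congr (_ + _).
rewrite /dotr (bigD1 i)//= !mxE !eqxx mulr1 big1 ?addr0// => j ji.
by rewrite !mxE eqxx (negbTE ji) mulr0 mul0r.
Qed.

(** Differentiation under the integral sign: a derivative multiplies the
    amplitudes by xi_i and exchanges cosine and sine. *)
Lemma partial_synth (i : 'I_N) A B x : integrableR A -> integrableR B ->
  integrableR (fun xi => xi ord0 i * A xi) -> integrableR (fun xi => xi ord0 i * B xi) ->
  partial i (synth A B) x =
  synth (fun xi => xi ord0 i * B xi) (fun xi => - (xi ord0 i * A xi)) x.
Proof.
move=> iA iB iA' iB'.
pose f (h : R) xi := A xi * cos (h * xi ord0 i + dotr x xi)
  + B xi * sin (h * xi ord0 i + dotr x xi).
have fE h xi : f h xi = A xi * cos (dotr (h *: delta_mx ord0 i + x) xi)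
  + B xi * sin (dotr (h *: delta_mx ord0 i + x) xi) by rewrite /f dotr_delta.
pose g (h : R) xi := - (xi ord0 i * A xi) * sin (h * xi ord0 i + dotr x xi)
  + (xi ord0 i * B xi) * cos (h * xi ord0 i + dotr x xi).
have df (h : R) xi : is_derive h 1 (f ^~ xi) (g h xi).
  by apply: is_derive_eq; rewrite /GRing.scale/= /g; ring.
have dfE h xi : partial1of2 f h xi = g h xi.
  by rewrite partial1of2E; apply: derive_val.
have I0 : (`](-1), 1[%classic : set R) 0 by rewrite /= in_itv/= ltrN10 ltr01.
have fi (h : R) : (`](-1), 1[%classic : set R) h -> mu.-integrable setT (EFin \o f h).
  move=> _; have := @integrable_synth R N A B (h *: delta_mx ord0 i + x) iA iB.
  by congr (mu.-integrable _ (EFin \o _)); apply/funext => xi; rewrite fE.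
have fd (h : R) xi : (`](-1), 1[%classic : set R) h -> setT xi -> derivable (f ^~ xi) h 1.
  by move=> _ _; have [] := df h xi.
pose G xi := `|xi ord0 i * A xi| + `|xi ord0 i * B xi|.
have G0 xi : 0 <= G xi by rewrite addr_ge0.
have iG : mu.-integrable setT (EFin \o G) by exact: integrable_absD.
have hG (h : R) xi : (`](-1), 1[%classic : set R) h -> setT xi -> `|partial1of2 f h xi| <= G xi.
  move=> _ _; rewrite dfE /g (le_trans (ler_normD _ _))// lerD//.
    by rewrite normrM normrN ler_piMr// norm_sin_le1.
  by rewrite normrM ler_piMr// norm_cos_le1.
have h := @cvg_differentiation_under_integral _ _ _ mu f setT measurableT 0 (-1) 1
    I0 fi fd G G0 iG hG.
have -> : synth (fun xi => xi ord0 i * B xi) (fun xi => - (xi ord0 i * A xi)) x =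
    \int[mu]_xi partial1of2 f 0 xi.
  by apply: eq_Rintegral => xi _; rewrite dfE /g mul0r add0r addrC.
rewrite /partial /derive; apply: cvg_lim => //.
rewrite [X in X @ _ --> _](_ : _ = (fun h : R =>
  h^-1 *: (\int[mu]_y f (h + 0) y - \int[mu]_y f 0 y))); first exact: h.
apply/funext => k /=; congr (_ *: (_ - _)).
  by apply: eq_Rintegral => xi _; rewrite addr0 fE.
by apply: eq_Rintegral => xi _; rewrite /f mul0r add0r.
Qed.

Lemma coord_sqr_le (i : 'I_N) xi : xi ord0 i ^+ 2 <= dotr xi xi.
Proof.
rewrite /dotr (bigD1 i)//= -expr2 lerDl.
by apply: sumr_ge0 => j _; rewrite -expr2 sqr_ge0.
Qed.

(** Since |xi_i| <= 1 + xi_i^2 <= 1 + |xi|^2, the second moment controls the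
    first. *)
Lemma integrable_coordM (i : 'I_N) A : integrableR A ->
  integrableR (fun xi => dotr xi xi * A xi) ->
  integrableR (fun xi => xi ord0 i * A xi) /\
  integrableR (fun xi => xi ord0 i * (xi ord0 i * A xi)).
Proof.
move=> iA iA2.
have mA := integrable_measurable iA.
have mc := @measurable_coordR R N i.
split.
- apply: (integrable_le measurableT _
    (integrableR_add (integrableR_normr iA) (integrableR_normr iA2))).
    exact: measurable_funM.
  move=> xi _; rewrite !normrM -[X in _ <= X + _]mul1r -mulrDl ler_wpM2r//.
  rewrite (ger0_norm (dotr_ge0 _)).
  have h := coord_sqr_le i xi; rewrite -(real_normK (num_real (xi ord0 i))) in h.
  have := sqr_ge0 (`|xi ord0 i| - 1); have := normr_ge0 (xi ord0 i).
  by move: (`|xi ord0 i|) h => z h z0 hz; nra.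
- apply: (integrable_le measurableT _ (integrableR_normr iA2)).
    by apply: measurable_funM => //; exact: measurable_funM.
  move=> xi _; rewrite mulrA !normrM ler_wpM2r// -normrM -expr2.
  by rewrite ger0_norm ?sqr_ge0// (ger0_norm (dotr_ge0 _)) coord_sqr_le.
Qed.

Lemma synth_sum (I : Type) (r : seq I) (A B : I -> rV -> R) x :
  (forall i, integrableR (A i)) -> (forall i, integrableR (B i)) ->
  integrableR (fun xi => \sum_(i <- r) A i xi) /\
  integrableR (fun xi => \sum_(i <- r) B i xi) /\
  synth (fun xi => \sum_(i <- r) A i xi) (fun xi => \sum_(i <- r) B i xi) x =
  \sum_(i <- r) synth (A i) (B i) x.
Proof.
move=> iA iB; elim: r => [|j r [IA [IB IH]]].
  have i0 : integrableR (fun _ : rV => 0 : R).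
    have := integrableR_mulr 0 (integrable_gaussN (0 : rV) 1).
    by congr (mu.-integrable _ (EFin \o _)); apply/funext => y; rewrite mul0r.
  under [X in integrableR X]eq_fun do rewrite big_nil.
  under [X in _ /\ (integrableR X /\ _)]eq_fun do rewrite big_nil.
  split=> //; split=> //; rewrite big_nil.
  transitivity (\int[mu]_xi (0 : R)).
    by apply: eq_Rintegral => xi _; rewrite !big_nil !mul0r addr0.
  by rewrite Rintegral_cst// mul0r.
have e (F : I -> rV -> R) : (fun xi => \sum_(i <- j :: r) F i xi) =
   (fun xi => F j xi + \sum_(i <- r) F i xi).
  by apply/funext => xi; rewrite big_cons.
rewrite !e; split; first exact: integrableR_add.
split; first exact: integrableR_add.
by rewrite synthD// IH big_cons.
Qed.

Lemma laplacian_synth A B x : integrableR A -> integrableR B ->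
  integrableR (fun xi => dotr xi xi * A xi) -> integrableR (fun xi => dotr xi xi * B xi) ->
  laplacian (synth A B) x =
  - synth (fun xi => dotr xi xi * A xi) (fun xi => dotr xi xi * B xi) x.
Proof.
move=> iA iB iA2 iB2.
pose q (i : 'I_N) F (xi : rV) := xi ord0 i * (xi ord0 i * F xi).
have step (i : 'I_N) : partial i (partial i (synth A B)) x = - synth (q i A) (q i B) x.
  have [iA1 iA3] := integrable_coordM i iA iA2.
  have [iB1 iB3] := integrable_coordM i iB iB2.
  have -> : partial i (synth A B) =
      synth (fun xi => xi ord0 i * B xi) (fun xi => - (xi ord0 i * A xi)).
    by apply/funext => y; exact: partial_synth.
  have iN F : integrableR F -> integrableR (fun xi => - F xi).
    move=> /(integrableR_mulr (-1)); congr (mu.-integrable _ (EFin \o _)).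
    by apply/funext => xi; rewrite mulN1r.
  rewrite partial_synth//; [|exact: iN|].
    rewrite -mulN1r -synthZ//.
    by apply: eq_Rintegral => xi _; rewrite /q; ring.
  by move: (iN _ iA3); congr (mu.-integrable _ (EFin \o _)); apply/funext => xi; rewrite mulrN.
rewrite /laplacian (eq_bigr _ (fun i _ => step i)) sumrN; congr (- _).
have [|_ [_ <-]] := @synth_sum _ (index_enum 'I_N) (fun i => q i A) (fun i => q i B) x
    _ (fun i => proj2 (integrable_coordM i iB iB2)).
  by move=> i; have [] := integrable_coordM i iA iA2.
have e F xi : \sum_(i <- index_enum 'I_N) q i F xi = dotr xi xi * F xi.
  by rewrite /dotr mulr_suml; apply: eq_bigr => i _; rewrite /q mulrA.
by apply: eq_Rintegral => xi _; rewrite !e.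
Qed.

(** On the cube [-1, 1]^N the bound M applies, outside of it |xi|^2 is at
    least 1. *)
Lemma integrable_second_moment (A : rV -> R) (M : R) : measurable_fun setT A ->
  (forall xi, `|A xi| <= M) ->
  integrableR (fun xi => dotr xi xi * A xi) -> integrableR A.
Proof.
move=> mA AM iA2.
pose b (xi : rV) : R := \prod_(i < N) \1_(`[-1, 1]%classic : set R) (xi ord0 i).
have ib : integrableR b.
  have [] // := @integrable_prod R N (fun=> \1_(`[-1, 1]%classic : set R)).
  move=> _; apply: integrable_indic_itv => //.
apply: (integrable_le measurableT mA
  (integrableR_add (integrableR_mulr M ib) (integrableR_normr iA2))).
move=> xi _; have [h|/existsNP[i /negP]] := pselect (forall i, `|xi ord0 i| <= 1).
  rewrite /b big1; last first.
    by move=> i _; rewrite indicE mem_set//= in_itv/= -ler_norml.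
  by rewrite mulr1 -[leLHS]addr0 lerD.
rewrite -ltNge => hi; rewrite -[leLHS]add0r lerD//.
  rewrite mulr_ge0 ?prodr_ge0//; first exact: le_trans (AM xi).
rewrite normrM ler_peMl// (ger0_norm (dotr_ge0 _)) (le_trans _ (coord_sqr_le i xi))//.
by rewrite -real_normK ?num_real// exprn_ege1// ltW.
Qed.

End synth_derivative.

(** * The solution formula *)

Section symbol.
Variables (R : realType) (N : nat) (s : R).
Hypothesis s01 : 0 < s < 1.
Local Notation rV := 'rV[R]_N.
Local Notation mu := (@lebesgue_rV R N).
Implicit Types (x xi : rV).

(** The symbols of (-Delta)^s and of -Delta + (-Delta)^s. *)
Definition fsymbol xi : R := dotr xi xi `^ s.
Definition symbol xi : R := dotr xi xi + fsymbol xi.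

Lemma enorm_sqr xi : enorm xi ^+ 2 = dotr xi xi.
Proof. by rewrite /enorm sqr_sqrtr// dotr_ge0. Qed.

Lemma enorm_powR xi : enorm xi `^ (2 * s) = fsymbol xi.
Proof.
by rewrite powRrM powR_mulrn ?sqrtr_ge0// enorm_sqr.
Qed.

Lemma symbol0 : symbol 0 = 0.
Proof.
have /andP[s0 _] := s01.
by rewrite /symbol /fsymbol dotr0l powR0 ?addr0// gt_eqF.
Qed.

Lemma symbolN xi : symbol (- xi) = symbol xi.
Proof. by rewrite /symbol /fsymbol dotrNl dotrNr opprK. Qed.

Lemma dotr_seq_continuous xi : seq_continuous_at (fun xi => dotr xi xi) xi.
Proof. by move=> u hu; apply: cvg_sumR => i; apply: cvgM; exact: hu. Qed.

Lemma symbol_seq_continuous xi : seq_continuous_at symbol xi.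
Proof.
have /andP[s0 _] := s01.
move=> u hu; apply: cvgD; first exact: dotr_seq_continuous.
apply: cvg_powR => //; [exact: dotr_ge0|by move=> n; exact: dotr_ge0|].
exact: dotr_seq_continuous.
Qed.

End symbol.

Section solution.
Variables (R : realType) (N : nat) (gamma s : R).
Variables (phi : 'rV[R]_N -> R) (v : 'rV[R]_N -> R -> R).
Local Notation rV := 'rV[R]_N.
Local Notation mu := (@lebesgue_rV R N).
Hypothesis gamma0 : 0 <= gamma.
Hypothesis s01 : 0 < s < 1.
Hypothesis iphi : integrableR phi.
Hypothesis sol : cauchy_solution gamma s phi v.
Implicit Types (x xi : rV) (t : R) (c : R -> R).

Local Notation C t := (cosT (v ^~ t)).
Local Notation S t := (sinT (v ^~ t)).
Let K : R := (2 * pi) ^+ N.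

Let K0 : K != 0.
Proof. by rewrite expf_neq0// mulf_neq0// gt_eqF// pi_gt0. Qed.

Lemma integrable_sol t : 0 <= t -> integrableR (v ^~ t).
Proof. by move=> t0; apply/Lfun1_integrable; exact: (sol_L1 sol t0). Qed.

Lemma Re_mulE (z w : R[i]) :
  complex.Re (z * w) = complex.Re z * complex.Re w - complex.Im z * complex.Im w.
Proof. by case: z; case: w. Qed.

Lemma Im_mulE (z w : R[i]) :
  complex.Im (z * w) = complex.Re z * complex.Im w + complex.Im z * complex.Re w.
Proof. by case: z => a b; case: w => c d /=. Qed.

Lemma ReC (r : R) : complex.Re (r%:C)%C = r. Proof. by []. Qed.
Lemma ImC (r : R) : complex.Im (r%:C)%C = 0. Proof. by []. Qed.
Lemma Re_expi (r : R) : complex.Re (expi r) = cos r. Proof. by []. Qed.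
Lemma Im_expi (r : R) : complex.Im (expi r) = sin r. Proof. by []. Qed.
Lemma real_part_equation (D c L : R) (z : R[i]) :
  (D%:C = c%:C * (L%:C - z))%C -> D = c * (L - complex.Re z).
Proof.
case: z => a b h; have := congr1 (@complex.Re R) h.
by rewrite Re_mulE ReC ImC mul0r subr0.
Qed.

Lemma Re_fourierR u xi : integrableR u -> complex.Re (fourierR u xi) = cosT u xi.
Proof.
move=> iu; rewrite /fourierR /fourier /cintegral /=.
apply: eq_Rintegral => y _; rewrite /expi cosN dotrC /=; ring.
Qed.

Lemma Im_fourierR u xi : integrableR u -> complex.Im (fourierR u xi) = - sinT u xi.
Proof.
move=> iu; rewrite /fourierR /fourier /cintegral /= -[RHS]mulN1r.
rewrite -RintegralZl//; last exact: (integrable_waved xi (@wave_sin R) iu).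
by apply: eq_Rintegral => y _; rewrite sinN /=; ring.
Qed.

Let integrable_multiplier t (m : rV -> R) : 0 < t ->
  cintegrable (fun xi => ((m xi)%:C%C * fourierR (v ^~ t) xi)) ->
  integrableR (fun xi => m xi * C t xi) /\ integrableR (fun xi => m xi * S t xi).
Proof.
move=> t0 [h1 h2]; have iv := integrable_sol (ltW t0); split.
  move: h1; congr (mu.-integrable _ (EFin \o _)); apply/funext => xi.
  by rewrite Re_mulE Re_fourierR//=; ring.
have := integrableR_mulr (-1) h2; congr (mu.-integrable _ (EFin \o _)); apply/funext => xi.
by rewrite Im_mulE Im_fourierR//=; ring.
Qed.

Lemma integrable_laplacian_transform t : 0 < t ->
  integrableR (fun xi => dotr xi xi * C t xi) /\ integrableR (fun xi => dotr xi xi * S t xi).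
Proof.
move=> t0; apply: integrable_multiplier => //.
have [+ _] := sol_multiplier sol t0.
by congr cintegrable; apply/funext => xi; rewrite enorm_sqr.
Qed.

Lemma integrable_fractional_transform t : 0 < t ->
  integrableR (fun xi => fsymbol s xi * C t xi) /\
  integrableR (fun xi => fsymbol s xi * S t xi).
Proof.
move=> t0; apply: integrable_multiplier => //.
have [_ +] := sol_multiplier sol t0.
by congr cintegrable; apply/funext => xi; rewrite enorm_powR.
Qed.

(** The multiplier hypotheses give second moments of the transform, and the
    transform of an integrable function is bounded. *)
Lemma integrable_transform t : 0 < t -> integrableR (C t) /\ integrableR (S t).
Proof.
move=> t0; have iv := integrable_sol (ltW t0).
have mv := integrable_measurable iv.
have [h1 h2] := integrable_laplacian_transform t0.
have M c : wave c -> integrableR (fun xi => dotr xi xi * waveT c (v ^~ t) xi) ->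
    integrableR (waveT c (v ^~ t)).
  move=> wc; apply: (@integrable_second_moment _ _ _ (\int[mu]_y `|v y t|)).
    exact: measurable_waveT.
  by move=> xi; exact: norm_waveT_le.
by split; apply: M; [exact: wave_cos| |exact: wave_sin|].
Qed.

Lemma sol_synth t x : 0 < t -> synth (C t) (S t) x = K * v x t.
Proof.
move=> t0; have [iC iS] := integrable_transform t0.
apply: (@fourier_inversion _ _ (v ^~ t)) => //; first exact: integrable_sol (ltW t0).
by apply: continuous_seq; have [+ _ _] := sol_C2 sol t0; exact.
Qed.

Let integrable_symbol t : 0 < t ->
  integrableR (fun xi => symbol s xi * C t xi) /\ integrableR (fun xi => symbol s xi * S t xi).
Proof.
move=> t0; have [l1 l2] := integrable_laplacian_transform t0.
have [f1 f2] := integrable_fractional_transform t0; split.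
  by move: (integrableR_add l1 f1); congr (mu.-integrable _ (EFin \o _));
    apply/funext => xi; rewrite -mulrDl.
by move: (integrableR_add l2 f2); congr (mu.-integrable _ (EFin \o _));
  apply/funext => xi; rewrite -mulrDl.
Qed.

Lemma laplacian_sol t x : 0 < t ->
  laplacian (v ^~ t) x =
  - (K^-1 * synth (fun xi => dotr xi xi * C t xi) (fun xi => dotr xi xi * S t xi) x).
Proof.
move=> t0; have [iC iS] := integrable_transform t0.
have [l1 l2] := integrable_laplacian_transform t0.
have iZ F : integrableR F -> integrableR (fun xi => K^-1 * F xi) by exact: integrableR_mulr.
have vE : v ^~ t = synth (fun xi => K^-1 * C t xi) (fun xi => K^-1 * S t xi).
  by apply/funext => y; rewrite synthZ// sol_synth// mulKf.
have e F : (fun xi : rV => dotr xi xi * (K^-1 * F xi)) = (fun xi => K^-1 * (dotr xi xi * F xi)).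
  by apply/funext => xi; rewrite mulrCA.
rewrite [X in laplacian X]vE laplacian_synth//;
  [|exact: iZ|exact: iZ|by rewrite e; exact: iZ|by rewrite e; exact: iZ].
by rewrite !e synthZ.
Qed.

Lemma Re_frac_laplacian_sol t x : 0 < t ->
  complex.Re (frac_laplacian s (v ^~ t) x) =
  K^-1 * synth (fun xi => fsymbol s xi * C t xi) (fun xi => fsymbol s xi * S t xi) x.
Proof.
move=> t0; have iv := integrable_sol (ltW t0).
rewrite /frac_laplacian /inv_fourier Re_mulE ReC ImC mul0r subr0 -/K; congr (_ * _).
transitivity (\int[mu]_xi complex.Re
  ((enorm xi `^ (2 * s))%:C%C * fourierR (v ^~ t) xi * expi (dotr x xi))) => //.
apply: eq_Rintegral => xi _.
rewrite Re_mulE Re_mulE Im_mulE ReC ImC Re_expi Im_expi Re_fourierR// Im_fourierR//.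
by rewrite enorm_powR; ring.
Qed.

(** The equation, read on the frequency side: the time derivative is synthesized
    from the amplitudes multiplied by - t^gamma times the symbol. *)
Lemma sol_derivative t x : 0 < t ->
  'D_1 (v x) t = synth (fun xi => - (t `^ gamma / K) * (symbol s xi * C t xi))
                       (fun xi => - (t `^ gamma / K) * (symbol s xi * S t xi)) x.
Proof.
move=> t0; have [i1 i2] := integrable_symbol t0.
have [l1 l2] := integrable_laplacian_transform t0.
have [f1 f2] := integrable_fractional_transform t0.
rewrite (real_part_equation (sol_equation sol x t0)).
rewrite laplacian_sol// Re_frac_laplacian_sol// synthZ//.
rewrite (_ : synth (fun xi => symbol s xi * C t xi) (fun xi => symbol s xi * S t xi) x =
   synth (fun xi => dotr xi xi * C t xi) (fun xi => dotr xi xi * S t xi) x +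
   synth (fun xi => fsymbol s xi * C t xi) (fun xi => fsymbol s xi * S t xi) x); first by ring.
rewrite -synthD//; apply: eq_Rintegral => xi _; rewrite /symbol; ring.
Qed.

Let quot t h x := h^-1 * (v x (t + h) - v x t).

Let integrable_quot t h : 0 <= t -> 0 <= t + h -> integrableR (quot t h).
Proof.
by move=> t0 th; apply: integrableR_mulr; apply: integrableR_sub; exact: integrable_sol.
Qed.

Let quot_cvg t (x : rV) : 0 < t -> quot t h x @[h --> 0^'] --> 'D_1 (v x) t.
Proof.
move=> t0; have := @sol_derivable _ _ _ _ _ _ sol x t t0; rewrite /derivable => /cvg_ex[l hl].
rewrite /derive (cvg_lim _ hl)//.
move: hl; rewrite [X in X @ _ --> _](_ : _ = fun h => quot t h x)//.
by apply/funext => h; rewrite /quot /= [h%:A]mulr1 [h + t]addrC.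
Qed.

Let near_pos t : 0 < t -> \forall h \near 0^', (0 <= t + h :> R).
Proof.
move=> t0; have : \forall h \near (0 : R), 0 <= t + h.
  exists t => //= h /=; rewrite sub0r normrN ltr_norml => /andP[/ltW h1 _].
  by rewrite -lerBlDl sub0r.
exact: cvg_within.
Qed.

Let measurable_derivative t : 0 < t -> measurable_fun setT (fun x => 'D_1 (v x) t).
Proof.
move=> t0.
pose h (n : nat) : R := n.+1%:R^-1.
apply: (measurable_fun_cvg (h := fun n x => quot t (h n) x)).
  move=> n; apply: (integrable_measurable (mu := mu)); apply: integrable_quot.
    exact: ltW.
  by rewrite addr_ge0 ?invr_ge0// ltW.
move=> x _; have /cvgr_dnbhsP := @quot_cvg t x t0; apply; split.
  by move=> n; rewrite gt_eqF// invr_gt0.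
exact: cvg_harmonic.
Qed.

(** The derivative differs by an integrable function from one difference
    quotient, the L^1 distance of the two being finite for small steps. *)
Lemma integrable_derivative t : 0 < t -> integrableR (fun x => 'D_1 (v x) t).
Proof.
move=> t0; have mD := measurable_derivative t0.
have [hfin _] := (fine_cvgP _ _).1 (sol_derivable_L1 sol t0).
have [h [h1 h2]] := @filter_ex _ (0 : R)^' _ _ (filterI (near_pos t0) hfin).
have iq := integrable_quot (ltW t0) h1.
have id : integrableR (fun x => quot t h x - 'D_1 (v x) t).
  apply/integrableP; split.
    apply/measurable_EFinP; apply: measurable_funB => //.
    exact: integrable_measurable iq.
  by rewrite ltey_eq; apply/orP; left.
move: (integrableR_sub iq id); congr (mu.-integrable _ (EFin \o _)).
by apply/funext => x; rewrite opprB addrCA subrr addr0.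
Qed.

(** Differentiability in L^1 passes to the transform since a wave is bounded
    by 1. *)
Let transform_derivable c t xi : 0 < t -> wave c ->
  is_derive t 1 (fun t => waveT c (v ^~ t) xi) (waveT c (fun y => 'D_1 (v y) t) xi).
Proof.
move=> t0 wc; have iD := integrable_derivative t0.
have iM F := @integrable_waved _ _ c F xi wc.
suff h : h^-1 *: (((fun t => waveT c (v ^~ t) xi) \o shift t) h%:A - waveT c (v ^~ t) xi)
    @[h --> 0^'] --> waveT c (fun y => 'D_1 (v y) t) xi.
  apply: DeriveDef; first by apply/cvg_ex; eexists; exact: h.
  exact: cvg_lim h.
have [hfin hcv] := (fine_cvgP _ _).1 (sol_derivable_L1 sol t0).
apply/cvgrPdist_le => e e0.
have /cvgrPdist_le/(_ _ e0) hcv' := hcv.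
have np := near_pos t0.
near=> h.
have th : 0 <= t + h by near: h.
have hf : (\int[mu]_x `|quot t h x - 'D_1 (v x) t|%:E)%E \is a fin_num by near: h.
have : `|0 - fine (\int[mu]_x `|quot t h x - 'D_1 (v x) t|%:E)%E| <= e by near: h.
rewrite sub0r normrN => he.
rewrite /= [h%:A]mulr1 [h + t]addrC distrC.
have i1 := iM _ (integrable_sol th); have i2 := iM _ (integrable_sol (ltW t0)).
have i3 := iM _ iD.
rewrite -RintegralB// -[_ *: _]/(_ * _) -RintegralZl//; last exact: integrableR_sub.
rewrite -RintegralB//; last exact: (integrableR_mulr _ (integrableR_sub i1 i2)).
apply: (le_trans (le_normr_Rintegral measurableT _)).
  exact: (integrableR_sub (integrableR_mulr _ (integrableR_sub i1 i2)) i3).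
apply: le_trans he; apply: le_trans (ler_norm _).
have id := integrableR_sub (integrable_quot (ltW t0) th) iD.
apply: le_Rintegral => //.
- exact: (integrableR_normr (integrableR_sub (integrableR_mulr _ (integrableR_sub i1 i2)) i3)).
- exact: integrableR_normr id.
- move=> y _; rewrite -mulrBl mulrA -mulrBl -/(quot t h y).
  exact: norm_wave_le.
Unshelve. all: by end_near. Qed.

(** The converse inversion [synth_transform] reads off the transform of the time
    derivative; the phase - pi / 2 turns the cosine into a sine. *)
Lemma transform_ode t xi : 0 < t ->
  cosT (fun y => 'D_1 (v y) t) xi = - (t `^ gamma * symbol s xi) * C t xi /\
  sinT (fun y => 'D_1 (v y) t) xi = - (t `^ gamma * symbol s xi) * S t xi.
Proof.
move=> t0; have [i1 i2] := integrable_symbol t0.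
have iv := integrable_sol (ltW t0).
pose k := - (t `^ gamma / K).
have main th : \int[mu]_y ('D_1 (v y) t * cos (dotr y xi + th)) =
    K * (k * (symbol s xi * C t xi) * cos th - k * (symbol s xi * S t xi) * sin th).
  apply: (@synth_transform R N (fun xi => k * (symbol s xi * C t xi))
    (fun xi => k * (symbol s xi * S t xi)) (fun y => 'D_1 (v y) t)).
  - exact: integrableR_mulr.
  - exact: integrableR_mulr.
  - exact: integrable_derivative.
  - by move=> x; exact: sol_derivative.
  - move=> z; rewrite symbolN; congr (_ * (_ * _)).
    by apply: eq_Rintegral => y _; rewrite dotrNr cosN.
  - move=> z; rewrite symbolN -mulrN -mulrN; congr (_ * (_ * _)).
    rewrite -[RHS]mulN1r -RintegralZl//; last exact: (integrable_waved z (@wave_sin R) iv).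
    by apply: eq_Rintegral => y _; rewrite dotrNr sinN; ring.
  - move=> z u hu; apply: cvgMr; apply: cvgM.
      exact: (symbol_seq_continuous s01 hu).
    exact: (waveT_seq_continuous (@wave_cos R) iv hu).
  - move=> z u hu; apply: cvgMr; apply: cvgM.
      exact: (symbol_seq_continuous s01 hu).
    exact: (waveT_seq_continuous (@wave_sin R) iv hu).
split.
  have := main 0; rewrite /cosT /waveT cos0 sin0 mulr1 mulr0 subr0.
  under eq_Rintegral do rewrite addr0.
  by move=> ->; rewrite /k; field.
have := main (- (pi / 2)); rewrite /sinT /waveT cosN sinN cos_pihalf sin_pihalf.
under eq_Rintegral do rewrite cosBpihalf.
by move=> ->; rewrite /k; field.
Qed.

(** The primitive of t^gamma: in this new time the equation has constant
    coefficients. *)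
Definition clock (t : R) : R := t `^ (gamma + 1) / (gamma + 1).

Let gamma1 : 0 < gamma + 1.
Proof. by rewrite ltr_wpDl. Qed.

Lemma is_derive_clock t : 0 < t -> is_derive t 1 clock (t `^ gamma).
Proof.
move=> t0; have h := is_derive1_powR (gamma + 1) t0.
rewrite /clock; apply: is_derive_eq; rewrite addrK /GRing.scale/=; field.
by rewrite gt_eqF.
Qed.

Lemma cvg_clock0 : clock t @[t --> 0^'+] --> (0 : R).
Proof.
rewrite /clock [X in _ --> X](_ : 0 = 0 * (gamma + 1)^-1); last by rewrite mul0r.
by apply: cvgMl; exact: (powR_cvg0 gamma1).
Qed.

(** Multiplied by the integrating factor, f becomes a constant, equal to its limit
    l at 0. *)
Let ode_solution (f : R -> R) (psi l : R) :
  (forall t, 0 < t -> is_derive t 1 f (- (t `^ gamma * psi) * f t)) ->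
  f t @[t --> 0^'+] --> l ->
  forall t, 0 < t -> f t = expR (- (clock t * psi)) * l.
Proof.
move=> df fl t t0.
pose E r := f r * expR (clock r * psi).
have dE (r : R) : 0 < r -> is_derive r 1 E 0.
  move=> r0; have h1 := df r r0; have h2 := is_derive_clock r0.
  have h3 : is_derive r 1 (fun r => expR (clock r * psi)) (expR (clock r * psi) * (r `^ gamma * psi)).
    by apply: is_derive_eq; rewrite /GRing.scale/=; ring.
  by apply: (is_derive_eq (is_deriveM h1 h3)); rewrite /GRing.scale/=; ring.
have Econst (a b : R) : 0 < a -> a < b -> E b = E a.
  move=> a0 ab.
  have dE' (x : R) : x \in `]a, b[%R -> is_derive x 1 E ((fun=> 0) x).
    by rewrite in_itv/= => /andP[ax _]; apply: dE; exact: lt_trans ax.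
  have cE : {within `[a, b], continuous E}.
    apply: derivable_within_continuous => x; rewrite in_itv/= => /andP[ax _].
    by have [] := dE x (lt_le_trans a0 ax).
  have [c _] := MVT ab dE' cE.
  by rewrite mul0r => /eqP; rewrite subr_eq0 => /eqP.
have El : E r @[r --> 0^'+] --> l.
  have h : expR (clock r * psi) @[r --> 0^'+] --> (expR (0 * psi) : R).
    apply: continuous_cvg; first exact: continuous_expR.
    by apply: cvgMl; exact: cvg_clock0.
  have lE : l = l * expR (0 * psi) by rewrite mul0r expR0 mulr1.
  by rewrite lE; exact: cvgM.
have Et : E r @[r --> 0^'+] --> E t.
  apply: cvg_near_cst; near=> r; apply/esym/Econst.
    by near: r; exact: nbhs_right_gt.
  by near: r; exact: nbhs_right_lt.
rewrite (cvg_unique _ El Et)//.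
by rewrite /E mulrCA -expRD addrC subrr expR0 mulr1.
Unshelve. all: by end_near. Qed.

Let transform_initial c xi : wave c ->
  waveT c (v ^~ t) xi @[t --> 0^'+] --> waveT c phi xi.
Proof.
move=> wc; have iM F := @integrable_waved _ _ c F xi wc.
have [hfin hcv] := (fine_cvgP _ _).1 (sol_initial_L1 sol).
apply/cvgrPdist_le => e e0.
have /cvgrPdist_le/(_ _ e0) hcv' := hcv.
near=> t.
have t0 : 0 < t by near: t; exact: nbhs_right_gt.
have : `|0 - fine (\int[mu]_x `|v x t - phi x|%:E)%E| <= e by near: t.
rewrite sub0r normrN => he; rewrite distrC.
have iv := integrable_sol (ltW t0).
have [i1 i2] := (iM _ iv, iM _ iphi).
rewrite -RintegralB//; apply: (le_trans (le_normr_Rintegral measurableT _)).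
  exact: (integrableR_sub i1 i2).
apply: le_trans he; apply: le_trans (ler_norm _).
apply: le_Rintegral => //.
- exact: (integrableR_normr (integrableR_sub i1 i2)).
- exact: integrableR_normr (integrableR_sub iv iphi).
- by move=> y _; rewrite -mulrBl; exact: norm_wave_le.
Unshelve. all: by end_near. Qed.

Lemma transform_sol t xi : 0 < t ->
  C t xi = expR (- (clock t * symbol s xi)) * cosT phi xi /\
  S t xi = expR (- (clock t * symbol s xi)) * sinT phi xi.
Proof.
move=> t0; split.
  apply: (ode_solution (f := fun t => C t xi)) => //.
    move=> r r0; have [<- _] := transform_ode xi r0.
    by apply: transform_derivable => //; exact: wave_cos.
  by apply: transform_initial; exact: wave_cos.
apply: (ode_solution (f := fun t => S t xi)) => //.
  move=> r r0; have [_ <-] := transform_ode xi r0.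
  by apply: transform_derivable => //; exact: wave_sin.
by apply: transform_initial; exact: wave_sin.
Qed.

Theorem solution_formula t x : 0 < t ->
  v x t = K^-1 * synth (fun xi => expR (- (clock t * symbol s xi)) * cosT phi xi)
                       (fun xi => expR (- (clock t * symbol s xi)) * sinT phi xi) x.
Proof.
move=> t0; rewrite -[LHS](mulKf K0) -sol_synth//; congr (_ * _).
by apply: eq_Rintegral => xi _; have [-> ->] := transform_sol xi t0.
Qed.

End solution.

(** * Exponential integrals on the half-line *)

Section half_line.
Variable R : realType.
Local Notation leb := (@lebesgue_measure R).
Local Notation pos := (`]0%R, +oo[%classic : set R).
Implicit Types (c l u : R).

Lemma measurable_pos : measurable (pos : set (measurableTypeR R)).
Proof. exact: measurable_itv. Qed.

Lemma pos_gt0 u : pos u -> 0 < u.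
Proof. by rewrite /= in_itv/= andbT. Qed.

Lemma gt0_pos u : 0 < u -> pos u.
Proof. by rewrite /= in_itv/= andbT. Qed.

Lemma sigma_finite_pos : sigma_finite pos leb.
Proof.
have [F FE mF] := @sigma_finiteT _ _ _ leb.
exists (fun n => pos `&` F n); first by rewrite -setI_bigcupr -FE setIT.
move=> n; have [mFn Fn] := mF n; split; first by apply: measurableI => //; exact: measurable_pos.
by apply: le_lt_trans Fn; apply: le_measure; rewrite ?inE//; apply: measurableI => //;
  exact: measurable_pos.
Qed.

(** Both sides are measures that agree on half-open intervals. *)
Lemma lebesgue_measure_scale c : 0 < c ->
  forall A, measurable A ->
  (c%:E * leb ((fun t : R => (c * t)%R) @^-1` A))%E = leb A.
Proof.
move=> c0 A mA.
have mc : measurable_fun [set: measurableTypeR R] (fun t : measurableTypeR R => c * t : measurableTypeR R).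
  exact: measurable_funM.
pose p : {measure set (measurableTypeR R) -> \bar R} :=
  measure_function_pushforward__canonical__measure_function_Measure leb mc.
pose m : {measure set (measurableTypeR R) -> \bar R} := mscale (NngNum (ltW c0)) p.
suff h : forall A, measurable A -> leb A = m A by rewrite [RHS]h.
apply: lebesgue_measure_unique => X /ocitvP[->|[[a b]/= ab ->]].
  by rewrite !measure0.
rewrite /m /mscale/= /p/= /pushforward.
rewrite (_ : (fun t => c * t) @^-1` `]a, b]%classic = `]a / c, b / c]%classic); last first.
  by apply/seteqP; split => t /=; rewrite !in_itv/= ltr_pdivrMr// ler_pdivlMr// [t * c]mulrC.
rewrite !lebesgue_measure_itv/= !lte_fin ltr_pM2r ?invr_gt0// ab.
by rewrite -!EFinD -EFinM; congr EFin; field; rewrite gt_eqF.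
Qed.

Lemma integral_scale c (F : R -> \bar R) : 0 < c -> measurable_fun pos F ->
  (forall u, 0 < u -> (0 <= F u)%E) ->
  (\int[leb]_(u in pos) F u = c%:E * \int[leb]_(u in pos) F (c * u)%R)%E.
Proof.
move=> c0 mF F0.
have mc : measurable_fun [set: measurableTypeR R] (fun t : measurableTypeR R => c * t : measurableTypeR R).
  exact: measurable_funM.
pose p : {measure set (measurableTypeR R) -> \bar R} :=
  measure_function_pushforward__canonical__measure_function_Measure leb mc.
pose m : {measure set (measurableTypeR R) -> \bar R} := mscale (NngNum (ltW c0)) p.
transitivity (\int[m]_(u in pos) F u)%E.
  apply: eq_measure_integral => A mA _; exact/esym/lebesgue_measure_scale.
rewrite /m ge0_integral_mscale//=; last by move=> u /pos_gt0 /F0.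
rewrite /p; congr (_ * _)%E.
rewrite (ge0_integral_pushforward mc leb measurable_pos mF); last first.
  by move=> u; rewrite inE => /pos_gt0 /F0.
congr (integral _ _ _); apply/seteqP; split => t /=; rewrite !in_itv/= !andbT.
  by rewrite pmulr_rgt0.
by move=> ?; rewrite mulr_gt0.
Qed.

Lemma integrable_scale c (F : R -> R) : 0 < c ->
  leb.-integrable pos (EFin \o F) -> (forall u, 0 < u -> 0 <= F u) ->
  leb.-integrable pos (EFin \o (fun u => F (c * u))) /\
  \int[leb]_(u in pos) F u = c * \int[leb]_(u in pos) F (c * u).
Proof.
move=> c0 iF F0.
have mF := integrable_measurable iF.
have e := @integral_scale c (EFin \o F) c0 (measurable_int _ iF) F0.
have fF : (\int[leb]_(u in pos) (F u)%:E)%E \is a fin_num by exact: integrable_fin_num.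
have e' : (\int[leb]_(u in pos) (F (c * u)%R)%:E = c^-1%:E * \int[leb]_(u in pos) (F u)%:E)%E.
  rewrite [in RHS]e muleA -EFinM mulVf ?gt_eqF// mul1e//.
split; last first.
  rewrite /Rintegral e' fineM// mulrA divff ?gt_eqF// mul1r//.
apply/integrableP; split.
  apply/measurable_EFinP.
  apply: (@measurable_comp _ _ _ _ _ _ pos F pos (fun u : R => c * u)) => //.
  - by move=> _ [u /pos_gt0 u0 <-]; apply: gt0_pos; rewrite mulr_gt0.
  - exact: measurable_funM.
rewrite (_ : (\int[leb]_(x in pos) _)%E = (\int[leb]_(u in pos) (F (c * u))%:E)%E); last first.
  apply: eq_integral.
  by move=> u; rewrite inE => /pos_gt0 u0; rewrite /= ger0_norm// F0// mulr_gt0.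
by rewrite e' -(fineK fF) -EFinM ltry.
Qed.

Lemma integrable_expRN_tail l (r : R) : 0 < l ->
  leb.-integrable `]r, +oo[ (EFin \o (fun t => expR (- (l * t)))) /\
  \int[leb]_(t in `]r, +oo[) expR (- (l * t)) = expR (- (l * r)) / l.
Proof.
move=> l0; pose F (t : R) := - (expR (- (l * t)) / l).
have dF (t : R) : is_derive t 1 F (expR (- (l * t))).
  rewrite /F; apply: is_derive_eq; rewrite /GRing.scale/=; field; exact: lt0r_neq0.
have c : continuous (fun t : R => expR (- (l * t))).
  move=> t; apply: continuous_comp; last exact: continuous_expR.
  by apply: continuousN; exact: mulrl_continuous.
have e : (\int[leb]_(t in `[r, +oo[) (expR (- (l * t)))%:E = (expR (- (l * r)) / l)%:E)%E.
  rewrite (@ge0_continuous_FTC2y _ _ F _ 0).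
  - by rewrite -EFinB sub0r opprK.
  - by move=> t _; exact: expR_ge0.
  - exact: continuous_subspaceT.
  - rewrite /F -oppr0 -(mul0r l^-1); apply: cvgN; apply: cvgMl.
    apply: (@cvg_comp _ _ _ (fun t => l * t) (fun z => expR (- z)) _ (pinfty_nbhs R)); last exact: cvgr_expR.
    exact: gt0_cvgMry.
  - by move=> t _; have [] := dF t.
  - apply: cvg_at_right_filter; apply: differentiable_continuous.
    by apply/derivable1_diffP; have [] := dF r.
  - by move=> t _; rewrite derive1E; apply: derive_val.
have mE (D : set R) : measurable_fun D (fun t : R => expR (- (l * t))).
  by apply: measurable_funTS; exact: continuous_measurable_fun.
have i1 : leb.-integrable `]r, +oo[ (EFin \o (fun t => expR (- (l * t)))).
  apply/integrableP; split; first by apply/measurable_EFinP; exact: mE.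
  under eq_integral do rewrite /= ger0_norm ?expR_ge0//.
  rewrite integral_itv_obnd_cbnd; last by apply/measurable_EFinP; exact: mE.
  by rewrite e ltry.
split => //.
by rewrite Rintegral_itv_obnd_cbnd// /Rintegral e.
Qed.

Lemma integrable_expRN l : 0 < l ->
  leb.-integrable pos (EFin \o (fun t => expR (- (l * t)))) /\
  \int[leb]_(t in pos) expR (- (l * t)) = l^-1.
Proof.
by move=> l0; have := integrable_expRN_tail 0 l0; rewrite mulr0 oppr0 expR0 mul1r.
Qed.

(** The side b of the upper bound is free: it encodes whether the event t < X or
    t <= X is meant in [laplace_tail]. *)
Lemma integrable_expRN_itv (l x : R) (b : bool) : 0 < l -> 0 <= x ->
  leb.-integrable [set` Interval (BRight 0) (BSide b x)] (EFin \o (fun t => expR (- (l * t)))) /\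
  \int[leb]_(t in [set` Interval (BRight 0) (BSide b x)]) expR (- (l * t)) = (1 - expR (- (l * x))) / l.
Proof.
move=> l0 x0; have [i e] := integrable_expRN l0; have [i' e'] := integrable_expRN_tail x l0.
have mp := measurable_pos.
have ib (c : bool) : leb.-integrable [set` Interval (BRight 0) (BSide c x)] (EFin \o (fun t => expR (- (l * t)))).
  apply: (integrableS mp) i => //.
  by move=> t; rewrite /= !in_itv/= => /andP[->].
split => //.
have h : \int[leb]_(t in `]0, x]) expR (- (l * t)) = (1 - expR (- (l * x))) / l.
  have := @Rintegral_itvB R _ (BRight 0) (BInfty _ false) x i.
  rewrite bnd_simp => /(_ x0) /(_ isT); rewrite e e' => h.
  by rewrite mulrBl mul1r -h opprB addrC subrK.
case: b (ib b) => // ib'; rewrite -h.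
exact: Rintegral_itv_bndo_bndc.
Qed.

(** The layer cake formula for the function 1 - exp(- l X): exchanging the
    integrals, exp(- l t) is integrated over 0 < t < X. It yields at once the
    Laplace transforms of r |-> P(S >= r) and of the tail of the Levy measure;
    the strict inequality is b = true, the large one b = false. *)
Lemma laplace_tail d (T : measurableType d) (m : {measure set T -> \bar R})
    (D : set T) (X : T -> R) (b : bool) (l : R) :
  measurable D -> sigma_finite D m -> measurable_fun D X ->
  (forall w, D w -> 0 <= X w) -> 0 < l ->
  (\int[leb]_(t in pos) ((expR (- (l * t)))%:E * m (D `&` [set w | t < X w ?<= if ~~ b])) =
   \int[m]_(w in D) ((1 - expR (- (l * X w))) / l)%:E)%E.
Proof.
move=> mD sD mX X0 l0; have mp := measurable_pos.
have mcut (D' : set (R * T)) (f g : R * T -> R) : measurable D' ->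
    measurable_fun D' f -> measurable_fun D' g ->
    measurable_fun D' (fun p => f p < g p ?<= if ~~ b).
  move=> mD' mf mg; case: (b) => /=; first exact: measurable_fun_ltr.
  exact: measurable_fun_ler.
have mpD : measurable (pos `*` D : set (measurableTypeR R * T)) by exact: measurableX.
have mX2 : measurable_fun (pos `*` D) (fun p : measurableTypeR R * T => X p.2).
  apply: (@measurable_comp _ _ _ _ _ _ D X) => //; first by move=> _ [[t w] [_ /= Dw] <-].
  exact: measurable_funTS measurable_snd.
pose f (p : R * T) : \bar R := (expR (- (l * p.1)) * (p.1 < X p.2 ?<= if ~~ b)%R%:R)%:E.
have mf : measurable_fun (pos `*` D) (f : measurableTypeR R * T -> \bar R).
  apply/measurable_EFinP; apply: measurable_funM.
    apply: measurable_funTS; apply: (measurableT_comp (@measurable_expR R)).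
    by apply: measurable_funN; apply: measurable_funM => //; exact: measurable_fst.
  apply: (measurableT_comp (_ : measurable_fun setT (fun c : bool => c%:R : R))) => //.
  by apply: mcut => //; exact: measurable_funTS measurable_fst.
have := @tonelli_on _ _ _ _ R leb m pos D mp mD f sigma_finite_pos sD mf.
move=> /(_ (fun t w _ _ => ltac:(by rewrite lee_fin mulr_ge0 ?expR_ge0))) fub.
transitivity (\int[leb]_(t in pos) \int[m]_(w in D) f (t, w))%E.
  apply: eq_integral => t _.
  have mc : measurable (D `&` [set w | t < X w ?<= if ~~ b]).
    have := mX mD `[t, +oo[%classic (measurable_itv _).
    have := mX mD `]t, +oo[%classic (measurable_itv _).
    by case: (b) => /= h1 h2; [move: h1|move: h2]; congr (measurable (_ `&` _));
      apply/seteqP; split => w /=; rewrite in_itv/= andbT.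
  set A := D `&` _ in mc *.
  transitivity (\int[m]_(w in D) ((expR (- (l * t)))%:E * (\1_A w)%:E))%E; last first.
    apply: eq_integral => w; rewrite inE => Dw; rewrite /f/= -EFinM indicE; congr (_ * _%:R)%:E.
    by rewrite /A in_setI mem_set//= mem_setE.
  rewrite ge0_integralZl// ?integral_indic//; last first.
    by apply/measurable_EFinP; exact: measurable_indic.
  by rewrite setIidl//; move=> w [].
rewrite fub; apply: eq_integral => w; rewrite inE => Dw.
have [it et] := integrable_expRN_itv b l0 (X0 w Dw).
rewrite -et /Rintegral fineK; last by apply: integrable_fin_num => //; exact: measurable_itv.
rewrite [RHS]integral_mkcond [LHS]integral_mkcond; apply: eq_integral => t _.
rewrite /f/= !patchE !mem_setE !in_itv/= andbT.
by case: (0 < t) => //=; case: (_ < _ ?<= if _); rewrite ?mulr1 ?mulr0.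
Qed.

(** From x <= exp(x) at x = u / (2 n), raised to the power n. *)
Lemma exprn_le_expR u (n : nat) : 0 <= u -> u ^+ n <= (2 * n%:R) ^+ n * expR (u / 2).
Proof.
move=> u0; case: n => [|n]; first by rewrite !expr0 mul1r -[leLHS]expR0 ler_expR divr_ge0.
have n0 : 0 < 2 * n.+1%:R :> R by rewrite mulr_gt0.
have e : u / (2 * n.+1%:R) <= expR (u / (2 * n.+1%:R)).
  by rewrite (le_trans _ (expR_ge1Dx _))// lerDr.
have h : (u / (2 * n.+1%:R)) ^+ n.+1 <= expR (u / (2 * n.+1%:R)) ^+ n.+1.
  by rewrite lerXn2r// nnegrE ?expR_ge0// divr_ge0// ltW.
rewrite -expRM_natl (_ : n.+1%:R * (u / (2 * n.+1%:R)) = u / 2) in h; last first.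
  by field; rewrite ?pnatr_eq0 -?natr1 ?natr1 ?pnatr_eq0.
by rewrite mulrC -ler_pdivrMr ?exprn_gt0// -expr_div_n.
Qed.

Lemma powR_le_expR (r : R) : 0 <= r ->
  exists C : R, 0 <= C /\ forall u, 0 <= u -> u `^ r <= C * expR (u / 2).
Proof.
move=> r0; pose n := (Num.trunc r).+1.
exists (1 + (2 * n%:R) ^+ n); split; first by rewrite addr_ge0// exprn_ge0// mulr_ge0.
move=> u u0; rewrite mulrDl mul1r.
have rn : r <= n%:R.
  by rewrite ltW// /n -natr1; have := truncnS_gt r; rewrite natr1.
have e1 := @exprn_le_expR u n u0.
have [u1|u1] := leP u 1.
  rewrite (@le_trans _ _ 1)//.
    by have := ge0_ler_powR r0 _ _ u1; rewrite !nnegrE powR1; apply.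
  rewrite -[leLHS]addr0 lerD ?mulr_ge0 ?exprn_ge0 ?mulr_ge0 ?expR_ge0//.
    by rewrite -[leLHS]expR0 ler_expR divr_ge0.
rewrite (le_trans _ (lerD (expR_ge0 _) e1))// add0r -powR_mulrn//.
by apply: ler_powR => //; exact: ltW.
Qed.

Lemma integrable_powR_expR (r : R) : 0 <= r ->
  leb.-integrable pos (EFin \o (fun u => u `^ r * expR (- u))).
Proof.
move=> r0; have [C [C0 hC]] := powR_le_expR r0.
have h : (0 : R) < 2^-1 by rewrite invr_gt0.
have [i1 _] := integrable_expRN h.
apply: (integrable_le measurable_pos _ (integrable_mulr measurable_pos C i1)).
  apply: measurable_funM; first exact: (measurable_funTS (measurable_powR r)).
  by apply: measurable_funTS; apply: measurableT_comp => //; exact: measurable_funN.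
move=> u /pos_gt0 u0; rewrite ger0_norm ?mulr_ge0 ?powR_ge0 ?expR_ge0//.
have -> : expR (- (2^-1 * u)) = expR (u / 2) * expR (- u).
  by rewrite -expRD; congr expR; field.
by rewrite mulrA ler_wpM2r ?expR_ge0// hC// ltW.
Qed.

End half_line.

Lemma Rintegral_sum d (T : measurableType d) (R : realType)
    (mu : {measure set T -> \bar R}) (D : set T) (F : nat -> T -> R) n :
  measurable D -> (forall i, mu.-integrable D (EFin \o F i)) ->
  mu.-integrable D (EFin \o (fun x => \sum_(i < n) F i x)) /\
  \int[mu]_(x in D) (\sum_(i < n) F i x) = \sum_(i < n) \int[mu]_(x in D) F i x.
Proof.
move=> mD iF; elim: n => [|n [IH1 IH2]].
  split.
    apply: (@eq_integrable _ _ _ mu _ mD (cst 0%E)); last exact: integrable0.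
    by move=> u _; rewrite /= big_ord0.
  transitivity (\int[mu]_(x in D) (0 * 0 : R)).
    by apply: eq_Rintegral => x _; rewrite big_ord0 mul0r.
  by rewrite RintegralZl ?mul0r ?big_ord0//; exact: integrable0.
have e : (fun x => \sum_(i < n.+1) F i x) = (fun x => \sum_(i < n) F i x + F n x).
  by apply/funext => u; rewrite big_ord_recr.
rewrite e; split; first exact: (integrable_add mD IH1 (iF n)).
by rewrite (RintegralD mD IH1 (iF n)) IH2 big_ord_recr.
Qed.

Lemma integrable_cst_fin d (T : measurableType d) (R : realType)
    (mu : {measure set T -> \bar R}) (A : set T) (c : R) :
  measurable A -> (mu A < +oo)%E -> mu.-integrable A (EFin \o (fun=> c)).
Proof.
move=> mA Afin; apply/integrableP; split; first exact: measurable_cst.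
by rewrite /= integral_cst// lte_mul_pinfty// ?lee_fin.
Qed.

Lemma Rintegral_le_subset d (T : measurableType d) (R : realType)
    (mu : {measure set T -> \bar R}) (A B : set T) (f : T -> R) :
  measurable A -> measurable B -> A `<=` B -> mu.-integrable B (EFin \o f) ->
  (forall x, B x -> 0 <= f x) -> \int[mu]_(x in A) f x <= \int[mu]_(x in B) f x.
Proof.
move=> mA mB AB iF f0.
rewrite (_ : A = B `&` A); last by rewrite setIC; apply/esym/setIidPl.
rewrite Rintegral_mkcondr; apply: le_Rintegral => //.
  apply: (integrable_le mB _ iF).
    apply/(measurable_restrict f mA mB); apply: (measurable_funS mB) (integrable_measurable iF) => //.
  move=> x Bx; rewrite patchE; case: ifP => _; last by rewrite normr0 f0.
  by rewrite ger0_norm// f0.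
by move=> x Bx; rewrite patchE; case: ifP => // _; exact: f0.
Qed.

(** * Continuity of the Laplace transform on monotone functions *)

Section exponential_polynomials.
Variable R : realType.
Local Notation leb := (@lebesgue_measure R).
Local Notation pos := (`]0%R, +oo[%classic : set R).
Implicit Types (w W : R -> R) (q : {poly R}).

(** Integrals against these weights are combinations of the values of the Laplace
    transform at the positive integers. *)
Definition exp_weight q u : R := expR (- u) * q.[expR (- u)].

Lemma measurable_expRN : measurable_fun pos (fun u : R => expR (- u)).
Proof. by apply: measurable_funTS; apply: measurableT_comp => //; exact: measurable_funN. Qed.

Lemma expRN_itv (u : R) : 0 < u -> 0 <= expR (- u) <= 1.
Proof. by move=> u0; rewrite expR_ge0 -[leRHS]expR0 ler_expR oppr_le0 ltW. Qed.

Lemma exp_weight_sum w : leb.-integrable pos (EFin \o (fun u => expR (- u) * w u)) ->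
  forall (c : nat -> R) n,
  leb.-integrable pos (EFin \o (fun u => \sum_(i < n) c i * (expR (- u) ^+ i.+1 * w u))) /\
  \int[leb]_(u in pos) (\sum_(i < n) c i * (expR (- u) ^+ i.+1 * w u)) =
  \sum_(i < n) c i * \int[leb]_(u in pos) (expR (- u) ^+ i.+1 * w u).
Proof.
move=> iw c; have mp := @measurable_pos R.
have iX i : leb.-integrable pos (EFin \o (fun u => expR (- u) ^+ i.+1 * w u)).
  have := integrable_mulb (b := fun u => expR (- u) ^+ i) (M := 1) mp _ _ iw.
  rewrite (_ : (fun u => expR (- u) ^+ i.+1 * w u) =
      (fun u => expR (- u) ^+ i * (expR (- u) * w u))); last first.
    by apply/funext => u; rewrite exprSr mulrA.
  apply; first exact: (measurable_funX _ measurable_expRN).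
  move=> u /pos_gt0 /expRN_itv/andP[u0 u1].
  by rewrite ger0_norm ?exprn_ge0// exprn_ile1.
move=> n; have [h e] := Rintegral_sum n mp (fun i => integrable_mulr mp (c i) (iX i)).
by split => //; rewrite e; apply: eq_bigr => i _; rewrite RintegralZl.
Qed.

Lemma integrable_exp_weight w q :
  leb.-integrable pos (EFin \o (fun u => expR (- u) * w u)) ->
  leb.-integrable pos (EFin \o (fun u => exp_weight q u * w u)) /\
  \int[leb]_(u in pos) (exp_weight q u * w u) =
  \sum_(i < size q) q`_i * \int[leb]_(u in pos) (expR (- u) ^+ i.+1 * w u).
Proof.
move=> iw; have [h1 h2] := exp_weight_sum iw (fun i => q`_i) (size q).
have e u : \sum_(i < size q) q`_i * (expR (- u) ^+ i.+1 * w u) = exp_weight q u * w u.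
  rewrite /exp_weight horner_coef mulr_sumr mulr_suml; apply: eq_bigr => i _.
  by rewrite exprS; ring.
by split; [move: h1|rewrite -h2]; [congr (leb.-integrable _ (EFin \o _))|congr (Rintegral _ _ _)];
  apply/funext => u; rewrite e.
Qed.

Lemma integrable_exp_weight1 q :
  leb.-integrable pos (EFin \o exp_weight q).
Proof.
have [i1 _] := integrable_expRN (@ltr01 R).
have i1' : leb.-integrable pos (EFin \o (fun u : R => expR (- u) * 1)).
  by move: i1; congr (leb.-integrable _ (EFin \o _)); apply/funext => u; rewrite mulr1 mul1r.
have [h _] := integrable_exp_weight q i1'.
by move: h; congr (leb.-integrable _ (EFin \o _)); apply/funext => u; rewrite mulr1.
Qed.

(** A polynomial whose weight is a probability density on the half-line that is
    concentrated within distance delta of a, up to a multiple eps of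
    exp(- u). *)
Record window (a delta eps : R) q : Prop := {
  window_ge0 : forall x, 0 <= x <= 1 -> 0 <= q.[x] ;
  window_mass : \int[leb]_(u in pos) exp_weight q u = 1 ;
  window_tail : forall u, 0 < u -> delta <= `|u - a| -> q.[expR (- u)] <= eps }.

(** Landau's kernel (1 - (x - x0)^2)^n with x0 = exp(- a), normalized. A point u
    at distance delta from a has |exp(- u) - x0| >= eta, hence a base at most
    r = 1 - eta^2, while on an interval of length kappa next to a the base is at
    least r' = 1 - eta^2 / 4 > r. The mass is therefore at least of order r'^n,
    and the kernel away from a is of order r^n. *)
Lemma landau_window (a delta eps : R) : 0 < a -> 0 < delta -> 0 < eps ->
  exists q, window a delta eps q.
Proof.
move=> a0 d0 e0; have mp := @measurable_pos R.
pose x0 := expR (- a); pose eta := x0 * (1 - expR (- delta)).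
have x00 : 0 < x0 := expR_gt0 _.
have x01 : x0 < 1 by rewrite expR_lt1 oppr_lt0.
have ed0 : 0 < expR (- delta) := expR_gt0 _.
have ed1 : expR (- delta) < 1 by rewrite expR_lt1 oppr_lt0.
have eta0 : 0 < eta by rewrite mulr_gt0// subr_gt0.
have eta1 : eta < 1 by rewrite /eta; nra.
pose g : {poly R} := 1 - ('X - x0%:P) ^+ 2.
have gE x : g.[x] = 1 - (x - x0) ^+ 2 by rewrite /g !hornerE.
have g0 x : 0 <= x <= 1 -> 0 <= g.[x].
  by move=> /andP[x_0 x_1]; rewrite gE; nra.
pose kappa := eta / 2; have kappa0 : 0 < kappa by rewrite divr_gt0.
pose b := expR (- (a + kappa)); have b0 : 0 < b := expR_gt0 _.
pose r := 1 - eta ^+ 2; pose r' := 1 - (eta / 2) ^+ 2.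
have r0 : 0 <= r by rewrite /r; nra.
have rr : r < r' by rewrite /r /r'; nra.
have r'0 : 0 < r' by exact: le_lt_trans rr.
have [n hn] : exists n, (r / r') ^+ n <= eps * (kappa * b).
  have c : (r / r') ^+ n @[n --> \oo] --> 0.
    by apply: cvg_expr; rewrite ger0_norm ?divr_ge0 ?(ltW r'0)// ltr_pdivrMr// mul1r.
  have e1 : 0 < eps * (kappa * b) := mulr_gt0 e0 (mulr_gt0 kappa0 b0).
  have /cvgrPdist_le/(_ _ e1)[n _ h] := c.
  exists n; have := h n (leqnn _); rewrite sub0r normrN; apply: le_trans.
  exact: ler_norm.
pose D := \int[leb]_(u in pos) exp_weight (g ^+ n) u.
have iD := integrable_exp_weight1 (g ^+ n).
have wpos u : 0 < u -> 0 <= exp_weight (g ^+ n) u.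
  move=> u0; rewrite mulr_ge0 ?expR_ge0// horner_exp exprn_ge0// g0//; exact: expRN_itv.
have Dge : kappa * b * r' ^+ n <= D.
  pose B := `]a, (a + kappa)[%classic : set R.
  have mB : measurable (B : set (measurableTypeR R)) by exact: measurable_itv.
  have BE : leb B = kappa%:E.
    by rewrite /B lebesgue_measure_itv/= lte_fin ltrDl kappa0 -EFinB addrC addKr.
  have Bp : B `<=` pos.
    by move=> u; rewrite /= !in_itv/= => /andP[au _]; rewrite andbT (lt_trans a0).
  have -> : kappa * b * r' ^+ n = \int[leb]_(u in B) (b * r' ^+ n).
    rewrite Rintegral_cst// (_ : fine _ = kappa); first by ring.
    by transitivity (fine (leb B)) => //; rewrite BE.
  apply: (@le_trans _ _ (\int[leb]_(u in B) exp_weight (g ^+ n) u)).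
    apply: le_Rintegral => //.
    - by apply: integrable_cst_fin => //; apply: (le_lt_trans _ (ltry kappa)); rewrite -BE.
    - exact: (integrableS mp mB Bp iD).
    - move=> u; rewrite /B/= in_itv/= => /andP[au uk].
      rewrite ler_pM ?exprn_ge0 ?(ltW b0) ?(ltW r'0)//.
        by rewrite ler_expR lerN2 ltW.
      rewrite horner_exp lerXn2r ?nnegrE ?(ltW r'0)//.
        by rewrite g0// expRN_itv// (lt_trans a0).
      rewrite gE /r' lerD2l lerN2.
      have h1 : expR (- u) <= x0 by rewrite ler_expR lerN2 ltW.
      have h2 : x0 * (1 + (a - u)) <= expR (- u).
        rewrite (_ : expR (- u) = x0 * expR (a - u)); last by rewrite -expRD; congr expR; ring.
        by rewrite ler_wpM2l ?(ltW x00)// expR_ge1Dx.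
      have h3 : x0 - expR (- u) <= eta / 2.
        have : u - a <= eta / 2 by move: uk; rewrite /kappa; lra.
        move: h2 au x01 x00 => {}; nra.
      by rewrite -sqrrN opprB ler_pXn2r ?nnegrE// ?subr_ge0// divr_ge0// ltW.
  by apply: Rintegral_le_subset => // u /pos_gt0; exact: wpos.
have D0 : 0 < D := lt_le_trans (mulr_gt0 (mulr_gt0 kappa0 b0) (exprn_gt0 n r'0)) Dge.
have wE u : exp_weight (D^-1 *: g ^+ n) u = D^-1 * exp_weight (g ^+ n) u.
  by rewrite /exp_weight hornerZ mulrCA.
exists (D^-1 *: g ^+ n); split.
- move=> x x1; rewrite hornerZ horner_exp mulr_ge0 ?invr_ge0 ?(ltW D0)//.
  by rewrite exprn_ge0// g0.
- under eq_Rintegral do rewrite wE.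
  by rewrite RintegralZl// mulVf// gt_eqF.
move=> u u0 du; rewrite hornerZ horner_exp.
have gr : g.[expR (- u)] <= r.
  rewrite gE /r lerD2l lerN2.
  suff : eta <= `|expR (- u) - x0|.
    by move=> h; rewrite -[leRHS](real_normK (num_real _)) ler_pXn2r ?nnegrE// ltW.
  move: du; rewrite ler_normr => /orP[du|du].
    rewrite ler_normr; apply/orP; right; rewrite opprB /eta mulrBr mulr1 lerD2l lerN2.
    by rewrite -expRD ler_expR; lra.
  have h : x0 * (1 + (a - u)) <= expR (- u).
    rewrite (_ : expR (- u) = x0 * expR (a - u)); last by rewrite -expRD; congr expR; ring.
    by rewrite ler_wpM2l ?(ltW x00)// expR_ge1Dx.
  rewrite ler_normr; apply/orP; left.
  have h2 : 1 - delta <= expR (- delta) := expR_ge1Dx _.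
  rewrite /eta; nra.
have h1 : g.[expR (- u)] ^+ n <= r ^+ n.
  by rewrite lerXn2r ?nnegrE// g0// expRN_itv.
rewrite mulrC ler_pdivrMr// (le_trans h1)//.
rewrite (@le_trans _ _ (eps * (kappa * b * r' ^+ n)))//; last by rewrite ler_wpM2l// ltW.
by rewrite mulrA -ler_pdivrMr ?exprn_gt0// -expr_div_n.
Qed.

(** Up to eps, the value at b of a nondecreasing function is at most its average
    over a window to the right of b and at least its average over a window to the
    left of b. *)
Section window_bounds.
Variables (a delta eps : R) (q : {poly R}).
Hypothesis qw : window a delta eps q.
Hypothesis eps0 : 0 < eps.
Variable W : R -> R.
Hypothesis mW : forall u v, 0 < u -> u <= v -> W u <= W v.
Hypothesis W0 : forall u, 0 < u -> 0 <= W u.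
Hypothesis iW : leb.-integrable pos (EFin \o (fun u => expR (- u) * W u)).

Let i1 : leb.-integrable pos (EFin \o (fun u : R => expR (- u))).
Proof.
have [h _] := integrable_expRN (@ltr01 R).
by move: h; congr (leb.-integrable _ (EFin \o _)); apply/funext => u; rewrite mul1r.
Qed.

Let i1E : \int[leb]_(u in pos) expR (- u) = 1 :> R.
Proof.
have [_ h] := integrable_expRN (@ltr01 R).
rewrite -invr1 -h; by apply: eq_Rintegral => u _; rewrite mul1r.
Qed.

Let mp : measurable (pos : set (measurableTypeR R)) := @measurable_pos R.

Lemma window_lower b : 0 < b -> b <= a - delta ->
  W b * (1 - eps) <= \int[leb]_(u in pos) (exp_weight q u * W u).
Proof.
move=> b0 ba; have [iq _] := integrable_exp_weight q iW.
have iq1 := integrable_exp_weight1 q.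
have j1 := integrable_mulr mp (W b) iq1.
have j2 := integrable_mulr mp (W b * eps) i1.
have -> : W b * (1 - eps) = \int[leb]_(u in pos) (W b * exp_weight q u - W b * eps * expR (- u)).
  by rewrite (RintegralB mp j1 j2) !RintegralZl// (window_mass qw) i1E; ring.
apply: le_Rintegral => //; first exact: (integrable_sub mp j1 j2).
move=> u /pos_gt0 u0; rewrite /exp_weight.
have e0 := expR_gt0 (- u).
have q0 : 0 <= q.[expR (- u)] by apply: (window_ge0 qw); exact: expRN_itv.
have [bu|ub] := leP b u.
  have h : W b <= W u by exact: mW.
  have := W0 b0; move: e0 q0 h eps0 => {}; move: (expR _) (q.[_]) (W b) (W u) eps.
  move=> E Q w w' e E0 Q0 ww' e0 w0.
  have : 0 <= E * Q * (w' - w) by rewrite !mulr_ge0 ?subr_ge0// ltW.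
  have : 0 <= e * (E * w) by rewrite !mulr_ge0// ltW.
  by nra.
have h : q.[expR (- u)] <= eps.
  by apply: (window_tail qw) => //; rewrite ler_normr; apply/orP; right; lra.
have h2 := W0 u0; have := W0 b0; move: e0 q0 h h2 eps0 => {}; move: (expR _) (q.[_]) (W b) (W u) eps.
move=> E Q w w' e E0 Q0 Qe w'0 e0 w0.
have : 0 <= E * w * (e - Q) by rewrite !mulr_ge0 ?subr_ge0// ltW.
have : 0 <= E * Q * w' by rewrite !mulr_ge0// ltW.
by nra.
Qed.

Lemma window_upper b : 0 < b -> a + delta <= b ->
  \int[leb]_(u in pos) (exp_weight q u * W u) <=
  W b + eps * \int[leb]_(u in pos) (expR (- u) * W u).
Proof.
move=> b0 ba; have [iq _] := integrable_exp_weight q iW.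
have iq1 := integrable_exp_weight1 q.
have j1 := integrable_mulr mp (W b) iq1.
have j2 := integrable_mulr mp eps iW.
have -> : W b + eps * \int[leb]_(u in pos) (expR (- u) * W u) =
   \int[leb]_(u in pos) (W b * exp_weight q u + eps * (expR (- u) * W u)).
  by rewrite (RintegralD mp j1 j2) !RintegralZl// (window_mass qw) mulr1.
apply: le_Rintegral => //; first exact: (integrable_add mp j1 j2).
move=> u /pos_gt0 u0; rewrite /exp_weight.
have e0 := expR_gt0 (- u).
have q0 : 0 <= q.[expR (- u)] by apply: (window_ge0 qw); exact: expRN_itv.
have [ub|bu] := leP u b.
  have h : W u <= W b by exact: mW.
  have := W0 u0; move: e0 q0 h eps0 => {}; move: (expR _) (q.[_]) (W b) (W u) eps.
  move=> E Q w w' e E0 Q0 Qe e0 w0.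
  have : 0 <= E * Q * (w - w') by rewrite !mulr_ge0 ?subr_ge0// ltW.
  have : 0 <= e * (E * w') by rewrite !mulr_ge0// ltW.
  by nra.
have h : q.[expR (- u)] <= eps.
  by apply: (window_tail qw) => //; rewrite ler_normr; apply/orP; left; lra.
have h2 := W0 u0; have := W0 b0; move: e0 q0 h h2 eps0 => {}; move: (expR _) (q.[_]) (W b) (W u) eps.
move=> E Q w w' e E0 Q0 Qe w'0 e0 w0.
have : 0 <= E * w' * (e - Q) by rewrite !mulr_ge0 ?subr_ge0// ltW.
have : 0 <= E * Q * w by rewrite !mulr_ge0// ltW.
by nra.
Qed.

End window_bounds.
End exponential_polynomials.

Section monotone_laplace.
Variable R : realType.
Local Notation leb := (@lebesgue_measure R).
Local Notation pos := (`]0%R, +oo[%classic : set R).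

Definition laplace_monotone (W : R -> R) : Prop :=
  [/\ forall u v, 0 < u -> u <= v -> W u <= W v,
      forall u, 0 < u -> 0 <= W u &
      leb.-integrable pos (EFin \o (fun u => expR (- u) * W u))].

Let small_upper (v m e eps w : R) : 0 < eps <= 1 / 2 ->
  eps * (v + m + 2 + e) = e / 2 -> 0 <= eps * v ->
  w * (1 - eps) <= v + e / 2 + eps * m + eps -> w <= v + e.
Proof.
move=> /andP[e0 e1] h hv hw; have e2 : 0 < 1 - eps by lra.
rewrite -(ler_pM2r e2); apply: le_trans hw _.
have -> : (v + e) * (1 - eps) = v + e - eps * v - eps * e by ring.
have : eps * v + eps * m + eps * 2 + eps * e = e / 2 by rewrite -h; ring.
lra.
Qed.

Let small_lower (v m e eps w : R) : 0 < eps <= 1 / 2 -> 0 <= eps * e ->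
  eps * (v + m + 2 + e) = e / 2 ->
  (v - e / 2) * (1 - eps) - eps <= w + eps * (m + 1) -> v - e <= w.
Proof.
move=> /andP[e0 e1] he h; have -> : (v - e / 2) * (1 - eps) = v - e / 2 - eps * v + eps * e / 2 by field.
have -> : eps * (m + 1) = eps * m + eps by ring.
have : eps * v + eps * m + eps * 2 + eps * e = e / 2 by rewrite -h; ring.
lra.
Qed.

(** The values of the Laplace transform at the positive integers control monotone
    functions at points of continuity of the limit: averages over polynomial
    windows converge, and windows just before and just after 1 squeeze the value
    at 1. Pointwise control replaces the weak compactness argument usual in
    proofs of Tauberian theorems. *)
Theorem monotone_laplace_continuity I (F : set_system I) {FF : Filter F}
    (V_ : I -> R -> R) (V : R -> R) :
  (\forall i \near F, laplace_monotone (V_ i)) -> laplace_monotone V ->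
  {for 1, continuous V} ->
  (forall k, \int[leb]_(u in pos) (expR (- u) ^+ k.+1 * V_ i u) @[i --> F] -->
             \int[leb]_(u in pos) (expR (- u) ^+ k.+1 * V u)) ->
  V_ i 1 @[i --> F] --> V 1.
Proof.
move=> mV_ mV cV hV.
have [mV1 mV2 mV3] := mV.
pose J q (W : R -> R) := \int[leb]_(u in pos) (exp_weight q u * W u).
pose m W := \int[leb]_(u in pos) (expR (- u) * W u).
have hm : m (V_ i) @[i --> F] --> m V by exact: (hV 0%N).
have hJ q : J q (V_ i) @[i --> F] --> J q V.
  rewrite /J; have [_ ->] := integrable_exp_weight q mV3.
  have h : \sum_(j < size q) q`_j * \int[leb]_(u in pos) (expR (- u) ^+ j.+1 * V_ i u) @[i --> F]
     --> \sum_(j < size q) q`_j * \int[leb]_(u in pos) (expR (- u) ^+ j.+1 * V u).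
    by apply: cvg_big => [|j _]; [exact: add_continuous|apply: cvgMr; exact: hV].
  apply: cvg_trans h; apply: near_eq_cvg.
  by apply: filterS mV_ => i [_ _ mi]; have [_ ->] := integrable_exp_weight q mi.
apply/cvgrPdist_le => e e0.
have [d d0 hd] : exists2 d : R, 0 < d < 1 / 2 & forall u, `|u - 1| <= 2 * d -> `|V u - V 1| <= e / 2.
  have e2 : 0 < e / 2 by rewrite divr_gt0.
  have /cvgrPdist_le/(_ _ e2)[d /= d0 hd] := cV.
  exists (Num.min (1 / 4) (d / 4)).
    by rewrite lt_min !divr_gt0//= gt_min; apply/orP; left; lra.
  move=> u hu; rewrite distrC; apply: hd => /=.
  rewrite distrC (le_lt_trans hu)// (@le_lt_trans _ _ (2 * (d / 4)))//; last by lra.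
  by rewrite ler_pM2l// ge_min lexx orbT.
have /andP[d_0 d_1] := d0.
have v0 : 0 <= V 1 := mV2 _ ltr01.
have m0 : 0 <= m V by apply: Rintegral_ge0 => u /pos_gt0 u0; rewrite mulr_ge0 ?expR_ge0// mV2.
pose X := V 1 + m V + 2 + e.
have X0 : 0 < X by rewrite /X; lra.
(* The errors eps V(1), eps m(V), 2 eps and eps e add up to e / 2. *)
pose eps := e / (2 * X).
have eps0 : 0 < eps by rewrite divr_gt0// mulr_gt0.
have epsX : eps * X = e / 2 by rewrite /eps; field; rewrite gt_eqF.
have eps1 : eps <= 1 / 2.
  by rewrite /eps ler_pdivrMr ?mulr_gt0// /X; lra.
have [q1 w1] : exists q, window (1 + d) d eps q by apply: landau_window => //; lra.
have [q2 w2] : exists q, window (1 - d) d eps q by apply: landau_window => //; lra.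
have u1 : J q1 V <= V 1 + e / 2 + eps * m V.
  have d2 : 0 < 1 + 2 * d by lra.
  have := window_upper w1 eps0 mV1 mV2 mV3 d2 => /(_ _)/le_trans -> //; first by lra.
  rewrite lerD2r; have := hd (1 + 2 * d).
  rewrite addrC addKr ger0_norm ?mulr_ge0 ?(ltW d_0)// => /(_ (lexx _)).
  by rewrite ler_norml => /andP[_]; lra.
have l1 : (V 1 - e / 2) * (1 - eps) <= J q2 V.
  have d2 : 0 < 1 - 2 * d by lra.
  have := window_lower w2 eps0 mV1 mV2 mV3 d2 => h.
  apply: le_trans (h _); last by rewrite mulr_natl mulr2n opprD addrA.
  apply: ler_wpM2r; first by lra.
  have := hd (1 - 2 * d).
  rewrite addrC addKr normrN ger0_norm ?mulr_ge0 ?(ltW d_0)// => /(_ (lexx _)).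
  by rewrite ler_norml => /andP[+ _]; lra.
have /cvgrPdist_le/(_ _ eps0) n1 := hJ q1.
have /cvgrPdist_le/(_ _ eps0) n2 := hJ q2.
have /cvgrPdist_le/(_ _ ltr01) n3 := hm.
near=> i.
have [mi1 mi2 mi3] : laplace_monotone (V_ i) by near: i.
have : `|J q1 V - J q1 (V_ i)| <= eps by near: i.
rewrite ler_norml => /andP[a1 a2].
have : `|J q2 V - J q2 (V_ i)| <= eps by near: i.
rewrite ler_norml => /andP[b1 b2].
have : `|m V - m (V_ i)| <= 1 by near: i.
rewrite ler_norml => /andP[c1 c2].
have k1 : V_ i 1 * (1 - eps) <= J q1 (V_ i).
  by apply: (window_lower w1 eps0 mi1 mi2 mi3 ltr01); rewrite addrK.
have k2 : J q2 (V_ i) <= V_ i 1 + eps * m (V_ i).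
  by apply: (window_upper w2 eps0 mi1 mi2 mi3 ltr01); rewrite subrK.
have mi : eps * m (V_ i) <= eps * (m V + 1).
  by rewrite ler_pM2l// addrC -lerBlDr -lerN2 opprB.
have ee : 0 < eps <= 1 / 2 by rewrite eps0.
rewrite distrC ler_distl; apply/andP; split.
  apply: (small_lower ee _ epsX); first by rewrite mulr_ge0// ltW.
  apply: (@le_trans _ _ (J q2 (V_ i))); last by rewrite (le_trans k2)// lerD2l.
  by rewrite lerBlDr (le_trans l1)// -lerBlDl.
apply: (small_upper ee epsX); first by rewrite mulr_ge0// ltW.
apply: (le_trans k1); apply: (@le_trans _ _ (J q1 V + eps)); last by rewrite lerD2r.
by rewrite addrC -lerBlDr -lerN2 opprB.
Unshelve. all: by end_near. Qed.

End monotone_laplace.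

(** * Bounds and decay of the solution *)

Section limits_at_infinity.
Variable R : realType.

Lemma cvg_at_right_of (I : Type) (F : set_system I) {FF : Filter F} (g : I -> R) :
  (\forall i \near F, 0 < g i) -> g i @[i --> F] --> (0 : R) -> g i @[i --> F] --> 0^'+.
Proof.
move=> g0 gc A hA; have := gc _ hA.
by rewrite /nbhs/= => h; apply: filterS2 h g0 => i /=; apply.
Qed.

Lemma cvg_divy (c : R) : 0 < c -> c / x @[x --> +oo] --> 0^'+.
Proof.
move=> c0; apply: cvg_at_right_of.
  by near=> x; rewrite divr_gt0//; near: x; exact: nbhs_pinfty_gt.
rewrite -[X in _ --> X](mulr0 c); apply: cvgMr.
apply/gtr0_cvgV0; last exact: cvg_id.
exact: nbhs_pinfty_gt.
Unshelve. all: by end_near. Qed.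

End limits_at_infinity.

Section cauchy_density.
Variable R : realType.
Local Notation leb := (@lebesgue_measure R).
Local Notation pos := (`]0%R, +oo[%classic : set R).

(** The arctangent integral over the line, rescaled by b. *)
Lemma integrable_cauchy (b : R) : 0 < b ->
  leb.-integrable setT (EFin \o (fun r => (1 + (b * r) ^+ 2)^-1)) /\
  \int[leb]_r (1 + (b * r) ^+ 2)^-1 = pi / b.
Proof.
move=> b0; have mp := @measurable_pos R.
have p0 (r : R) : 0 <= (1 + r ^+ 2)^-1 by rewrite invr_ge0 addr_ge0 ?sqr_ge0.
have cc (c : R) : continuous (fun r : R => (1 + (c * r) ^+ 2)^-1).
  move=> r; apply: cvgV; first by rewrite gt_eqF// ltr_pwDl// sqr_ge0.
  apply: cvgD; first exact: cvg_cst.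
  apply: (@continuous_comp _ _ _ (fun r => c * r) (fun z : R => z ^+ 2)); last exact: exprn_continuous.
  exact: mulrl_continuous.
have m1 : measurable_fun setT (fun r : R => (1 + r ^+ 2)^-1).
  by apply: continuous_measurable_fun => r; have := cc 1; under eq_fun do rewrite mul1r; apply.
have e0 : (\int[leb]_(r in pos) ((1 + r ^+ 2)^-1)%:E = (pi / 2)%:E)%E.
  rewrite -integral0y_oneDsqr integral_itv_obnd_cbnd//.
  by apply/measurable_EFinP; exact: measurable_funTS.
have i0 : leb.-integrable pos (EFin \o (fun r : R => (1 + r ^+ 2)^-1)).
  apply/integrableP; split; first by apply/measurable_EFinP; exact: measurable_funTS.
  under eq_integral do rewrite /= ger0_norm//.
  by rewrite e0 ltry.
have [i1 e1] := integrable_scale b0 i0 (fun u _ => p0 u).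
have e : (\int[leb]_r ((1 + (b * r) ^+ 2)^-1)%:E = (pi / b)%:E)%E.
  rewrite ge0_symfun_integralT//; last by move=> r; rewrite /= mulrN sqrrN.
  rewrite -set_itvcy -integral_itv_obnd_cbnd//; last exact: measurable_int i1.
  rewrite -[X in (_ * X)%E]fineK; last exact: integrable_fin_num.
  rewrite -EFinM; congr EFin; rewrite -[fine _]/(\int[leb]_(r in pos) (1 + (b * r) ^+ 2)^-1).
  have -> : \int[leb]_(r in pos) (1 + (b * r) ^+ 2)^-1 = b^-1 * (pi / 2).
    by apply: (mulfI (lt0r_neq0 b0)); rewrite -e1 /Rintegral e0/=; field; rewrite gt_eqF.
  by field; rewrite gt_eqF.
split; last by rewrite /Rintegral e.
apply/integrableP; split; first by apply/measurable_EFinP; exact: continuous_measurable_fun (cc b).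
under eq_integral do rewrite /= ger0_norm//.
by rewrite e ltry.
Qed.

Lemma integrable_powRN (q : R) : 1 < q ->
  leb.-integrable `[1, +oo[ (EFin \o (fun t => t `^ (- q))).
Proof.
move=> q1.
have q0 : 0 < q - 1 by rewrite subr_gt0.
pose F (t : R) := - (t `^ (1 - q) / (q - 1)).
have dF (t : R) : 0 < t -> is_derive t 1 F (t `^ (- q)).
  move=> t0; have h := is_derive1_powR (1 - q) t0.
  rewrite /F; apply: is_derive_eq; rewrite /GRing.scale/= (_ : 1 - q - 1 = - q); last by ring.
  by field; rewrite gt_eqF.
have cp (t : R) : 0 < t -> {for t, continuous (fun t : R => t `^ (- q))}.
  move=> t0; apply: differentiable_continuous; apply/derivable1_diffP.
  by have [] := is_derive1_powR (- q) t0.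
have gt1 (t : R) : 1 <= t -> 0 < t by exact: lt_le_trans.
have cF : F t @[t --> +oo] --> (0 : R).
  have h : (1 / t) `^ (q - 1) @[t --> +oo] --> (0 : R).
    exact: (cvg_comp _ _ (cvg_divy ltr01) (powR_cvg0 q0)).
  have h' : - ((1 / t) `^ (q - 1) / (q - 1)) @[t --> +oo] --> - (0 / (q - 1)) by apply: cvgN; apply: cvgMl.
  rewrite mul0r oppr0 in h'; apply: cvg_trans h'; apply: near_eq_cvg; near=> t.
  have t0 : 0 < t by near: t; exact: nbhs_pinfty_gt.
  rewrite /F; congr (- (_ / _)); rewrite div1r -powR_inv1 ?(ltW t0)// -powRrM.
  by congr (_ `^ _); ring.
have e : (\int[leb]_(t in `[1%R, +oo[) (t `^ (- q))%:E = 0%:E - (F 1)%:E)%E.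
  apply: ge0_continuous_FTC2y.
  - by move=> t _; exact: powR_ge0.
  - apply/continuous_within_itvcyP; split.
      by move=> t; rewrite in_itv/= andbT => t1; apply: cp; exact: lt_trans t1.
    by apply: cvg_at_right_filter; apply: cp.
  - exact: cF.
  - by move=> t t1; have [] := dF t (lt_trans ltr01 t1).
  - apply: cvg_at_right_filter; apply: differentiable_continuous.
    by apply/derivable1_diffP; have [] := dF 1 ltr01.
  - move=> t; rewrite in_itv/= andbT => t1; rewrite derive1E.
    by have [_ ->] := dF t (lt_trans ltr01 t1).
apply/integrableP; split.
  by apply/measurable_EFinP; exact: measurable_funTS (measurable_powR _).
under eq_integral do rewrite /= ger0_norm ?powR_ge0//.
by rewrite e -EFinB ltry.
Unshelve. all: by end_near. Qed.

End cauchy_density.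

Section stable_weight.
Variables (R : realType) (N : nat) (s : R).
Hypothesis N0 : (0 < N)%N.
Hypothesis s0 : 0 < s.
Local Notation leb := (@lebesgue_measure R).
Local Notation mu := (@lebesgue_rV R N).
Local Notation rV := 'rV[R]_N.

(** With y = a |r|^(2s), the right-hand side is C / (1 + y^(1/s)), and exp(y)
    dominates powers of y. The Cauchy density is used because it can be
    integrated in closed form for every scale. *)
Lemma expR_powR_le : exists C : R, 0 <= C /\
  forall a r : R, 0 < a -> expR (- (a * (r ^+ 2) `^ s)) <= C * (1 + (a `^ (2 * s)^-1 * r) ^+ 2)^-1.
Proof.
have [C [C0 hC]] := @powR_le_expR R s^-1 (ltac:(by rewrite invr_ge0 ltW)).
exists (1 + C); split; first by rewrite addr_ge0.
move=> a r a0; set y := a * (r ^+ 2) `^ s.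
have y0 : 0 <= y by rewrite mulr_ge0 ?powR_ge0// ltW.
have ye : (a `^ (2 * s)^-1 * r) ^+ 2 = y `^ s^-1.
  rewrite exprMn /y powRM ?powR_ge0 ?(ltW a0)// -!powRrM.
  rewrite mulfV ?gt_eqF// powRr1 ?sqr_ge0//; congr (_ * _).
  rewrite -powR_mulrn ?powR_ge0// -powRrM; congr (_ `^ _).
  by field; rewrite gt_eqF.
have z0 : 0 <= y `^ s^-1 := powR_ge0 _ _.
rewrite ye ler_pdivlMr ?ltr_pwDl//.
have h1 : y `^ s^-1 <= C * expR y.
  by rewrite (le_trans (hC _ y0))// ler_wpM2l// ler_expR; lra.
have h2 : 1 <= expR y by rewrite -[leLHS]expR0 ler_expR.
have E0 := expR_gt0 y.
rewrite expRN mulrC ler_pdivrMr//; lra.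
Qed.

(** Bounding |xi|^(2s) below by the mean of the |xi_i|^(2s) decouples the
    coordinates; each factor integrates to a multiple of a^(- 1 / (2 s)). *)
Lemma stable_weight_integral : exists C : R, forall a : R, 0 < a ->
  integrableR (fun xi : rV => expR (- (a * dotr xi xi `^ s))) /\
  \int[mu]_xi expR (- (a * dotr xi xi `^ s)) <= C * a `^ (- (N%:R / (2 * s))).
Proof.
have [C [C0 hC]] := expR_powR_le.
have Nr : 0 < N%:R :> R by rewrite ltr0n.
exists ((C * pi) ^+ N * N%:R `^ (N%:R / (2 * s))) => a a0.
have aN : 0 < a / N%:R by rewrite divr_gt0.
pose b := (a / N%:R) `^ (2 * s)^-1.
have b0 : 0 < b by rewrite powR_gt0.
have [ic ec] := integrable_cauchy b0.
pose F (i : 'I_N) (r : R) := C * (1 + (b * r) ^+ 2)^-1.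
have iF i : leb.-integrable setT (EFin \o F i) by exact: integrable_mulr.
have [iP eP] := integrable_prod iF.
have bnd (xi : rV) : expR (- (a * dotr xi xi `^ s)) <= \prod_(i < N) F i (xi ord0 i).
  apply: (@le_trans _ _ (\prod_(i < N) expR (- (a / N%:R * (xi ord0 i ^+ 2) `^ s)))).
    rewrite -expR_sum ler_expR sumrN lerN2 -mulr_sumr -mulrA ler_pM2l//.
    rewrite mulrC ler_pdivrMr//.
    have -> : dotr xi xi `^ s * N%:R = \sum_(i < N) dotr xi xi `^ s.
      by rewrite sumr_const card_ord mulr_natr.
    apply: ler_sum => i _; apply: ge0_ler_powR; rewrite ?nnegrE ?sqr_ge0 ?dotr_ge0 ?(ltW s0)//.
    exact: coord_sqr_le.
  by apply: ler_prod => i _; rewrite expR_ge0/=; exact: hC.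
have mE : measurable_fun setT (fun xi : rV => expR (- (a * dotr xi xi `^ s))).
  apply: (measurableT_comp (@measurable_expR R)); apply: measurable_funN; apply: measurable_funM => //.
  exact: (measurableT_comp (measurable_powR s) (@measurable_dotrr R N)).
have iE : integrableR (fun xi : rV => expR (- (a * dotr xi xi `^ s))).
  by apply: (integrable_le measurableT mE iP) => xi _; rewrite ger0_norm ?expR_ge0.
split => //.
apply: (@le_trans _ _ (\int[mu]_xi \prod_(i < N) F i (xi ord0 i))); first exact: le_Rintegral.
rewrite eP (eq_bigr (fun=> C * pi / b)); last first.
  by move=> i _; rewrite /F RintegralZl// ec mulrA.
rewrite prodr_const card_ord exprMn -mulrA ler_wpM2l ?exprn_ge0 ?mulr_ge0 ?pi_ge0//.
rewrite le_eqVlt; apply/orP; left; apply/eqP.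
rewrite exprVn /b -powR_mulrn ?powR_ge0// -powRrM.
rewrite (_ : (2 * s)^-1 * N%:R = N%:R / (2 * s)); last by rewrite mulrC.
have NV p : (N%:R^-1 : R) `^ p = (N%:R `^ p)^-1 by rewrite -powR_inv1 ?ler0n// -powRrM mulN1r powRN.
by rewrite powRM ?invr_ge0 ?(ltW a0) ?(ltW Nr)// NV powRN invfM invrK mulrC.
Qed.

End stable_weight.

Section solution_estimates.
Variables (R : realType) (N : nat) (gamma s : R).
Variables (phi : 'rV[R]_N -> R) (v : 'rV[R]_N -> R -> R) (M : R).
Local Notation rV := 'rV[R]_N.
Local Notation mu := (@lebesgue_rV R N).
Local Notation leb := (@lebesgue_measure R).
Local Notation pos := (`]0%R, +oo[%classic : set R).
Hypothesis N0 : (0 < N)%N.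
Hypothesis gamma0 : 0 <= gamma.
Hypothesis s01 : 0 < s < 1.
Hypothesis sN : s < N%:R * (gamma + 1) / 2.
Hypothesis iphi : integrableR phi.
Hypothesis phiM : forall x, 0 <= phi x <= M.
Hypothesis sol : cauchy_solution gamma s phi v.
Implicit Types (x xi y : rV) (t : R).

Let K : R := (2 * pi) ^+ N.
Let K0 : 0 < K.
Proof. by rewrite exprn_gt0// mulr_gt0// pi_gt0. Qed.

Local Notation clock := (clock gamma).

Let gamma1 : 0 < gamma + 1.
Proof. by rewrite ltr_wpDl. Qed.

Lemma clock_gt0 t : 0 < t -> 0 < clock t.
Proof. by move=> t0; rewrite divr_gt0// powR_gt0. Qed.

Let stable (c : R) xi := expR (- (c * dotr xi xi `^ s)).

Let stable0 c : stable c 0 = 1.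
Proof.
have /andP[s0 _] := s01.
by rewrite /stable dotr0l powR0 ?gt_eqF// mulr0 oppr0 expR0.
Qed.

Let posmult_st c : 0 < c -> posmult (stable c).
Proof. by move=> c0; apply: posmult_stable => //; exact: ltW. Qed.

Let heat (c : R) := gexp (Num.sqrt (2 * c)) : rV -> R.

Let heat_neq0 c : 0 < c -> Num.sqrt (2 * c) != 0 :> R.
Proof. by move=> c0; rewrite sqrtr_eq0 -ltNge mulr_gt0. Qed.

Let heatE (c : R) xi : 0 < c -> heat c xi = expR (- (c * dotr xi xi)).
Proof.
move=> c0; rewrite /heat /gexp sqr_sqrtr; last by rewrite mulr_ge0// ltW.
by congr expR; field.
Qed.

Let factor c c' xi : 0 < c -> 0 < c' ->
  expR (- ((c + c') * symbol s xi)) = heat c xi * (stable (c + c') xi * heat c' xi).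
Proof.
move=> c0 c'0; rewrite !heatE// -!expRD; congr expR; rewrite /symbol /fsymbol; ring.
Qed.

Let iheatM c (B : rV -> R) : 0 < c -> measurable_fun setT B ->
  (forall xi, `|B xi| <= \int[mu]_y `|phi y|) -> integrableR (fun xi => heat c xi * B xi).
Proof.
move=> c0 mB hB; have ih := integrable_gexp N (heat_neq0 c0).
exact: (integrable_mulbr measurableT mB (fun xi _ => hB xi) ih).
Qed.

Let mphi := integrable_measurable iphi.

Let iA c : 0 < c -> integrableR (fun xi => heat c xi * cosT phi xi).
Proof.
move=> c0; apply: iheatM => //; first exact: (measurable_waveT (@wave_cos R)).
by move=> xi; exact: (norm_waveT_le _ (@wave_cos R)).
Qed.

Let iB c : 0 < c -> integrableR (fun xi => heat c xi * sinT phi xi).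
Proof.
move=> c0; apply: iheatM => //; first exact: (measurable_waveT (@wave_sin R)).
by move=> xi; exact: (norm_waveT_le _ (@wave_sin R)).
Qed.

(* The stable semigroup at time c applied to the heat semigroup at time c'. The
   two times are kept apart so that a part of the Gaussian factor can be split
   off in the proof of strict positivity. *)
Let w c c' x := synth (fun xi => stable c xi * (heat c' xi * cosT phi xi))
                      (fun xi => stable c xi * (heat c' xi * sinT phi xi)) x.

Let w_bound c c' x : 0 < c -> 0 < c' -> 0 <= w c c' x <= K * M.
Proof.
move=> c0 c'0.
have hx y : 0 <= synth (fun xi => heat c' xi * cosT phi xi) (fun xi => heat c' xi * sinT phi xi) y <= K * M.
  rewrite synth_gexp_transform ?heat_neq0// -/K.
  have ig := integrable_gaussN y (Num.sqrt (2 * c')).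
  have igp := integrable_gaussNM y (heat_neq0 c'0) iphi.
  apply/andP; split.
    rewrite mulr_ge0 ?(ltW K0)//; apply: Rintegral_ge0 => z _.
    by rewrite mulr_ge0 ?gaussN_ge0//; have /andP[] := phiM z.
  have eM : M = \int[mu]_z (M * gaussN y (Num.sqrt (2 * c')) z).
    by rewrite RintegralZl// Rintegral_gaussN mulr1.
  rewrite ler_pM2l// [leRHS]eM; apply: le_Rintegral => //; first exact: integrable_mulr.
  by move=> z _; rewrite mulrC ler_wpM2r ?gaussN_ge0//; have /andP[] := phiM z.
apply/andP; split.
  have h0 y := (andP (hx y)).1.
  rewrite -[leLHS](mulr0 (stable c 0)).
  exact: (pm_synth (posmult_st c0) (iA c'0) (iB c'0) h0 x).
have iNA := integrableR_mulr (-1) (iA c'0).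
have iNB := integrableR_mulr (-1) (iB c'0).
have hN y : - (K * M) <= synth (fun xi => -1 * (heat c' xi * cosT phi xi))
    (fun xi => -1 * (heat c' xi * sinT phi xi)) y.
  rewrite synthZ; [|exact: iA|exact: iB].
  by rewrite mulN1r lerN2; have /andP[] := hx y.
have := pm_synth (posmult_st c0) iNA iNB hN x.
rewrite stable0 mul1r lerNl; apply: le_trans; rewrite le_eqVlt; apply/orP; left; apply/eqP.
rewrite /w -[RHS]mulN1r -synthZ.
- by apply: eq_Rintegral => xi _; ring.
- exact: integrable_pm (posmult_st c0) iNA.
- exact: integrable_pm (posmult_st c0) iNB.
Qed.

(** The solution is a Gaussian average of phi, hence between 0 and M, followed by
    a multiplier that preserves lower bounds; the upper bound is the lower bound
    for the opposite amplitudes. *)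
Lemma solution_bound x t : 0 < t -> 0 <= v x t <= M.
Proof.
move=> t0; have c0 := clock_gt0 t0.
have -> : v x t = K^-1 * w (clock t) (clock t) x.
  rewrite (solution_formula gamma0 s01 iphi sol x t0); congr (_ * _).
  apply: eq_Rintegral => xi _; rewrite /symbol mulrDr opprD expRD /fsymbol.
  by rewrite /stable heatE//; ring.
have /andP[w0 w1] := w_bound x c0 c0.
apply/andP; split; first by rewrite mulr_ge0 ?invr_ge0 ?(ltW K0).
by rewrite ler_pdivrMl.
Qed.

(** Half of the heat semigroup is split off, so that v(y, t) is the average of a
    nonnegative function W against a positive density. If it vanishes at one
    point, W = 0 almost everywhere, v(., t) = 0, and the mass of phi, which the
    flow conserves since the symbol vanishes at 0, is 0. *)
Lemma solution_gt0 x t : ~ {ae mu, forall x, phi x = 0} -> 0 < t -> 0 < v x t.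
Proof.
move=> phi0 t0; have c0 := clock_gt0 t0.
have c20 : 0 < clock t / 2 by rewrite divr_gt0.
have /andP[vge0 _] := solution_bound x t0.
rewrite lt_def vge0 andbT; apply/eqP => vx0; apply: phi0.
pose W := w (clock t) (clock t / 2).
have iWA := integrable_pm (posmult_st c0) (iA c20).
have iWB := integrable_pm (posmult_st c0) (iB c20).
have vE y : v y t = K^-1 * \int[mu]_z (gaussN y (Num.sqrt (2 * (clock t / 2))) z * W z).
  rewrite (solution_formula gamma0 s01 iphi sol y t0); congr (_ * _).
  rewrite -synth_gexp ?heat_neq0//; apply: eq_Rintegral => xi _; rewrite -/(heat (clock t / 2) xi).
  have e : expR (- (clock t * symbol s xi)) =
      heat (clock t / 2) xi * (stable (clock t) xi * heat (clock t / 2) xi).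
    by have := factor xi c20 c20; rewrite -splitr.
  by rewrite e; ring.
have W0 z : 0 <= W z by have /andP[] := w_bound z c0 c20.
have mW : measurable_fun setT W.
  exact: (measurable_synth (integrable_measurable iWA) (integrable_measurable iWB)).
have iW y : integrableR (fun z => gaussN y (Num.sqrt (2 * (clock t / 2))) z * W z).
  have hW z : setT z -> `|W z| <= K * M.
    by move=> _; have /andP[w0 w1] := w_bound z c0 c20; rewrite ger0_norm.
  exact: (integrable_mulbr measurableT mW hW (integrable_gaussN y _)).
have zero_ae (F : rV -> R) : integrableR F -> (forall z, 0 <= F z) -> \int[mu]_z F z = 0 ->
    {ae mu, forall z, F z = 0}.
  move=> iF F0 eF.
  have [h _] := ae_eq_integral_abs mu measurableT (measurable_int _ iF).
  have : (\int[mu]_z `|(EFin \o F) z| = 0)%E.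
    under eq_integral do rewrite /= ger0_norm//.
    rewrite -[LHS]fineK; last exact: integrable_fin_num.
    by rewrite -[fine _]/(\int[mu]_z F z) eF.
  by move/h; apply: filterS => z /(_ I) [].
have W_ae : {ae mu, forall z, W z = 0}.
  have : \int[mu]_z (gaussN x (Num.sqrt (2 * (clock t / 2))) z * W z) = 0.
    by apply: (mulfI (invr_neq0 (lt0r_neq0 K0))); rewrite -vE vx0 mulr0.
  move/zero_ae => /(_ (iW x)) h.
  have : {ae mu, forall z, gaussN x (Num.sqrt (2 * (clock t / 2))) z * W z = 0}.
    by apply: h => z; rewrite mulr_ge0 ?gaussN_ge0.
  apply: filterS => z /eqP; rewrite mulf_eq0 => /orP[|/eqP//].
  by rewrite gt_eqF// gaussN_gt0// heat_neq0.
have v0 y : v y t = 0.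
  rewrite vE (_ : \int[mu]_z _ = 0) ?mulr0//.
  transitivity (\int[mu]_(z in setT) (0 : R)); last first.
    by rewrite /Rintegral integral0.
  rewrite /Rintegral; congr fine; apply: ae_eq_integral => //.
    exact: measurable_int (iW y).
  by apply: filterS W_ae => z e _; rewrite /= e mulr0.
have [e _] := transform_sol gamma0 s01 iphi sol 0 t0.
have mass : \int[mu]_y phi y = 0.
  have -> : \int[mu]_y phi y = cosT phi 0.
    by apply: eq_Rintegral => y _; rewrite dotrC dotr0l cos0 mulr1.
  have -> : cosT phi 0 = cosT (v ^~ t) 0.
    by rewrite e symbol0// mulr0 oppr0 expR0 mul1r.
  rewrite /cosT; transitivity (\int[mu]_(z in setT) (0 : R)).
    by apply: eq_Rintegral => y _; rewrite v0 mul0r.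
  by rewrite /Rintegral integral0.
by apply: zero_ae => // y; have /andP[] := phiM y.
Qed.

Lemma solution_continuous x t : 0 < t -> {for t, continuous (v x)}.
Proof.
move=> t0; apply: differentiable_continuous; apply/derivable1_diffP.
exact: (sol_derivable sol).
Qed.

(** Near 0 the solution is bounded. At infinity it is at most a multiple of the
    integral of exp(- clock(t) |xi|^(2s)), of order t^(- q) with
    q = N (gamma + 1) / (2 s); the condition on s says that q > 1. *)
Lemma solution_integrable x : leb.-integrable pos (EFin \o v x).
Proof.
have /andP[s0 _] := s01.
have mp := @measurable_pos R.
have mv : measurable_fun pos (v x).
  apply: open_continuous_measurable_fun; first exact: interval_open.
  by move=> t; rewrite inE => /pos_gt0; exact: solution_continuous.
have [C hC] := stable_weight_integral N0 s0.
pose q := N%:R * (gamma + 1) / (2 * s).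
have q1 : 1 < q.
  by have := sN; rewrite ltr_pdivlMr// mulrC => h; rewrite /q ltr_pdivlMr ?mulr_gt0// mul1r.
pose D := \int[mu]_y `|phi y|.
have D0 : 0 <= D by exact: Rintegral_ge0.
pose C' := K^-1 * (2 * D) * (C * (gamma + 1)^-1 `^ (- (N%:R / (2 * s)))).
have decay t : 0 < t -> v x t <= C' * t `^ (- q).
  move=> t0; have c0 := clock_gt0 t0.
  have [iE hE] := hC _ c0.
  rewrite (solution_formula gamma0 s01 iphi sol x t0).
  have -> : C' * t `^ (- q) = K^-1 * (2 * D * (C * clock t `^ (- (N%:R / (2 * s))))).
    rewrite /C' /clock powRM ?powR_ge0 ?invr_ge0 ?(ltW gamma1)// -powRrM.
    rewrite (_ : (gamma + 1) * - (N%:R / (2 * s)) = - q); first by ring.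
    by rewrite /q; field; rewrite gt_eqF.
  rewrite ler_pM2l ?invr_gt0//.
  have iT (B : rV -> R) : measurable_fun setT B -> (forall xi, `|B xi| <= D) ->
      integrableR (fun xi => expR (- (clock t * symbol s xi)) * B xi).
    move=> mB hB; apply: (integrable_le measurableT _ (integrableR_mulr D iE)).
      apply: measurable_funM => //; apply: (measurableT_comp (@measurable_expR R)).
      apply: measurable_funN; apply: measurable_funM => //; apply: measurable_funD.
        exact: measurable_dotrr.
      exact: (measurableT_comp (measurable_powR s) (@measurable_dotrr R N)).
    move=> xi _; rewrite normrM [leRHS]mulrC ler_pM// ger0_norm ?expR_ge0// ler_expR lerN2.
    by rewrite ler_pM2l// lerDr dotr_ge0.
  have i1 := iT _ (measurable_waveT (@wave_cos R) mphi) (fun xi => norm_waveT_le xi (@wave_cos R) iphi).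
  have i2 := iT _ (measurable_waveT (@wave_sin R) mphi) (fun xi => norm_waveT_le xi (@wave_sin R) iphi).
  apply: le_trans (ler_norm _) _; apply: le_trans (norm_synth_le x i1 i2) _.
  apply: (@le_trans _ _ (2 * D * \int[mu]_xi expR (- (clock t * dotr xi xi `^ s)))); last first.
    by rewrite ler_wpM2l// mulr_ge0.
  rewrite -RintegralZl//; apply: le_Rintegral => //; [exact: integrable_absD|exact: integrableR_mulr|].
  move=> xi _; rewrite !normrM ger0_norm ?expR_ge0// -mulrDr mulrC.
  rewrite ler_pM ?addr_ge0 ?expR_ge0//.
    rewrite mulr_natl mulr2n lerD//; first exact: (norm_waveT_le _ (@wave_cos R)).
    exact: (norm_waveT_le _ (@wave_sin R)).
  by rewrite ler_expR lerN2 ler_pM2l// lerDr dotr_ge0.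
have M0 : 0 <= M by have /andP[p0 p1] := phiM 0; exact: le_trans p1.
apply/integrableP; split; first exact/measurable_EFinP.
have posE : pos = `]0, 1[%classic `|` `[1, +oo[%classic.
  apply/seteqP; split => t /=; rewrite !in_itv/= !andbT.
    by move=> t0; have [t1|t1] := ltP t 1; [left; rewrite t0|right].
  by move=> [/andP[]//|]; exact: lt_le_trans.
have mA : measurable (`]0, 1[%classic : set (measurableTypeR R)) by exact: measurable_itv.
have mB : measurable (`[1, +oo[%classic : set (measurableTypeR R)) by exact: measurable_itv.
have i1 : leb.-integrable `]0, 1[ (EFin \o v x).
  apply: (@integrable_le _ _ _ leb _ mA _ (fun=> M)).
  - by apply: measurable_funS mv => // t; rewrite /= !in_itv/= => /andP[->].
  - apply: integrable_cst_fin => //.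
    have BE : leb (`]0%R, 1%R[%classic : set R) = 1%E.
      by rewrite lebesgue_measure_itv/= lte_fin ltr01 -EFinB subr0.
    by apply: (le_lt_trans _ (ltry 1)); rewrite -BE.
  - move=> t; rewrite /= in_itv/= => /andP[t0 _].
    by have /andP[v0 v1] := solution_bound x t0; rewrite ger0_norm.
have i2 : leb.-integrable `[1, +oo[ (EFin \o v x).
  apply: (@integrable_le _ _ _ leb _ mB _ (fun t => C' * t `^ (- q))).
  - by apply: measurable_funS mv => // t; rewrite /= !in_itv/= !andbT; exact: lt_le_trans.
  - by apply: integrable_mulr => //; exact: integrable_powRN.
  - move=> t; rewrite /= in_itv/= andbT => t1; have t0 : 0 < t := lt_le_trans ltr01 t1.
    by have /andP[v0 _] := solution_bound x t0; rewrite ger0_norm// decay.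
rewrite posE ge0_integral_setU//; last 2 first.
- by rewrite -posE; apply: measurableT_comp => //; exact/measurable_EFinP.
- rewrite disj_set2E; apply/eqP/seteqP; split => t //=; rewrite !in_itv/= andbT => -[/andP[_ t1]].
  by rewrite leNgt t1.
rewrite lte_add_pinfty//; first by have /integrableP[] := i1.
by have /integrableP[] := i2.
Qed.

(** A vanishing norm would make the solution vanish for almost every time, while
    it is positive at all of them. *)
Lemma solution_L1_gt0 x : ~ {ae mu, forall x, phi x = 0} -> 0 < L1_norm_time (v x).
Proof.
move=> phi0; rewrite lt_def; apply/andP; split; last by apply: Rintegral_ge0.
apply/eqP => e0; have iv := solution_integrable x; have mp := @measurable_pos R.
have [h _] := ae_eq_integral_abs leb mp (measurable_int _ iv).
have /h hae : (\int[leb]_(t in pos) `|(EFin \o v x) t| = 0)%E.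
  rewrite -[LHS]fineK; last exact: integrable_fin_num (integrable_abse iv).
  by rewrite -[fine _]/(L1_norm_time (v x)) e0.
have : leb.-negligible pos.
  move: hae; rewrite /ae_eq /almost_everywhere/=; apply: negligibleS => t /= pt /(_ pt) [].
  by apply/eqP; rewrite gt_eqF// solution_gt0//; exact: pos_gt0.
move/(measure_negligible mp).
have posE : leb pos = +oo%E by rewrite lebesgue_measure_itv/= ltry.
by rewrite -[X in X = _ -> _]/(leb pos) posE.
Qed.

End solution_estimates.

(** * Stieltjes sums *)

Section step_sums.
Variable R : realType.
Local Notation leb := (@lebesgue_measure R).
Local Notation pos := (`]0%R, +oo[%classic : set R).
Variables (f : R -> R) (M : R).
Hypothesis fM : forall t, 0 < t -> 0 <= f t <= M.
Hypothesis cf : forall t : R, 0 < t -> {for t, continuous f}.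
Implicit Types (n k : nat) (t : R) (H : R -> R).

(** Mesh 1 / (n + 1) on the interval [0, n + 1]: the mesh is refined and the
    interval exhausts the half-line at the same time. *)
Definition grid n k : R := k%:R / n.+1%:R.

Lemma grid0 n : grid n 0 = 0. Proof. by rewrite /grid mul0r. Qed.

Lemma grid_ge0 n k : 0 <= grid n k. Proof. by rewrite divr_ge0. Qed.

Lemma grid_le n : {homo grid n : j k / (j <= k)%N >-> j <= k}.
Proof. by move=> j k jk; rewrite /grid ler_wpM2r ?invr_ge0// ler_nat. Qed.

Lemma grid_gt0 n k : 0 < grid n k.+1. Proof. by rewrite divr_gt0. Qed.

Lemma grid_last n : grid n (n.+1 ^ 2) = n.+1%:R.
Proof. by rewrite /grid natrX; field; rewrite (_ : 1 + n%:R = n.+1%:R) ?pnatr_eq0// -natr1 addrC. Qed.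

Lemma gridS n k : grid n k.+1 = grid n k + n.+1%:R^-1.
Proof. by rewrite /grid -natr1 mulrDl mul1r. Qed.

Definition stepf n t : R :=
  \sum_(k < n.+1 ^ 2) f (grid n k.+1) * (grid n k < t <= grid n k.+1)%R%:R.

(** A sum of increments, linear in H: it can be integrated term by term over a
    family of distribution functions H, whatever the dependence of their
    densities on the parameter of the family. *)
Definition stepsum n H : R :=
  \sum_(k < n.+1 ^ 2) f (grid n k.+1) * (H (grid n k.+1) - H (grid n k)).

Lemma grid_cell n t : 0 < t -> t <= n.+1%:R ->
  exists2 k, (k < n.+1 ^ 2)%N & grid n k < t <= grid n k.+1.
Proof.
move=> t0; rewrite -grid_last => tn.
have ex : exists j, t <= grid n j by exists (n.+1 ^ 2)%N.
case: (ex_minnP ex) => -[|k] tk mk; first by move: tk; rewrite grid0 leNgt t0.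
exists k; first exact: mk.
rewrite tk andbT ltNge; apply/negP => /mk; by rewrite ltnn.
Qed.

Lemma stepf_cell n k t : (k < n.+1 ^ 2)%N -> grid n k < t <= grid n k.+1 ->
  stepf n t = f (grid n k.+1).
Proof.
move=> kn /andP[kt tk]; rewrite /stepf (bigD1 (Ordinal kn))//= kt tk mulr1.
rewrite big1 ?addr0// => i ik; have [ik'|ki] := ltnP i k.
  have := grid_le n ik'; move=> h; rewrite [t <= _]leNgt (le_lt_trans h kt) andbF mulr0//.
have ki' : (k < i)%N by rewrite ltn_neqAle ki andbT; apply: contra ik => /eqP e; apply/eqP/val_inj.
by have := grid_le n ki'; move=> h; rewrite ltNge (le_trans tk h) mulr0.
Qed.

Lemma stepf_bound n t : 0 < t -> 0 <= stepf n t <= M.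
Proof.
move=> t0; have [tn|nt] := leP t n.+1%:R.
  have [k kn kt] := grid_cell t0 tn.
  by rewrite (stepf_cell kn kt); apply: fM; exact: grid_gt0.
have -> : stepf n t = 0.
  rewrite /stepf big1// => k _.
  have h : grid n k.+1 <= n.+1%:R by rewrite -grid_last; apply: grid_le; exact: ltn_ord.
  by rewrite [t <= _]leNgt (le_lt_trans h nt) andbF mulr0.
by rewrite lexx; have /andP[h0 h1] := fM t0; exact: le_trans h1.
Qed.

Lemma cvg_stepf t : 0 < t -> stepf n t @[n --> \oo] --> f t.
Proof.
move=> t0; apply/cvgrPdist_lt => e e0.
have /cvgrPdist_lt/(_ _ e0)[d /= d0 hd] := cf t0.
have /cvgrPdist_lt/(_ _ d0) hn := @cvg_harmonic R.
near=> n.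
have tn : t <= n.+1%:R.
  rewrite (@le_trans _ _ n%:R) ?ler_nat//; near: n; exact: nbhs_infty_ger.
have [k kn /andP[kt tk]] := grid_cell t0 tn.
rewrite (stepf_cell kn); last by rewrite kt.
apply: hd => /=; rewrite distrC ger0_norm ?subr_ge0//.
apply: (@le_lt_trans _ _ n.+1%:R^-1); first by rewrite lerBlDl gridS lerD2r ltW.
have : `|0 - n.+1%:R^-1| < d by near: n; exact: hn.
by rewrite sub0r normrN ger0_norm ?invr_ge0.
Unshelve. all: by end_near. Qed.

Lemma measurable_stepf n : measurable_fun setT (stepf n).
Proof.
rewrite /stepf; apply: measurable_sum => k; apply: measurable_funM => //.
apply: measurableT_comp => //; apply: measurable_and.
  exact: measurable_fun_ltr.
exact: measurable_fun_ler.
Qed.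

(** Each increment of the primitive H is the integral of g over a cell. *)
Lemma stepsum_integral n (g : R -> R) H : leb.-integrable pos (EFin \o g) ->
  (forall t, 0 <= t -> H t = \int[leb]_(r in `]0, t]) g r) ->
  stepsum n H = \int[leb]_(t in pos) (stepf n t * g t).
Proof.
move=> ig hH; have mp := @measurable_pos R.
pose cell k : set R := `]grid n k, grid n k.+1]%classic.
have mcell k : measurable (cell k : set (measurableTypeR R)) by exact: measurable_itv.
have cellp k : cell k `<=` pos.
  by move=> t; rewrite /cell/= !in_itv/= => /andP[kt _]; rewrite andbT (le_lt_trans (grid_ge0 n k)).
pose F k (t : R) := f (grid n k.+1) * ((grid n k < t <= grid n k.+1)%R%:R * g t).
have patchF k t : (grid n k < t <= grid n k.+1)%R%:R * g t = (g \_ (cell k)) t.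
  by rewrite patchE mem_setE /cell in_itv/=; case: ifP => _; rewrite ?mul1r ?mul0r.
have iF1 k : leb.-integrable pos (EFin \o (fun t => (grid n k < t <= grid n k.+1)%R%:R * g t)).
  apply: (integrable_mulb mp (M := 1)) => //.
    apply: measurable_funTS; apply: measurableT_comp => //; apply: measurable_and.
      exact: measurable_fun_ltr.
    exact: measurable_fun_ler.
  by move=> t _; case: (_ && _); rewrite ?normr1 ?normr0.
have iF k : leb.-integrable pos (EFin \o F k) by exact: integrable_mulr.
have [_ e] := Rintegral_sum (n.+1 ^ 2) mp iF.
transitivity (\int[leb]_(t in pos) (\sum_(k < n.+1 ^ 2) F k t)); last first.
  apply: eq_Rintegral => t _; rewrite /stepf mulr_suml; apply: eq_bigr => k _.
  by rewrite /F mulrA.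
rewrite e; apply: eq_bigr => k _; rewrite /F RintegralZl//; congr (_ * _).
rewrite !hH ?grid_ge0// Rintegral_itvB; last 3 first.
- by apply: (integrableS mp) ig => //= t; rewrite /= !in_itv/= => /andP[->].
- by rewrite bnd_simp grid_ge0.
- by rewrite bnd_simp grid_le.
transitivity (\int[leb]_(t in pos `&` cell k) g t).
  by congr (Rintegral _ _ _); rewrite setIC; apply/esym/setIidPl; exact: cellp.
by rewrite Rintegral_mkcondr; apply: eq_Rintegral => t _; rewrite patchF.
Qed.

Lemma cvg_stepsum (g : R -> R) H : leb.-integrable pos (EFin \o g) ->
  (forall t, 0 <= t -> H t = \int[leb]_(r in `]0, t]) g r) ->
  stepsum n H @[n --> \oo] --> \int[leb]_(t in pos) (f t * g t).
Proof.
move=> ig hH; have mp := @measurable_pos R.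
have M0 : 0 <= M by have /andP[h0 h1] := fM ltr01; exact: le_trans h1.
rewrite (_ : stepsum ^~ H = fun n => \int[leb]_(t in pos) (stepf n t * g t)); last first.
  by apply/funext => n; exact: stepsum_integral.
refine (proj2 (@Rintegral_dct _ _ _ leb pos mp _ _ (fun t => M * `|g t|) _ _ _ _)).
- move=> n; apply: measurable_funM; last exact: integrable_measurable ig.
  exact: measurable_funTS (measurable_stepf n).
- by move=> t /pos_gt0 t0; apply: cvgMl; exact: cvg_stepf.
- by apply: integrable_mulr => //; exact: integrable_normr.
- move=> n t /pos_gt0 t0; rewrite normrM ler_wpM2r//.
  by have /andP[h0 h1] := stepf_bound n t0; rewrite ger0_norm.
Qed.

Lemma stepsum_bound n H : (forall s t, 0 <= s -> s <= t -> H s <= H t) ->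
  0 <= stepsum n H <= M * (H n.+1%:R - H 0).
Proof.
move=> mH; have d0 k : 0 <= H (grid n k.+1) - H (grid n k).
  by rewrite subr_ge0 mH ?grid_ge0// grid_le.
apply/andP; split.
  by apply: sumr_ge0 => k _; rewrite mulr_ge0//; have /andP[] := fM (grid_gt0 n k).
rewrite -grid_last -[in H 0](grid0 n) -(telescope_sumr (fun k => H (grid n k)))// big_mkord mulr_sumr.
apply: ler_sum => k _; rewrite ler_wpM2r//.
by have /andP[] := fM (grid_gt0 n k).
Qed.

End step_sums.

(** * Karamata's Tauberian theorem *)

Section karamata.
Variable R : realType.
Local Notation leb := (@lebesgue_measure R).
Local Notation pos := (`]0%R, +oo[%classic : set R).
Variables (h : R -> R) (M : R).
Hypothesis mh : measurable_fun pos h.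
Hypothesis hM : forall r, 0 < r -> 0 <= h r <= M.

Definition primitive (t : R) : R := \int[leb]_(r in `]0, t[) h r.
Definition laplace (l : R) : R := \int[leb]_(r in pos) (expR (- (l * r)) * h r).

Let mp : measurable (pos : set (measurableTypeR R)) := @measurable_pos R.

Let integrable_itv t : leb.-integrable `]0, t[ (EFin \o h).
Proof.
have tp : `]0, t[%classic `<=` (pos : set R).
  by move=> r; rewrite /= !in_itv/= => /andP[->].
have mi : measurable (`]0, t[%classic : set (measurableTypeR R)) by exact: measurable_itv.
apply: (@integrable_le _ _ _ leb _ mi h (fun=> M)).
- exact: measurable_funS mh.
- apply: integrable_cst_fin => //.
  have : (leb (`]0%R, t[%classic : set R) < +oo)%E; last by [].
  by rewrite lebesgue_measure_itv/=; case: ifP => // _; rewrite -EFinB ltry.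
- by move=> r /tp /pos_gt0 /hM/andP[h0 h1]; rewrite ger0_norm.
Qed.

Lemma primitive_ge0 t : 0 <= primitive t.
Proof.
by apply: Rintegral_ge0 => r; rewrite /= in_itv/= => /andP[/hM/andP[]].
Qed.

Lemma primitive_nondecreasing t t' : t <= t' -> primitive t <= primitive t'.
Proof.
move=> tt; apply: Rintegral_le_subset => //.
- by move=> r; rewrite /= !in_itv/= => /andP[-> rt]; rewrite (lt_le_trans rt).
- by move=> r; rewrite /= in_itv/= => /andP[/hM/andP[]].
Qed.

(** Tonelli on the region r < t: integrating exp(- l t) over t > r gives
    exp(- l r) / l. *)
Lemma laplace_primitive l : 0 < l ->
  leb.-integrable pos (EFin \o (fun t => expR (- (l * t)) * primitive t)) /\
  \int[leb]_(t in pos) (expR (- (l * t)) * primitive t) = laplace l / l.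
Proof.
move=> l0; have [ie _] := integrable_expRN l0.
have me := integrable_measurable ie.
have il : leb.-integrable pos (EFin \o (fun r => expR (- (l * r)) * h r)).
  apply: (integrable_le mp _ (integrable_mulr mp M ie)); first exact: measurable_funM.
  move=> r /pos_gt0/hM/andP[h0 h1].
  by rewrite ger0_norm ?mulr_ge0 ?expR_ge0// mulrC ler_wpM2r ?expR_ge0.
have mprim : measurable_fun pos primitive.
  by apply: measurable_funTS; apply: nondecreasing_measurable => //;
    exact: primitive_nondecreasing.
pose f (p : R * R) := (expR (- (l * p.1)) * ((p.2 < p.1)%R%:R * h p.2))%:E.
have mpp : measurable (pos `*` pos : set (measurableTypeR R * measurableTypeR R)) by exact: measurableX.
have comp1 (g : R -> R) : measurable_fun pos g ->
    measurable_fun (pos `*` pos) (fun p : measurableTypeR R * measurableTypeR R => g p.1).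
  move=> mg; apply: (@measurable_comp _ _ _ _ _ _ pos g) => //; last exact: measurable_funTS.
  by move=> _ [[t r] [/= pt _] <-].
have comp2 (g : R -> R) : measurable_fun pos g ->
    measurable_fun (pos `*` pos) (fun p : measurableTypeR R * measurableTypeR R => g p.2).
  move=> mg; apply: (@measurable_comp _ _ _ _ _ _ pos g) => //; last exact: measurable_funTS.
  by move=> _ [[t r] [/= _ pr] <-].
have mf : measurable_fun (pos `*` pos) (f : measurableTypeR R * measurableTypeR R -> \bar R).
  apply/measurable_EFinP; apply: measurable_funM; first exact: comp1 me.
  apply: measurable_funM; last exact: comp2 mh.
  apply: measurable_funTS; apply: (measurableT_comp (_ : measurable_fun setT (fun c : bool => c%:R : R))) => //.
  exact: measurable_fun_ltr measurable_snd measurable_fst.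
have sp : sigma_finite pos leb by exact: sigma_finite_pos.
have e : (\int[leb]_(t in pos) (expR (- (l * t)) * primitive t)%:E =
    \int[leb]_(r in pos) (expR (- (l * r)) * h r / l)%:E)%E.
  have f0 (t r : R) : pos t -> pos r -> (0 <= f (t, r))%E.
    by move=> _ /pos_gt0/hM/andP[h0 _]; rewrite lee_fin !mulr_ge0 ?expR_ge0.
  transitivity (\int[leb]_(t in pos) \int[leb]_(r in pos) f (t, r))%E.
    apply: eq_integral => t; rewrite inE => /pos_gt0 t0.
    have mt : measurable (`]0, t[%classic : set (measurableTypeR R)) by exact: measurable_itv.
    have it := integrable_itv t; rewrite /primitive -(RintegralZl _ _ it)//.
    rewrite /Rintegral fineK; last first.
      by apply: integrable_fin_num => //; exact: (integrable_mulr mt (expR (- (l * t))) it).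
    rewrite [LHS]integral_mkcond [RHS]integral_mkcond; apply: eq_integral => r _.
    rewrite /f !patchE !mem_setE !in_itv/= andbT.
    by case: (0 < r) => //=; case: (r < t); rewrite ?mul1r ?mul0r ?mulr0.
  rewrite (tonelli_on mp mp sp sp mf f0); apply: eq_integral => r; rewrite inE => /pos_gt0 r0.
  have [it et] := integrable_expRN_tail r l0.
  have mt : measurable (`]r, +oo[%classic : set (measurableTypeR R)) by exact: measurable_itv.
  rewrite mulrAC -et -(RintegralZr _ _ it)// /Rintegral fineK; last first.
    apply: integrable_fin_num => //.
    have := integrable_mulr mt (h r) it.
    by congr (leb.-integrable _ (EFin \o _)); apply/funext => t; rewrite mulrC.
  rewrite [LHS]integral_mkcond [RHS]integral_mkcond; apply: eq_integral => t _.
  rewrite /f !patchE !mem_setE !in_itv/= !andbT.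
  have [rt|_] := ltP r t; first by rewrite (lt_trans r0 rt) mul1r.
  by rewrite mul0r mulr0; case: ifP.
split; last by rewrite -RintegralZr// /Rintegral e.
apply/integrableP; split; first by apply/measurable_EFinP; exact: measurable_funM.
under eq_integral => t _ do rewrite /= ger0_norm ?mulr_ge0 ?expR_ge0 ?primitive_ge0//.
rewrite e; have := integrable_mulr mp l^-1 il => /integrable_fin_num -/(_ mp).
rewrite ge0_fin_numE.
  by congr (_ < _)%E; apply: eq_integral => r _; rewrite /= mulrC.
apply: integral_ge0 => r /pos_gt0/hM/andP[h0 _].
by rewrite lee_fin mulr_ge0 ?invr_ge0 ?(ltW l0)// mulr_ge0 ?expR_ge0.
Qed.

(** By scaling in the Gamma integral. *)
Lemma Gamma_laplace (rho : R) (k : nat) : 0 <= rho ->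
  leb.-integrable pos (EFin \o (fun u => expR (- u) ^+ k.+1 * u `^ rho)) /\
  \int[leb]_(u in pos) (expR (- u) ^+ k.+1 * u `^ rho) =
  k.+1%:R `^ (- rho) / k.+1%:R * Gamma (rho + 1).
Proof.
move=> rho0; have k0 : 0 < k.+1%:R :> R by [].
have iF := integrable_powR_expR rho0.
have F0 (u : R) : 0 < u -> 0 <= u `^ rho * expR (- u) by rewrite mulr_ge0 ?powR_ge0 ?expR_ge0.
have [i e] := integrable_scale k0 iF F0.
have kE (u : R) : 0 < u -> (k.+1%:R * u) `^ rho * expR (- (k.+1%:R * u)) =
   k.+1%:R `^ rho * (expR (- u) ^+ k.+1 * u `^ rho).
  by move=> u0; rewrite powRM ?(ltW u0)// -expRM_natl mulrN; ring.
have kr0 : 0 < k.+1%:R `^ rho :> R by rewrite powR_gt0.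
have i2 : leb.-integrable pos (EFin \o (fun u => expR (- u) ^+ k.+1 * u `^ rho)).
  apply: (@eq_integrable _ _ _ leb _ mp (EFin \o (fun u => (k.+1%:R `^ rho)^-1 *
      ((k.+1%:R * u) `^ rho * expR (- (k.+1%:R * u)))))).
    by move=> u; rewrite inE => /pos_gt0 u0; rewrite /= kE// mulKf// gt_eqF.
  exact: integrable_mulr i.
split; first exact: i2.
rewrite /Gamma addrK e.
transitivity (k.+1%:R `^ (- rho) * (k.+1%:R `^ rho * \int[leb]_(u in pos) (expR (- u) ^+ k.+1 * u `^ rho))).
  by rewrite powRN mulKf// gt_eqF.
rewrite -mulrA mulKf ?gt_eqF//; congr (_ * _).
by rewrite -RintegralZl//; apply: eq_Rintegral => u; rewrite inE => /pos_gt0 u0; rewrite kE.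
Qed.

(** The integrand is at least exp(- 2) on ]1, 2[. *)
Lemma Gamma_gt0 (rho : R) : 0 <= rho -> 0 < Gamma (rho + 1).
Proof.
move=> rho0; rewrite /Gamma addrK.
have iF := integrable_powR_expR rho0.
pose B := `]1, 2[%classic : set R.
have BE : leb B = 1%E.
  by rewrite /B lebesgue_measure_itv/= lte_fin ltr1n -EFinB; congr EFin; ring.
have mB : measurable (B : set (measurableTypeR R)) by exact: measurable_itv.
have Bp : B `<=` pos.
  by move=> u; rewrite /= !in_itv/= => /andP[u1 _]; rewrite andbT (lt_trans _ u1).
apply: (@lt_le_trans _ _ (\int[leb]_(u in B) expR (- 2))).
  rewrite Rintegral_cst// (_ : fine _ = 1); first by rewrite mulr1 expR_gt0.
  by transitivity (fine (leb B)) => //; rewrite BE.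
apply: (@le_trans _ _ (\int[leb]_(u in B) (u `^ rho * expR (- u)))).
  apply: le_Rintegral => //.
  - by apply: integrable_cst_fin => //; apply: (le_lt_trans _ (ltry 1)); rewrite -BE.
  - exact: (integrableS mp mB Bp iF).
  - move=> u; rewrite /B/= in_itv/= => /andP[u1 u2].
    rewrite -[leLHS]mul1r ler_pM ?expR_ge0//.
      by rewrite -(powRr0 u) ler_powR// ltW.
    by rewrite ler_expR lerN2 ltW.
apply: Rintegral_le_subset => // u /pos_gt0 u0.
by rewrite mulr_ge0 ?powR_ge0 ?expR_ge0.
Qed.

(** Karamata's Tauberian theorem: the functions V_T(u) = primitive(T u) / A(T) are
    nondecreasing, and the hypothesis says that their Laplace transforms at the
    positive integers tend to those of c u^rho / Gamma(rho + 1). Their values at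
    1 then converge as well. *)
Theorem karamata (A : R -> R) (c rho : R) : 0 <= c -> 0 <= rho ->
  (\forall T \near +oo, 0 <= A T) ->
  (forall k : nat, laplace (k.+1%:R / T) / A T @[T --> +oo] --> c * k.+1%:R `^ (- rho)) ->
  primitive T / A T @[T --> +oo] --> c / Gamma (rho + 1).
Proof.
move=> c0 rho0 A0 hA.
have G0 := Gamma_gt0 rho0.
pose V_ T u := primitive (T * u) / A T.
pose V u := c / Gamma (rho + 1) * u `^ rho.
have V1 : V 1 = c / Gamma (rho + 1) by rewrite /V powR1 mulr1.
have V_1 : (fun T => primitive T / A T) = (fun T => V_ T 1).
  by apply/funext => T; rewrite /V_ mulr1.
have scaled T (k : nat) : 0 < T ->
    leb.-integrable pos (EFin \o (fun u => expR (- u) ^+ k.+1 * V_ T u)) /\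
    \int[leb]_(u in pos) (expR (- u) ^+ k.+1 * V_ T u) =
    laplace (k.+1%:R / T) / A T / k.+1%:R.
  move=> T0; have l0 : 0 < k.+1%:R / T by rewrite divr_gt0.
  have [i e] := laplace_primitive l0.
  have [u|i' e'] := integrable_scale T0 i.
    by rewrite mulr_ge0 ?expR_ge0 ?primitive_ge0.
  have tE (u : R) : expR (- (k.+1%:R / T * (T * u))) * primitive (T * u) / A T =
      expR (- u) ^+ k.+1 * V_ T u.
    rewrite /V_ mulrA; congr (_ * _ / _).
    by rewrite -expRM_natl; congr expR; field; rewrite gt_eqF.
  have i2 : leb.-integrable pos (EFin \o (fun u => expR (- u) ^+ k.+1 * V_ T u)).
    have := integrable_mulr mp (A T)^-1 i'.
    by congr (leb.-integrable _ (EFin \o _)); apply/funext => u; rewrite -tE mulrC.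
  split => //.
  transitivity ((A T)^-1 * \int[leb]_(u in pos)
      (expR (- (k.+1%:R / T * (T * u))) * primitive (T * u))).
    by rewrite -RintegralZl//; apply: eq_Rintegral => u _; rewrite -tE mulrC.
  move: e; rewrite e' => e.
  have -> : \int[leb]_(u in pos) (expR (- (k.+1%:R / T * (T * u))) * primitive (T * u)) =
     laplace (k.+1%:R / T) / k.+1%:R.
    apply: (mulfI (lt0r_neq0 T0)); rewrite e; field.
    by rewrite (gt_eqF T0)/= (_ : 1 + k%:R = k.+1%:R) ?pnatr_eq0// -natr1 addrC.
  by rewrite mulrC mulrAC.
rewrite V_1 -V1; apply: monotone_laplace_continuity.
- near=> T.
  have T0 : 0 < T by near: T; exact: nbhs_pinfty_gt.
  have AT : 0 <= A T by near: T.
  split.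
  + move=> u w u0 uw; rewrite /V_ ler_wpM2r ?invr_ge0//.
    by apply: primitive_nondecreasing; rewrite ler_pM2l.
  + by move=> u u0; rewrite /V_ divr_ge0// primitive_ge0.
  + by have [] := scaled T 0%N T0.
- split.
  + move=> u w u0 uw; rewrite /V ler_wpM2l ?divr_ge0 ?(ltW G0)//.
    by apply: ge0_ler_powR; rewrite // ?nnegrE ?(ltW u0)// (le_trans (ltW u0)).
  + by move=> u _; rewrite mulr_ge0 ?powR_ge0// divr_ge0// ltW.
  + have [i _] := Gamma_laplace 0 rho0.
    have := integrable_mulr mp (c / Gamma (rho + 1)) i.
    by congr (leb.-integrable _ (EFin \o _)); apply/funext => u; rewrite /V expr1 mulrCA.
- have cp : {for 1, continuous (fun u : R => u `^ rho)}.
    apply: differentiable_continuous; apply/derivable1_diffP.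
    by have [] := is_derive1_powR rho (@ltr01 R).
  exact: cvgMr.
- move=> k; have [ik ek] := Gamma_laplace k rho0.
  have -> : \int[leb]_(u in pos) (expR (- u) ^+ k.+1 * V u) = c * k.+1%:R `^ (- rho) / k.+1%:R.
    transitivity (c / Gamma (rho + 1) * \int[leb]_(u in pos) (expR (- u) ^+ k.+1 * u `^ rho)).
      by rewrite -RintegralZl//; apply: eq_Rintegral => u _; rewrite mulrCA.
    rewrite ek; field.
    by rewrite (gt_eqF G0)/= (_ : 1 + k%:R = k.+1%:R) ?pnatr_eq0// -natr1 addrC.
  have hk : laplace (k.+1%:R / T) / A T / k.+1%:R @[T --> +oo] -->
      c * k.+1%:R `^ (- rho) / k.+1%:R by apply: cvgMl; exact: hA.
  apply: cvg_trans hk; apply: near_eq_cvg; near=> T.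
  have T0 : 0 < T by near: T; exact: nbhs_pinfty_gt.
  by have [_ ->] := scaled T k T0.
Unshelve. all: by end_near. Qed.

End karamata.

(** * The inverse subordinator *)

Section inverse_process.
Variables (R : realType) (d : measure_display) (T : measurableType d).
Variables (P : probability T R) (S : R -> {RV P >-> R}).
Variables (sigma : {measure set (measurableTypeR R) -> \bar R}) (G : R -> R -> R).
Hypothesis hS : subordinator S sigma.
Hypothesis hG : inverse_density S G.
Local Notation leb := (@lebesgue_measure R).
Local Notation pos := (`]0%R, +oo[%classic : set R).
Local Notation Phi := (laplace_exponent sigma).
Implicit Types (r tau lambda : R).

Let mp : measurable (pos : set (measurableTypeR R)) := @measurable_pos R.

(** The distribution function in tau of the first passage time E_r, expressed by
    the process itself. *)
Definition hit r tau : R := fine (P [set w | r <= S tau w]).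

Let measurable_hit r tau : measurable [set w | r <= S tau w].
Proof.
have mS : measurable_fun setT (S tau) by exact: measurable_funPT.
rewrite (_ : [set w | _] = setT `&` S tau @^-1` `[r, +oo[%classic).
  by apply: mS => //; exact: measurable_itv.
by rewrite setTI; apply/seteqP; split => w /=; rewrite in_itv/= andbT.
Qed.

Lemma hitE r tau : P [set w | r <= S tau w] = (hit r tau)%:E.
Proof. by rewrite /hit fineK// fin_num_measure//; exact: measurable_hit. Qed.

Lemma hit_ge0 r tau : 0 <= hit r tau.
Proof. by rewrite /hit fine_ge0. Qed.

Lemma hit_le1 r tau : hit r tau <= 1.
Proof. by rewrite -lee_fin -hitE probability_le1//; exact: measurable_hit. Qed.

Lemma hit_nonincreasing tau r r' : r <= r' -> hit r' tau <= hit r tau.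
Proof.
move=> rr; rewrite -lee_fin -!hitE le_measure ?inE//; try exact: measurable_hit.
by move=> w /=; exact: le_trans.
Qed.

Lemma hit_nondecreasing r tau tau' : 0 <= tau -> tau <= tau' -> hit r tau <= hit r tau'.
Proof.
move=> tau0 tt; rewrite -lee_fin -!hitE le_measure ?inE//; try exact: measurable_hit.
by move=> w /= /le_trans; apply; exact: (sub_nondecreasing hS).
Qed.

Lemma hit0 r : 0 < r -> hit r 0 = 0.
Proof.
move=> r0; rewrite /hit (_ : [set w | _] = set0) ?measure0//.
by apply/seteqP; split => w //=; rewrite (levy0 (sub_levy hS)) leNgt r0.
Qed.

Lemma measurable_hitr tau : measurable_fun setT (hit ^~ tau).
Proof.
rewrite -[X in measurable_fun _ X]opprK; apply: measurable_funN.
apply: nondecreasing_measurable => // r r' rr; rewrite lerN2; exact: hit_nonincreasing.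
Qed.

(** Right-continuity makes the infimum attained. *)
Lemma inverse_subordinator_le r tau w : 0 <= tau ->
  (inverse_subordinator S r w <= tau%:E)%E <-> r <= S tau w.
Proof.
move=> tau0; split => [h|h]; last by apply: ereal_inf_lbound; exists tau.
have rc := @levy_right_continuous _ _ _ _ _ (sub_levy hS) w _ tau0.
apply: (cvgr_to_ge rc).
near=> u.
have tu : tau < u by near: u; exact: nbhs_right_gt.
have /ereal_inf_lt[_ [t [t0 rt] <-]] : (inverse_subordinator S r w < u%:E)%E.
  by rewrite (le_lt_trans h)// lte_fin.
rewrite lte_fin => tu'; rewrite (le_trans rt)//.
by apply: (sub_nondecreasing hS) => //; exact: ltW.
Unshelve. all: by end_near. Qed.

Lemma hit_density r tau : 0 < r -> 0 <= tau ->
  (\int[leb]_(u in `]0%R, tau]) (G r u)%:E = (hit r tau)%:E)%E.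
Proof.
move=> r0 tau0; have [_ _ <-//] := hG r0; rewrite -hitE; congr (P _).
by apply/seteqP; split => w /= /inverse_subordinator_le; apply.
Qed.

(** By monotone convergence along ]0, n], the total mass of the density is the
    limit of probabilities. *)
Lemma integrable_density r : 0 < r -> leb.-integrable pos (EFin \o G r).
Proof.
move=> r0; have [mG G0 _] := hG r0.
have mE : measurable_fun pos (EFin \o G r) by exact/measurable_EFinP.
apply/integrableP; split => //.
rewrite (_ : (\int[leb]_(x in pos) _)%E = (\int[leb]_(u in pos) (G r u)%:E)%E); last first.
  by apply: eq_integral => u; rewrite inE => /pos_gt0 u0; rewrite /= ger0_norm ?G0.
pose F (n : nat) : set R := `]0, n%:R]%classic.
have FE : pos = \bigcup_n F n.
  apply/seteqP; split => [u /pos_gt0 u0|u [n _]]; last first.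
    by rewrite /F/= !in_itv/= => /andP[->].
  exists (Num.trunc u).+1 => //; rewrite /F/= in_itv/= u0/= ltW//; exact: truncnS_gt.
have Fp n : F n `<=` pos by rewrite FE; apply: bigcup_sup.
have h : (\int[leb]_(u in F n) (G r u)%:E @[n --> \oo] --> \int[leb]_(u in \bigcup_n F n) (G r u)%:E)%E.
  apply: ge0_nondecreasing_set_cvg_integral.
  - apply/nondecreasing_seqP => n; rewrite subsetEset => u; rewrite /F/= !in_itv/= => /andP[-> un].
    by rewrite (le_trans un)// ler_nat.
  - by move=> n; exact: measurable_itv.
  - by move=> n; apply: measurable_funS mE.
  - by move=> n u /Fp /pos_gt0 u0; rewrite lee_fin G0.
rewrite FE -(cvg_lim _ h)//; apply: (@le_lt_trans _ _ 1%E); last exact: ltry.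
apply: lime_le; first by apply/cvg_ex; eexists; exact: h.
by apply: nearW => n; rewrite /F hit_density// lee_fin hit_le1.
Qed.

Lemma density_hit r tau : 0 < r -> 0 <= tau ->
  hit r tau = \int[leb]_(u in `]0, tau]) G r u.
Proof. by move=> r0 tau0; rewrite /Rintegral hit_density. Qed.

(** Layer cake for the random variable S_tau, whose Laplace transform is
    exp(- tau Phi). *)
Lemma laplace_hit lambda tau : 0 < lambda -> 0 <= tau ->
  leb.-integrable pos (EFin \o (fun r => expR (- (lambda * r)) * hit r tau)) /\
  \int[leb]_(r in pos) (expR (- (lambda * r)) * hit r tau) =
  (1 - expR (- (tau * Phi lambda))) / lambda.
Proof.
move=> l0 tau0; have S0 w : 0 <= S tau w by exact: (sub_ge0 hS).
have mS : measurable_fun setT (S tau) by exact: measurable_funPT.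
have i1 : P.-integrable setT (EFin \o (fun=> 1 : R)) by exact: finite_measure_integrable_cst.
split.
  have [ie _] := integrable_expRN l0; apply: (integrable_le mp _ ie).
    apply: measurable_funM; first exact: integrable_measurable ie.
    exact: measurable_funTS (measurable_hitr tau).
  by move=> r _; rewrite ger0_norm ?mulr_ge0 ?expR_ge0 ?hit_ge0// ler_piMr ?expR_ge0 ?hit_le1.
transitivity (\int[P]_w ((1 - expR (- (lambda * S tau w))) / lambda)).
  rewrite /Rintegral; congr fine.
  rewrite -(laplace_tail false measurableT (sigma_finiteT P) mS (fun w _ => S0 w) l0).
  by apply: eq_integral => r _; rewrite setTI EFinM -hitE.
have ie : P.-integrable setT (EFin \o (fun w => expR (- (lambda * S tau w)))).
  apply: (integrable_le measurableT _ i1).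
    by apply: (measurableT_comp (@measurable_expR R)); apply: measurable_funN; exact: measurable_funM.
  move=> w _; rewrite ger0_norm ?expR_ge0// -[leRHS]expR0 ler_expR oppr_le0.
  by rewrite mulr_ge0// ltW.
rewrite RintegralZr//; last exact: integrable_sub.
rewrite (RintegralB measurableT i1 ie); congr ((_ - _) / _).
  rewrite Rintegral_cst// (_ : fine _ = 1) ?mul1r//.
  by transitivity (fine (P setT)) => //; rewrite probability_setT.
have := sub_laplace hS (ltW l0) tau0.
by rewrite unlock /Rintegral => ->.
Qed.

(** Markov's inequality for the function min(1, u). *)
Lemma levy_tail_fin (t : R) : 0 < t -> (sigma `]t, +oo[%classic < +oo)%E.
Proof.
move=> t0; have h := sub_levy_measure hS.
have mt : measurable (`]t, +oo[%classic : set (measurableTypeR R)) by exact: measurable_itv.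
pose c := Num.min 1 t; have c0 : 0 < c by rewrite lt_min ltr01.
have mm : measurable_fun pos (fun u : R => (Num.min 1 u)%:E).
  by apply/measurable_EFinP; apply: measurable_minr.
have h1 : (c%:E * sigma `]t, +oo[%classic <= \int[sigma]_(tau in pos) (Num.min 1 tau)%:E)%E.
  rewrite -integral_cst//; apply: (@le_trans _ _ (\int[sigma]_(tau in `]t, +oo[) (Num.min 1 tau)%:E)%E).
    apply: ge0_le_integral => //.
    - by move=> u _; rewrite lee_fin ltW.
    - by apply: measurable_funS mm => // u; rewrite /= !in_itv/= !andbT; exact: lt_trans.
    - by move=> u; rewrite /= in_itv/= andbT => tu; rewrite lee_fin le_min !ge_min lexx (ltW tu) orbT.
  apply: ge0_subset_integral => //.
  - by move=> u /pos_gt0 u0; rewrite lee_fin le_min ler01 ltW.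
  - by move=> u; rewrite /= !in_itv/= !andbT; exact: lt_trans.
have : (c%:E * sigma `]t, +oo[%classic < +oo)%E by exact: le_lt_trans h1 h.
have := measure_ge0 sigma `]t, +oo[%classic.
by case: (sigma _) => [r _ _|_|//]; rewrite ?ltry// gt0_muley ?lte_fin// ltxx.
Qed.

(** Layer cake for the identity under the Levy measure. *)
Lemma laplace_exponentE lambda : 0 < lambda ->
  Phi lambda = lambda * laplace_transform (levy_kernel sigma) lambda.
Proof.
move=> l0.
have sp : sigma_finite pos sigma.
  exists (fun n => `]n.+1%:R^-1, +oo[%classic).
    apply/seteqP; split => [u /pos_gt0 u0|u [n _]]; last first.
      by rewrite /= !in_itv/= !andbT; exact: lt_trans.
    exists (Num.trunc u^-1) => //; rewrite /= in_itv/= andbT.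
    by rewrite invf_plt ?posrE//; exact: truncnS_gt.
  by move=> n; split; [exact: measurable_itv|exact: levy_tail_fin].
have mid : measurable_fun pos (fun u : R => u) by exact: measurable_id.
have e : \int[leb]_(t in pos) (expR (- (lambda * t)) * levy_kernel sigma t) =
  \int[sigma]_(u in pos) ((1 - expR (- (lambda * u))) / lambda).
  rewrite /Rintegral; congr fine.
  rewrite -(laplace_tail true mp sp mid (fun u u0 => ltW (pos_gt0 u0)) l0).
  apply: eq_integral => t; rewrite inE => /pos_gt0 t0.
  rewrite EFinM /levy_kernel fineK ?ge0_fin_numE ?levy_tail_fin//; congr (_ * sigma _)%E.
  apply/seteqP; split => u /=; rewrite !in_itv/= !andbT; last by case.
  by move=> tu; split => //; exact: lt_trans tu.
have i1 : sigma.-integrable pos (EFin \o (fun u => 1 - expR (- (lambda * u)))).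
  have im : sigma.-integrable pos (EFin \o (fun u : R => Num.min 1 u)).
    apply/integrableP; split.
      by apply/measurable_EFinP; apply: measurable_minr.
    apply: le_lt_trans (sub_levy_measure hS); rewrite le_eqVlt; apply/orP; left; apply/eqP.
    apply: eq_integral => u; rewrite inE => /pos_gt0 u0; rewrite /= ger0_norm//.
    by rewrite le_min ler01 ltW.
  apply: (integrable_le mp _ (integrable_mulr mp (1 + lambda) im)).
    apply: measurable_funB => //; apply: measurable_funTS.
    by apply: (measurableT_comp (@measurable_expR R)); apply: measurable_funN; exact: measurable_funM.
  move=> u /pos_gt0 u0; have lu : 0 < lambda * u by rewrite mulr_gt0.
  have e1 : 1 - lambda * u <= expR (- (lambda * u)) := expR_ge1Dx _.
  have e2 : expR (- (lambda * u)) <= 1 by rewrite -[leRHS]expR0 ler_expR oppr_le0 ltW.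
  rewrite ger0_norm ?subr_ge0//; have e3 := expR_gt0 (- (lambda * u)).
  by have [u1|u1] := leP 1 u; nra.
by rewrite /laplace_transform e RintegralZr// mulrC divfK ?gt_eqF.
Qed.

Section subordinated_function.
Variables (f : R -> R) (M : R).
Hypothesis fM : forall t, 0 < t -> 0 <= f t <= M.
Hypothesis cf : forall t : R, 0 < t -> {for t, continuous f}.

Let M0 : 0 <= M.
Proof. by have /andP[h0 h1] := fM ltr01; exact: le_trans h1. Qed.

Lemma cvg_subordinated r : 0 < r ->
  stepsum f n (hit r) @[n --> \oo] --> subordinated f G r.
Proof.
move=> r0; apply: (cvg_stepsum fM cf (integrable_density r0)) => t t0.
exact: density_hit.
Qed.

Lemma stepsum_hit_bound r n : 0 < r -> 0 <= stepsum f n (hit r) <= M.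
Proof.
move=> r0; have /andP[h0 h1] := stepsum_bound fM n (@hit_nondecreasing r).
by rewrite h0 (le_trans h1)// hit0// subr0 ler_piMr// hit_le1.
Qed.

Lemma subordinated_bound r : 0 < r -> 0 <= subordinated f G r <= M.
Proof.
move=> r0; have c := cvg_subordinated r0; apply/andP; split.
  by apply: (cvgr_to_ge c); apply: nearW => n; have /andP[] := stepsum_hit_bound n r0.
by apply: (cvgr_to_le c); apply: nearW => n; have /andP[] := stepsum_hit_bound n r0.
Qed.

Let measurable_stepsum n : measurable_fun pos (fun r => stepsum f n (hit r)).
Proof.
rewrite /stepsum; apply: measurable_sum => k; apply: measurable_funM => //.
by apply: measurable_funB; apply: measurable_funTS; exact: measurable_hitr.
Qed.

(** The densities G_r for different r are only related through the distribution
    functions; measurability in r comes from the step sums, which involve the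
    monotone functions r |-> P(S_tau >= r). *)
Lemma measurable_subordinated : measurable_fun pos (subordinated f G).
Proof.
apply: (measurable_fun_cvg (h := fun n r => stepsum f n (hit r))) => // r /pos_gt0.
exact: cvg_subordinated.
Qed.

(** The Laplace transform in r of the step sums of f against P(S_tau >= r) is the
    step sum of f against (1 - exp(- tau Phi(lambda))) / lambda. Letting the mesh
    tend to 0 on both sides gives the Laplace transform of the subordinated
    function. *)
Theorem laplace_subordinated lambda : 0 < lambda -> 0 < Phi lambda ->
  laplace (subordinated f G) lambda =
  Phi lambda / lambda * \int[leb]_(t in pos) (f t * expR (- (Phi lambda * t))).
Proof.
move=> l0 p0; have [iel _] := integrable_expRN l0; have [iep _] := integrable_expRN p0.
pose c := Phi lambda / lambda; have c0 : 0 < c by rewrite divr_gt0.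
have h1 : \int[leb]_(r in pos) (expR (- (lambda * r)) * stepsum f n (hit r)) @[n --> \oo] -->
    laplace (subordinated f G) lambda.
  refine (proj2 (@Rintegral_dct _ _ _ leb pos mp _ _ (fun r => M * expR (- (lambda * r))) _ _ _ _)).
  - by move=> n; apply: measurable_funM; [exact: integrable_measurable iel|exact: measurable_stepsum].
  - by move=> r /pos_gt0 r0; apply: cvgMr; exact: cvg_subordinated.
  - exact: integrable_mulr.
  - move=> n r /pos_gt0 r0; have /andP[s0 s1] := stepsum_hit_bound n r0.
    by rewrite ger0_norm ?mulr_ge0 ?expR_ge0// mulrC ler_wpM2r ?expR_ge0.
pose H tau := (1 - expR (- (tau * Phi lambda))) / lambda.
have e n : \int[leb]_(r in pos) (expR (- (lambda * r)) * stepsum f n (hit r)) = stepsum f n H.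
  pose F k (r : R) := f (grid R n k.+1) * (expR (- (lambda * r)) * hit r (grid R n k.+1)
      - expR (- (lambda * r)) * hit r (grid R n k)).
  have iB k : leb.-integrable pos (EFin \o (fun r => expR (- (lambda * r)) * hit r (grid R n k.+1)
      - expR (- (lambda * r)) * hit r (grid R n k))).
    have [i1 _] := laplace_hit l0 (grid_ge0 R n k.+1).
    have [i2 _] := laplace_hit l0 (grid_ge0 R n k).
    exact: integrable_sub.
  have iF k : leb.-integrable pos (EFin \o F k) by exact: integrable_mulr.
  have [_ h] := Rintegral_sum (n.+1 ^ 2) mp iF.
  transitivity (\int[leb]_(r in pos) (\sum_(k < n.+1 ^ 2) F k r)).
    apply: eq_Rintegral => r _; rewrite /stepsum mulr_sumr; apply: eq_bigr => k _.
    by rewrite /F; ring.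
  rewrite h; apply: eq_bigr => k _.
  rewrite RintegralZl//; congr (_ * _).
  have [i1 e1] := laplace_hit l0 (grid_ge0 R n k.+1).
  have [i2 e2] := laplace_hit l0 (grid_ge0 R n k).
  by rewrite (RintegralB mp i1 i2) e1 e2.
have h2 : stepsum f n H @[n --> \oo] -->
   \int[leb]_(t in pos) (f t * (c * expR (- (Phi lambda * t)))).
  apply: (cvg_stepsum fM cf); first exact: integrable_mulr.
  move=> t t0; have [it et] := integrable_expRN_itv false p0 t0.
  rewrite RintegralZl//.
  rewrite et /H /c [t * _]mulrC; field.
  by rewrite !gt_eqF.
have ifp : leb.-integrable pos (EFin \o (fun t => f t * expR (- (Phi lambda * t)))).
  apply: (integrable_mulb mp (M := M)) => //.
    apply: (measurable_fun_cvg (h := fun n t => stepf f n t)) => //.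
      by move=> n; exact: measurable_funTS (measurable_stepf f n).
    by move=> t /pos_gt0; exact: cvg_stepf.
  by move=> t /pos_gt0/fM/andP[f0 f1]; rewrite ger0_norm.
have <- : \int[leb]_(t in pos) (f t * (c * expR (- (Phi lambda * t)))) =
   c * \int[leb]_(t in pos) (f t * expR (- (Phi lambda * t))).
  by rewrite -RintegralZl//; apply: eq_Rintegral => t _; rewrite mulrCA.
have ee := funext e; rewrite /= in ee; rewrite ee in h1.
exact: (cvg_unique _ h1 h2).
Qed.

End subordinated_function.
End inverse_process.

(** * Cesaro means of subordinated functions *)

Section cesaro.
Variables (R : realType) (d : measure_display) (T : measurableType d).
Variables (P : probability T R) (S : R -> {RV P >-> R}).
Variables (sigma : {measure set (measurableTypeR R) -> \bar R}) (G : R -> R -> R).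
Hypothesis hS : subordinator S sigma.
Hypothesis hG : inverse_density S G.
Local Notation leb := (@lebesgue_measure R).
Local Notation pos := (`]0%R, +oo[%classic : set R).
Local Notation Phi := (laplace_exponent sigma).
Local Notation K := (laplace_transform (levy_kernel sigma)).
Variables (f : R -> R) (M : R).
Hypothesis fM : forall t, 0 < t -> 0 <= f t <= M.
Hypothesis cf : forall t : R, 0 < t -> {for t, continuous f}.
Hypothesis intf : leb.-integrable pos (EFin \o f).

Let mp : measurable (pos : set (measurableTypeR R)) := @measurable_pos R.

(** Dominated convergence, f itself being the dominating function. *)
Lemma cvg_laplace0 :
  \int[leb]_(t in pos) (f t * expR (- (p * t))) @[p --> 0^'+] -->
  \int[leb]_(t in pos) f t.
Proof.
apply/cvg_at_rightP => u [u0 uc].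
have mf := integrable_measurable intf.
refine (proj2 (@Rintegral_dct _ _ _ leb pos mp _ _ f _ _ intf _)).
- move=> n; apply: measurable_funM => //; apply: measurable_funTS.
  by apply: (measurableT_comp (@measurable_expR R)); apply: measurable_funN; exact: measurable_funM.
- move=> t _; rewrite -[f t in X in _ --> X]mulr1 -expR0 -oppr0 -(mul0r t).
  apply: cvgMr; apply: continuous_cvg; first exact: continuous_expR.
  by apply: cvgN; apply: cvgMl.
- move=> n t /pos_gt0 t0; have /andP[f0 _] := fM t0.
  rewrite ger0_norm ?mulr_ge0 ?expR_ge0// ler_piMr// -[leRHS]expR0 ler_expR oppr_le0.
  by rewrite mulr_ge0// ltW.
Qed.

(** The Laplace transform of the subordinated function at (k + 1) / T is
    K((k + 1) / T) times the Laplace transform of f at Phi((k + 1) / T). The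
    second factor tends to the norm of f since Phi tends to 0, and the first one,
    divided by K(1 / T), to (k + 1)^(- rho) by regular variation: Karamata's
    theorem applies with A(T) = K(1 / T). *)
Theorem cesaro_subordinated (rho : R) :
  let L := fun y : R => y `^ (- rho) * K y^-1 in
  lambda * K lambda @[lambda --> 0^'+] --> (0 : R) ->
  0 <= rho -> slowly_varying L -> 0 < L1_norm_time f ->
  asymp_equiv (cesaro_mean (subordinated f G))
    (fun t => L1_norm_time f / Gamma (rho + 1) * t `^ (rho - 1) * L t).
Proof.
move=> L hK rho0 sv nf0.
have nfE : L1_norm_time f = \int[leb]_(t in pos) f t.
  apply: eq_Rintegral => t; rewrite inE => /pos_gt0 t0.
  by rewrite ger0_norm//; have /andP[] := fM t0.
have G0 := Gamma_gt0 rho0.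
have K0 l : 0 <= K l.
  by apply: Rintegral_ge0 => t _; rewrite mulr_ge0 ?expR_ge0// fine_ge0.
(* Slow variation forces L to be nonzero eventually: L x / L x tends to 1, whereas
   the quotient is 0 where L x = 0. *)
have L0 : \forall x \near +oo, L x != 0.
  have h2 : (0 : R) < 1 by [].
  have /cvgrPdist_lt/(_ _ h2) := sv 1 ltr01; apply: filterS => x.
  by apply: contraTneq => ->; rewrite invr0 mulr0 subr0 normr1 ltxx.
have KV0 : \forall x \near +oo, 0 < K x^-1.
  by apply: filterS L0 => x; rewrite lt_def K0 andbT; apply: contraNneq; rewrite /L => ->; rewrite mulr0.
have KE (k : nat) : \forall x \near +oo, 0 < K (k.+1%:R / x).
  have [B [_ hB]] := KV0; near=> x; rewrite -invf_div; apply: hB.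
  by rewrite ltr_pdivlMr//; near: x; apply: nbhs_pinfty_gt; rewrite num_real.
have bnd r : 0 < r -> 0 <= subordinated f G r <= M by move=> r0; exact: (subordinated_bound hS hG fM cf).
have ms : measurable_fun pos (subordinated f G) by exact: (measurable_subordinated hS hG fM cf).
pose A x := K x^-1.
have Kar : primitive (subordinated f G) x / A x @[x --> +oo] --> L1_norm_time f / Gamma (rho + 1).
  apply: (karamata ms bnd) => //; first exact: ltW.
    by apply: nearW => x; exact: K0.
  move=> k; rewrite mulrC nfE.
  have h1 : K (k.+1%:R / x) / A x @[x --> +oo] --> k.+1%:R `^ (- rho).
    have k0 : (0 : R) < k.+1%:R^-1 by [].
    have h := sv _ k0.
    have h' : k.+1%:R `^ (- rho) * (L (k.+1%:R^-1 * x) / L x) @[x --> +oo] --> k.+1%:R `^ (- rho).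
      by rewrite -[X in _ --> X]mulr1; exact: cvgMr.
    apply: cvg_trans h'; apply: near_eq_cvg; near=> x.
    have x0 : 0 < x by near: x; exact: nbhs_pinfty_gt.
    have Lx : L x != 0 by near: x.
    have xr : 0 < x `^ (- rho) by rewrite powR_gt0.
    rewrite /L /A powRM ?invr_ge0 ?(ltW x0)// invfM invrK.
    rewrite -powR_inv1// -powRrM mulN1r opprK powRN.
    have kr : 0 < k.+1%:R `^ rho :> R by rewrite powR_gt0.
    have Kx : K x^-1 != 0 by move: Lx; rewrite /L mulf_eq0 negb_or => /andP[].
    move: (K x^-1) (K _) (_ `^ rho) Kx kr (x `^ _) xr => a b r a0 r0 y y0.
    by field; rewrite a0 !gt_eqF.
  have h2 : \int[leb]_(t in pos) (f t * expR (- (Phi (k.+1%:R / x) * t))) @[x --> +oo] -->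
      \int[leb]_(t in pos) f t.
    apply: (@cvg_comp _ _ _ (fun x => Phi (k.+1%:R / x))
      (fun p => \int[leb]_(t in pos) (f t * expR (- (p * t)))) _ 0^'+ _ _ cvg_laplace0).
    apply: cvg_at_right_of.
      near=> x; have x0 : 0 < x by near: x; exact: nbhs_pinfty_gt.
      rewrite (laplace_exponentE hS) ?divr_gt0// mulr_gt0 ?divr_gt0//; near: x; exact: KE.
    have c := @cvg_comp _ _ _ _ _ _ _ _ (cvg_divy (ltr0Sn R k)) hK.
    apply: cvg_trans c; apply: near_eq_cvg; near=> x.
    have x0 : 0 < x by near: x; exact: nbhs_pinfty_gt.
    by rewrite /= (laplace_exponentE hS) ?divr_gt0.
  have h3 : K (k.+1%:R / x) / A x * \int[leb]_(t in pos) (f t * expR (- (Phi (k.+1%:R / x) * t)))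
      @[x --> +oo] --> k.+1%:R `^ (- rho) * \int[leb]_(t in pos) f t by exact: cvgM.
  apply: cvg_trans h3; apply: near_eq_cvg; near=> x.
  have x0 : 0 < x by near: x; exact: nbhs_pinfty_gt.
  have kx : 0 < k.+1%:R / x by rewrite divr_gt0.
  have Kx : 0 < K (k.+1%:R / x) by near: x; exact: KE.
  have Px : 0 < Phi (k.+1%:R / x) by rewrite (laplace_exponentE hS)// mulr_gt0.
  have PK : Phi (k.+1%:R / x) / (k.+1%:R / x) = K (k.+1%:R / x).
    by rewrite (laplace_exponentE hS kx) mulrC mulKf// gt_eqF.
  by rewrite (laplace_subordinated hS hG fM cf kx Px) PK mulrAC.
pose C := L1_norm_time f / Gamma (rho + 1).
have c0 : C != 0 by rewrite gt_eqF// divr_gt0.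
have Kar1 : primitive (subordinated f G) x / A x / C @[x --> +oo] --> C / C by exact: cvgMl.
rewrite divff// in Kar1.
rewrite /asymp_equiv; apply: cvg_trans Kar1; apply: near_eq_cvg; near=> x.
have x0 : 0 < x by near: x; exact: nbhs_pinfty_gt.
have Kx : 0 < K x^-1 by near: x.
rewrite /cesaro_mean -/(primitive _ x) /A /L.
rewrite -/C; have -> : C * x `^ (rho - 1) * (x `^ (- rho) * K x^-1) = C * (x^-1 * K x^-1).
  rewrite -mulrA; congr (_ * _); rewrite mulrA; congr (_ * _).
  rewrite -powRD; last by apply/implyP => _; rewrite gt_eqF.
  by rewrite (_ : rho - 1 + - rho = -1) ?powR_inv1 ?(ltW x0)//; ring.
move: (primitive _ x) (K x^-1) Kx => p k k0.
by field; rewrite (gt_eqF x0) (gt_eqF k0) c0.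
Unshelve. all: by end_near. Qed.

End cesaro.

(** * Reduction to a bounded initial datum *)

Section initial_datum.
Variables (R : realType) (N : nat) (gamma s : R).
Variables (phi phi' : 'rV[R]_N -> R) (v : 'rV[R]_N -> R -> R).
Local Notation mu := (@lebesgue_rV R N).

(** The initial condition only involves phi up to null sets, so phi may be replaced
    by a representative with values in [0, M]. *)
Lemma cauchy_solution_ae : measurable_fun setT phi -> measurable_fun setT phi' ->
  {ae mu, forall x, phi x = phi' x} ->
  cauchy_solution gamma s phi v -> cauchy_solution gamma s phi' v.
Proof.
move=> mp mp' pp [h1 h2 h3 h4 h5 h6 h7 h8]; split => //.
  by apply: filterS2 pp h7 => x -> .
apply: cvg_trans h8; apply: near_eq_cvg; near=> t.
have t0 : 0 <= t by near: t; apply: filterS (nbhs_right_gt _) => u; exact: ltW.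
have iv : integrableR (v ^~ t) by apply/Lfun1_integrable; exact: h1.
have mv := integrable_measurable iv.
apply: ae_eq_integral => //.
- by apply/measurable_EFinP; apply: measurableT_comp => //; exact: measurable_funB.
- by apply/measurable_EFinP; apply: measurableT_comp => //; exact: measurable_funB.
- by apply: filterS pp => x e _; rewrite e.
Unshelve. all: by end_near. Qed.

(** The essential supremum of |phi| bounds it almost everywhere. When the whole
    space is a null set the norm takes a conventional value and any bound
    will do. *)
Lemma Lfun_oo_bounded : phi \in Lfun mu +oo%E ->
  exists M : R, {ae mu, forall x, `|phi x| <= M}.
Proof.
move=> /andP[_]; rewrite inE/= /finite_norm unlock.
case: ifPn => [_ /(@ess_supr_bounded _ _ _ _ (fun x => `|phi x|))//|].
rewrite -leNgt => m0 _; exists 0; exists setT; split => //.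
by apply/eqP; rewrite eq_le m0 measure_ge0.
Qed.

End initial_datum.

Theorem theorem1p3 (R : realType) (N : nat) (gamma s : R)
    (phi : 'rV[R]_N -> R) (v : 'rV[R]_N -> R -> R) :
  (1 <= N)%N -> 0 <= gamma -> 0 < s < 1 -> s < N%:R * (gamma + 1) / 2 ->
  phi \in Lfun (lebesgue_rV N) 1%E -> phi \in Lfun (lebesgue_rV N) +oo%E ->
  {ae lebesgue_rV N, forall x, 0 <= phi x} ->
  cauchy_solution gamma s phi v ->
  [/\ forall x t, 0 < t -> 0 <= v x t,
      forall x, lebesgue_measure.-integrable `]0, +oo[ (EFin \o v x) &
      ~ {ae lebesgue_rV N, forall x, phi x = 0} ->
      forall (d : measure_display) (T : measurableType d)
        (P : probability T R) (S : R -> {RV P >-> R})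
        (sigma : {measure set (measurableTypeR R) -> \bar R})
        (G : R -> R -> R) (rho : R),
      let k := levy_kernel sigma in
      let K := laplace_transform k in
      let L := fun y : R => y `^ (- rho) * K y^-1 in
      subordinator S sigma -> admissible_kernel k -> inverse_density S G ->
      lambda * K lambda @[lambda --> 0^'+] --> (0 : R) ->
      0 <= rho -> slowly_varying L ->
      forall x, asymp_equiv (cesaro_mean (subordinated (v x) G))
        (fun t => L1_norm_time (v x) / Gamma (rho + 1) *
                  t `^ (rho - 1) * L t)].
Proof.
move=> N0 gamma0 s01 sN phi1 phioo phi0 sol.
have iphi : integrableR phi by apply/Lfun1_integrable.
have mphi := integrable_measurable iphi.
have [M hM] := Lfun_oo_bounded phioo.
pose M' := Num.max 0 M.
have M'0 : 0 <= M' by rewrite le_max lexx.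
pose phi' x := Num.min M' (Num.max 0 (phi x)).
have phi'M x : 0 <= phi' x <= M' by rewrite /phi' le_min M'0 le_max lexx/= ge_min lexx.
have mphi' : measurable_fun setT phi' by apply: measurable_minr => //; exact: measurable_maxr.
have e : {ae lebesgue_rV N, forall x, phi x = phi' x}.
  apply: filterS2 phi0 hM => x x0 xM; rewrite /phi' (max_idPr x0); apply/esym/min_idPr.
  by rewrite le_max (le_trans _ xM) ?orbT// ler_norm.
have sol' := cauchy_solution_ae mphi mphi' e sol.
have iphi' : integrableR phi'.
  apply: (integrable_le measurableT mphi' (integrableR_normr iphi)) => x _.
  have /andP[p0 _] := phi'M x; rewrite ger0_norm// /phi' ge_min; apply/orP; right.
  by rewrite ge_max normr_ge0 ler_norm.
split.
- by move=> x t t0; have /andP[] := solution_bound gamma0 s01 iphi' phi'M sol' x t0.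
- by move=> x; exact: (solution_integrable N0 gamma0 s01 sN iphi' phi'M sol').
move=> phi_neq0 d T P S sigma G rho k K L hS _ hG hK rho0 sv x.
have phi'_neq0 : ~ {ae lebesgue_rV N, forall x, phi' x = 0}.
  by move=> h; apply: phi_neq0; apply: filterS2 e h => y -> .
apply: (cesaro_subordinated hS hG (M := M')) => //.
- by move=> t; exact: (solution_bound gamma0 s01 iphi' phi'M sol').
- by move=> t t0; exact: (solution_continuous sol').
- exact: (solution_integrable N0 gamma0 s01 sN iphi' phi'M sol').
- exact: (solution_L1_gt0 N0 gamma0 s01 sN iphi' phi'M sol').
Qed.
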